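(* Let $r\ge1$ be an integer, let $\lambda=(\lambda_1\ge\dots\ge\lambda_r)\in\mathbb Z_{\ge0}^{r}$ and let $g\in Sp_{2r}(\mathbb C)$. Put $\ell=\lambda+\rho$, i.e. $\ell_i=\lambda_i+r+1-i$. Then $$\sum_{\sigma\in\mathfrak W}(-1)^\sigma g^{\sigma\ell}=\chi_\lambda(g)\cdot\sum_{\sigma\in\mathfrak W}(-1)^\sigma g^{\sigma\rho};$$ equivalently, $$\bigwedge_{i=1}^{r}\left(g^{\ell_i}-g^{-\ell_i}\right)=\chi_\lambda(g)\cdot\bigwedge_{i=1}^{r}\left(g^{r+1-i}-g^{-(r+1-i)}\right).$$
   Context: $Sp_{2r}(\mathbb C)$ is the group of linear transformations of $\mathbb C^{2r}$, with coordinates ordered $(x_1,y_1,\dots,x_r,y_r)$, preserving the skew bilinear form $\sum_{i=1}^r(x_i'y_i''-y_i'x_i'')$. Its maximal torus $H$ consists of the matrices $\mathrm{diag}(z_1,z_1^{-1},\dots,z_r,z_r^{-1})$; the weight lattice of $H$ is $\mathbb Z^r$, with $\lambda=(\lambda_1,\dots,\lambda_r)$ corresponding to the character $\prod_j z_j^{\lambda_j}$. The half-sum of the positive roots is $\rho=(r,r-1,\dots,1)$ (positive roots: $e_i\pm e_j$ for $i<j$, and $2e_i$, where $e_1,\dots,e_r$ is the standard basis of $\mathbb Z^r$). $\chi_\lambda$ is the character of the irreducible representation of $Sp_{2r}(\mathbb C)$ with highest weight $\lambda$. The Weyl group $\mathfrak W$ is the semidirect product of $\mathfrak S_r$ and $(\mathbb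 Z/2)^r$, acting on $\mathbb Z^r$ by permutations of the coordinates and arbitrary sign changes; $(-1)^\sigma$ is the determinant of $\sigma$ acting on $\mathbb Z^r$. For $\ell\in\mathbb Z^r$, $g^\ell=g^{\ell_1}\otimes\dots\otimes g^{\ell_r}\in M_{2r}(\mathbb C)^{\otimes r}$, where $M_{2r}(\mathbb C)$ is the space of $2r\times 2r$ complex matrices. The wedge product is the antisymmetrized tensor $\bigwedge_{i=1}^rA_i=\sum_{\tau\in\mathfrak S_r}(-1)^\tau A_{\tau(1)}\otimes\dots\otimes A_{\tau(r)}$, where $(-1)^\tau$ is the sign of $\tau$ and the factors are elements of the vector space $M_{2r}(\mathbb C)$; thus $\sum_{\sigma\in\mathfrak W}(-1)^\sigma g^{\sigma\ell}=\bigwedge_{i=1}^r(g^{\ell_i}-g^{-\ell_i})$. *)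

(* Defs.v *)
From HB Require Import structures.
From mathcomp Require Import all_boot all_order all_fingroup all_algebra.
From mathcomp Require Import reals complex.
From mathcomp Require mpoly.

Set Implicit Arguments.
Unset Strict Implicit.
Unset Printing Implicit Defensive.

Import Order.TTheory GRing.Theory Num.Theory.
Local Open Scope ring_scope.

(* The coordinates of C^(2r) are ordered x_1, y_1, ..., x_r, y_r; with indices
   starting at 0, x_i sits at position 2i and y_i at position 2i + 1. *)
Fact xcoord_subproof r (i : 'I_r) : (i.*2 < r.*2)%N.
Proof. by rewrite ltn_double. Qed.

Fact ycoord_subproof r (i : 'I_r) : (i.*2.+1 < r.*2)%N.
Proof. by rewrite ltn_Sdouble. Qed.

Definition xcoord r (i : 'I_r) : 'I_r.*2 := Ordinal (xcoord_subproof i).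
Definition ycoord r (i : 'I_r) : 'I_r.*2 := Ordinal (ycoord_subproof i).

Section Symplectic.
Variables (R : realType) (r : nat).
Local Notation C := (complex R).

Definition skew_form (u v : 'cV[C]_r.*2) : C :=
  \sum_(i < r) (u (xcoord i) 0 * v (ycoord i) 0
                - u (ycoord i) 0 * v (xcoord i) 0).

Definition symplectic (g : 'M[C]_r.*2) : Prop :=
  g \in unitmx /\
  forall u v : 'cV[C]_r.*2, skew_form (g *m u) (g *m v) = skew_form u v.

(* diag(z_1, z_1^-1, ..., z_r, z_r^-1) *)
Definition torus_mx (z : 'I_r -> C) : 'M[C]_r.*2 :=
  \sum_(i < r) (z i *: delta_mx (xcoord i) (xcoord i)
                + (z i)^-1 *: delta_mx (ycoord i) (ycoord i)).

End Symplectic.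

Section Weights.
Variable r : nat.

(* The weight lattice Z^r is 'rV[int]_r. *)
Definition std_weight (i : 'I_r) : 'rV[int]_r := delta_mx 0 i.

Definition pos_root (a : 'rV[int]_r) : bool :=
  [exists i : 'I_r, exists j : 'I_r, (i < j)%N &&
     ((a == std_weight i - std_weight j) || (a == std_weight i + std_weight j))]
  || [exists i : 'I_r, a == std_weight i *+ 2].

(* mu <= lam iff lam - mu is a sum of positive roots, repetitions allowed. *)
Definition weight_le (mu lam : 'rV[int]_r) : Prop :=
  exists2 s : seq 'rV[int]_r, all pos_root s & lam - mu = \sum_(a <- s) a.

(* (r, r - 1, ..., 1) *)
Definition weyl_vector : 'rV[int]_r := \row_(i < r) (r%:Z - i%:Z).

(* The pair (p, e) is the signed permutation that permutes the coordinates by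
   p and then changes the sign of those in the support of e. *)
Definition weyl_group : finType := ('S_r * {ffun 'I_r -> bool})%type.

Definition weyl_act (w : weyl_group) (l : 'rV[int]_r) : 'rV[int]_r :=
  \row_(i < r) ((-1) ^+ (w.2 i) * l 0 ((w.1)^-1%g i)).

Definition weyl_sign (w : weyl_group) : int := \det (lin1_mx (weyl_act w)).

End Weights.

Section Representations.
Variables (R : realType) (r n : nat).
Local Notation C := (complex R).

(* A representation on C^n is a map on all 2r x 2r matrices of which only the
   values on Sp_2r(C) matter.  Sp_2r(C) is Zariski closed in the space of
   matrices, so its regular functions are the restrictions of polynomials in
   the matrix entries. *)
Variable rep : 'M[C]_r.*2 -> 'M[C]_n.

Definition sp_representation : Prop :=
  [/\ rep 1%:M = 1%:M,
      forall g h, symplectic g -> symplectic h ->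
        rep (g *m h) = rep g *m rep h
    & forall a b : 'I_n, exists P : mpoly.mpoly (r.*2 * r.*2) C,
        forall g, symplectic g ->
          rep g a b = mpoly.meval (fun k => mxvec g 0 k) P].

Definition sp_irreducible : Prop :=
  (0 < n)%N /\
  forall U : {vspace 'cV[C]_n},
    (forall g v, symplectic g -> v \in U -> rep g *m v \in U) ->
    U = 0%VS \/ U = fullv.

Definition weight_of (mu : 'rV[int]_r) : Prop :=
  exists2 v : 'cV[C]_n, v != 0 &
    forall z : 'I_r -> C, (forall i, z i != 0) ->
      rep (torus_mx z) *m v = (\prod_(i < r) z i ^ mu 0 i) *: v.

Definition highest_weight (lam : 'rV[int]_r) : Prop :=
  weight_of lam /\ forall mu, weight_of mu -> weight_le mu lam.

Definition rep_character (g : 'M[C]_r.*2) : C := \tr (rep g).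

End Representations.

Section Tensors.
Variables (R : realType) (r N : nat).
Local Notation C := (complex R).

(* M_N(C)^(tensor r), in coordinates for the basis of tensors
   E_(f 1) (x) ... (x) E_(f r), where E_(a, b) is the matrix unit at (a, b). *)
Definition tensor_power : lmodType C :=
  {ffun {ffun 'I_r -> 'I_N * 'I_N} -> C^o}.

Definition pure_tensor (A : 'I_r -> 'M[C]_N) : tensor_power :=
  [ffun f : {ffun 'I_r -> 'I_N * 'I_N} =>
     \prod_(i < r) A i (f i).1 (f i).2].

Definition wedge (A : 'I_r -> 'M[C]_N) : tensor_power :=
  \sum_(t : 'S_r) (-1) ^+ t *: pure_tensor (fun i => A (t i)).

(* Integer powers, for which the library requires a size of the form m.+1. *)
Definition mx_exprz (g : 'M[C]_N) (k : int) : 'M[C]_N :=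
  match k with
  | Posz m => g ^+ m
  | Negz m => invmx g ^+ m.+1
  end.

Definition mx_multipower (g : 'M[C]_N) (l : 'rV[int]_r) : tensor_power :=
  pure_tensor (fun i => mx_exprz g (l 0 i)).

End Tensors.

(* Main.v *)
Require Import Defs.
From mathcomp Require Import all_boot all_order all_fingroup all_algebra separable.
From mathcomp Require Import reals complex ring zify.
From mathcomp Require boolp mpoly.

Import (canonicals) mpoly.

(* The character of an irreducible representation is first computed on a regular
   element z of the torus.  The differential of the representation is defined
   algebraically, by differentiating along rational curves in the group; the
   Casimir operator built from it commutes with the group, hence is a scalar by
   Schur's lemma.  Taking the trace of z times the Casimir operator, and moving
   root vectors around the trace, gives a second order differential equation for
   the character chi.  Since the Weyl denominator Delta has an explicit
   logarithmic derivative, this equation says that chi * Delta is an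
   eigenfunction of the Laplacian: all exponents nu occurring in it have the same
   norm.  As chi * Delta is alternating and its exponents lie below lambda + rho,
   which has strictly larger norm than any other dominant nu below it, chi * Delta
   is the multiplicity of lambda times the alternant of lambda + rho.  That
   multiplicity is 1 because words in the lowering operators applied to a highest
   weight vector span the representation.

   If g is conjugate to a regular z, then g^k - g^-k is the combination of r fixed
   matrices with coefficients z_i^k - z_i^-k, so the coordinates of both wedges are
   the corresponding alternants in z times one common determinant.  Finally,
   transvections generate the group, so every g is joined to a regular torus
   element by a polynomial curve, along which almost all points have 2r distinct
   eigenvalues and are therefore conjugate to regular torus elements; both sides
   are polynomial along the curve. *)

Set Implicit Arguments.
Unset Strict Implicit.
Unset Printing Implicit Defensive.

Import Order.TTheory GRing.Theory Num.Theory.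
Local Open Scope ring_scope.

(** The representation is known only through polynomials restricted to the group, so derivatives can
    be taken only along curves that stay in the group. Two families suffice: the transvections
    [w -> w + t om(v, w) v], polynomial in t, whose velocities span the Lie algebra by polarization,
    and the torus curves [z_i = 1 + t], which leave the group at t = -1. The latter force jets of
    rational rather than polynomial functions. Identifying the Lie algebra with Sym^2 of C^(2r)
    gives one bracket formula for all root vectors, and presents the Casimir operator as a double
    contraction with the symplectic form; its invariance then follows from that of the form, without
    dual bases. The Casimir eigenvalue is never computed from lambda. It remains an unknown constant
    until the coefficient at lambda + rho is shown to be 1, so multiplicity one has to come before
    the comparison of norms. The dominance order enters only through partial sums of coordinates,
    that is, pairings with the fundamental weights. *)

Lemma neq_xy r (i j : 'I_r) : (xcoord i == ycoord j) = false.
Proof. by apply/negP=> /eqP /(congr1 (fun k => odd (val k))); rewrite /= !odd_double. Qed.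

Lemma neq_yx r (i j : 'I_r) : (ycoord i == xcoord j) = false.
Proof. by rewrite eq_sym neq_xy. Qed.

Lemma xcoord_inj r : injective (@xcoord r).
Proof. by move=> i j /(congr1 val) /= /double_inj /val_inj. Qed.

Lemma ycoord_inj r : injective (@ycoord r).
Proof. by move=> i j /(congr1 val) /= [] /double_inj /val_inj. Qed.

Definition eq_coord r (i j : 'I_r) :=
  (inj_eq (@xcoord_inj r) i j, inj_eq (@ycoord_inj r) i j, neq_xy i j, neq_yx i j).

Lemma half_coord_subproof r (k : 'I_r.*2) : (k./2 < r)%N.
Proof. by rewrite ltn_half_double. Qed.

Definition half_coord r (k : 'I_r.*2) : 'I_r := Ordinal (half_coord_subproof k).

Lemma half_xcoord r (i : 'I_r) : half_coord (xcoord i) = i.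
Proof. by apply/val_inj; rewrite /= doubleK. Qed.

Lemma half_ycoord r (i : 'I_r) : half_coord (ycoord i) = i.
Proof. by apply/val_inj; rewrite /= uphalf_double. Qed.

(** Case analysis on an index that also replaces [half_coord k] and [odd k] by their values. *)
Variant coord_spec r (k : 'I_r.*2) : 'I_r.*2 -> 'I_r -> bool -> Type :=
| CoordX i of k = xcoord i : coord_spec k (xcoord i) i false
| CoordY i of k = ycoord i : coord_spec k (ycoord i) i true.

Lemma coordP r (k : 'I_r.*2) : coord_spec k k (half_coord k) (odd k).
Proof.
have [k_odd|k_even] := boolP (odd k).
  have e : k = ycoord (half_coord k).
    by apply/val_inj; rewrite /= -[LHS]odd_double_half k_odd.
  by rewrite {2}e; apply: CoordY.
have e : k = xcoord (half_coord k).
  by apply/val_inj; rewrite /= -[LHS]odd_double_half (negbTE k_even).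
by rewrite {2}e; apply: CoordX.
Qed.

Lemma big_coord (S : Type) (idx : S) (op : Monoid.com_law idx) r
    (F : 'I_r.*2 -> S) :
  \big[op/idx]_(k < r.*2) F k
  = \big[op/idx]_(i < r) op (F (xcoord i)) (F (ycoord i)).
Proof.
rewrite big_split /= (bigID (fun k : 'I_r.*2 => ~~ odd k)) /=; congr (op _ _).
  rewrite (reindex_onto (@xcoord r) (@half_coord r)) /=; last first.
    by move=> k; case: coordP.
  by apply: eq_bigl => i; rewrite half_xcoord eqxx odd_double.
rewrite (reindex_onto (@ycoord r) (@half_coord r)) /=; last first.
  by move=> k; case: coordP.
by apply: eq_bigl => i; rewrite half_ycoord eqxx odd_double.
Qed.

(** * The symplectic group and its transvections *)

(* The notions of Defs over any algebraically closed numeric field; at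
   [complex R] they are convertible to the originals. *)
Section SymplecticGroup.
Variables (C : numClosedFieldType) (r : nat).

Definition symp_form (u v : 'cV[C]_r.*2) : C :=
  \sum_(i < r) (u (xcoord i) 0 * v (ycoord i) 0
                - u (ycoord i) 0 * v (xcoord i) 0).

Definition in_Sp (g : 'M[C]_r.*2) : Prop :=
  g \in unitmx /\
  forall u v : 'cV[C]_r.*2, symp_form (g *m u) (g *m v) = symp_form u v.

Definition torus_elt (z : 'I_r -> C) : 'M[C]_r.*2 :=
  \sum_(i < r) (z i *: delta_mx (xcoord i) (xcoord i)
                + (z i)^-1 *: delta_mx (ycoord i) (ycoord i)).

Definition is_poly_rep n (rep : 'M[C]_r.*2 -> 'M[C]_n) : Prop :=
  [/\ rep 1%:M = 1%:M,
      forall g h, in_Sp g -> in_Sp h ->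
        rep (g *m h) = rep g *m rep h
    & forall a b : 'I_n, exists P : mpoly.mpoly (r.*2 * r.*2) C,
        forall g, in_Sp g ->
          rep g a b = mpoly.meval (fun k => mxvec g 0 k) P].

Definition is_irreducible_rep n (rep : 'M[C]_r.*2 -> 'M[C]_n) : Prop :=
  (0 < n)%N /\
  forall U : {vspace 'cV[C]_n},
    (forall g v, in_Sp g -> v \in U -> rep g *m v \in U) ->
    U = 0%VS \/ U = fullv.

End SymplecticGroup.

Section Form.
Variables (C : numClosedFieldType) (r : nat).
Local Notation V := 'cV[C]_r.*2.
Implicit Types (u v w : V) (g h : 'M[C]_r.*2).
Local Notation om := (@symp_form C r).

Definition xvec (i : 'I_r) : V := delta_mx (xcoord i) 0.
Definition yvec (i : 'I_r) : V := delta_mx (ycoord i) 0.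

Definition skew_mx : 'M[C]_r.*2 :=
  \sum_(i < r) (delta_mx (xcoord i) (ycoord i) - delta_mx (ycoord i) (xcoord i)).

(** The functional [om v] as a row vector, so that [u *m covec v] is the rank-one map
    [w -> om(v, w) u]. *)
Definition covec v : 'rV[C]_r.*2 := v^T *m skew_mx.

Lemma tr_mul_delta v a b k : (v^T *m delta_mx a b : 'rV_r.*2) 0 k = v a 0 * (k == b)%:R.
Proof.
rewrite mxE (bigD1 a) //= big1 => [|c /negbTE ca]; rewrite !mxE ?ca ?mulr0 //.
by rewrite eqxx addr0.
Qed.

Lemma covecE v i :
  (covec v 0 (xcoord i) = - v (ycoord i) 0)
  * (covec v 0 (ycoord i) = v (xcoord i) 0).
Proof.
rewrite /covec /skew_mx mulmx_sumr !summxE; split; rewrite (bigD1 i) //= big1 ?addr0.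
- by rewrite mulmxBr mxE [X in _ + X]mxE !tr_mul_delta !eq_coord eqxx mulr0 mulr1 add0r.
- move=> j ji; rewrite mulmxBr mxE [X in _ + X]mxE !tr_mul_delta !eq_coord.
  by rewrite eq_sym (negbTE ji) !mulr0 subr0.
- by rewrite mulmxBr mxE [X in _ + X]mxE !tr_mul_delta !eq_coord eqxx mulr0 mulr1 subr0.
- move=> j ji; rewrite mulmxBr mxE [X in _ + X]mxE !tr_mul_delta !eq_coord.
  by rewrite eq_sym (negbTE ji) !mulr0 subr0.
Qed.

Lemma covec_mul v w : covec v *m w = (om v w)%:M.
Proof.
rewrite [LHS]mx11_scalar; congr (_%:M).
rewrite mxE big_coord; apply: eq_bigr => i _ /=.
by rewrite !covecE addrC mulNr.
Qed.

Lemma omE v w : om v w = (covec v *m w) 0 0.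
Proof. by rewrite covec_mul mxE mulr1n. Qed.

Lemma omDr u v w : om u (v + w) = om u v + om u w.
Proof. by rewrite !omE mulmxDr mxE. Qed.
Lemma omZr a u v : om u (a *: v) = a * om u v.
Proof. by rewrite !omE -scalemxAr mxE. Qed.
Lemma omC u v : om u v = - om v u.
Proof.
rewrite /symp_form -sumrN; apply: eq_bigr => i _.
by rewrite opprB [X in X - _]mulrC [X in _ - X]mulrC.
Qed.
Lemma omDl u v w : om (u + v) w = om u w + om v w.
Proof. by rewrite !(omC _ w) omDr opprD. Qed.
Lemma omZl a u v : om (a *: u) v = a * om u v.
Proof. by rewrite !(omC _ v) omZr mulrN. Qed.
Lemma omNl u v : om (- u) v = - om u v.
Proof. by rewrite -scaleN1r omZl mulN1r. Qed.
Lemma omBl u v w : om (u - v) w = om u w - om v w.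
Proof. by rewrite omDl omNl. Qed.
Lemma om0r u : om u 0 = 0.
Proof. by rewrite -[0](scale0r (0 : V)) omZr mul0r. Qed.
Lemma omuu u : om u u = 0.
Proof. by rewrite /symp_form big1 // => i _; rewrite mulrC subrr. Qed.

Lemma omx v i : om (xvec i) v = v (ycoord i) 0.
Proof.
rewrite /symp_form (bigD1 i) //= big1 => [|j ji]; rewrite !mxE ?eqxx !eq_coord.
  by rewrite mul1r mul0r subr0 addr0.
by rewrite (negbTE ji) !mul0r subrr.
Qed.

Lemma omy v i : om (yvec i) v = - v (xcoord i) 0.
Proof.
rewrite /symp_form (bigD1 i) //= big1 => [|j ji]; rewrite !mxE ?eqxx !eq_coord.
  by rewrite mul1r mul0r addr0 sub0r.
by rewrite (negbTE ji) !mul0r subrr.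
Qed.

Lemma omxy i j : (om (xvec i) (xvec j) = 0) * (om (yvec i) (yvec j) = 0)
  * (om (xvec i) (yvec j) = (i == j)%:R) * (om (yvec i) (xvec j) = - (i == j)%:R).
Proof. by rewrite !omx !omy !mxE !eq_coord !andbT oppr0. Qed.

Lemma om_nondeg u : (forall v, om u v = 0) -> u = 0.
Proof.
move=> u0; apply/matrixP => k j; rewrite ord1 [RHS]mxE.
case: (coordP k) => i _.
  by have /eqP := u0 (yvec i); rewrite omC omy opprK => /eqP.
by have /eqP := u0 (xvec i); rewrite omC omx oppr_eq0 => /eqP.
Qed.

Lemma vec_coord v :
  v = \sum_(i < r) (v (xcoord i) 0 *: xvec i + v (ycoord i) 0 *: yvec i).
Proof.
rewrite [LHS](matrix_sum_delta v) big_coord; apply: eq_bigr => i _.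
by rewrite !big_ord1.
Qed.

Lemma covecD u v : covec (u + v) = covec u + covec v.
Proof. by rewrite /covec linearD /= mulmxDl. Qed.
Lemma covecZ a u : covec (a *: u) = a *: covec u.
Proof. by rewrite /covec linearZ /= scalemxAl. Qed.

Lemma symplectic_om g u v : in_Sp g -> om (g *m u) (g *m v) = om u v.
Proof. by case. Qed.

Lemma symplectic1 : in_Sp (1%:M : 'M[C]_r.*2).
Proof. by split=> [|u v]; rewrite ?unitmx1 ?mul1mx. Qed.

Lemma symplecticM g h : in_Sp g -> in_Sp h -> in_Sp (g *m h).
Proof.
move=> [gu go] [hu ho]; split=> [|u v]; first by rewrite unitmx_mul gu.
by rewrite -!mulmxA go ho.
Qed.

Lemma symplecticV g : in_Sp g -> in_Sp (invmx g).
Proof.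
move=> [gu go]; split=> [|u v]; first by rewrite unitmx_inv.
by rewrite -go !mulmxA mulmxV // !mul1mx.
Qed.

Lemma eq_mulcol m n (A B : 'M[C]_(m, n)) :
  (forall v : 'cV_n, A *m v = B *m v) -> A = B.
Proof.
move=> AB; apply/matrixP=> i j.
by have /matrixP/(_ i 0) := AB (delta_mx j 0); rewrite -!colE !mxE.
Qed.

(** Invertibility comes for free: a vector killed by g is orthogonal to every vector, hence zero by
    nondegeneracy. *)
Lemma om_eq_symplectic g :
  (forall u v, om (g *m u) (g *m v) = om u v) -> in_Sp g.
Proof.
move=> go; split=> //; rewrite -unitmx_tr -row_free_unit.
apply: inj_row_free => v vg0; apply: trmx_inj; rewrite trmx0.
apply: om_nondeg => w; rewrite -go.
have -> : g *m v^T = 0 by rewrite -[g]trmxK -trmx_mul vg0 trmx0.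
by rewrite omC om0r oppr0.
Qed.

Lemma covec_symplectic g v :
  in_Sp g -> covec (g *m v) *m g = covec v.
Proof.
move=> gs; apply: eq_mulcol => w.
by rewrite -mulmxA !covec_mul symplectic_om.
Qed.

Lemma skew_mx_sqr : skew_mx *m skew_mx = - 1%:M.
Proof.
apply: eq_mulcol => v; apply: trmx_inj.
rewrite mulNmx mul1mx linearN /=.
have skT : skew_mx^T = - skew_mx.
  rewrite /skew_mx -sumrN linear_sum; apply: eq_bigr => i _.
  by rewrite linearB /= !trmx_delta opprB.
rewrite !trmx_mul skT !mulmxA !mulmxN mulNmx opprK.
have -> : v^T *m skew_mx *m skew_mx = covec (covec v)^T by rewrite /covec trmxK.
apply/matrixP=> a k; rewrite ord1.
by case: (coordP k) => i _; rewrite covecE mxE covecE !mxE.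
Qed.

(** From [g^T J g = J] and [J^2 = -1] for J = [skew_mx]. The inverse is thus linear in the entries
    of g, which keeps negative powers polynomial along a curve in the group. *)
Lemma symplectic_inv g : in_Sp g -> invmx g = - (skew_mx *m g^T *m skew_mx).
Proof.
move=> gs; have gJ : g^T *m skew_mx *m g = skew_mx.
  apply: eq_mulcol => w; apply/matrixP => k j.
  have := congr1 (fun A : 'rV_ _ => (A *m w) 0 j) (covec_symplectic (delta_mx k 0) gs).
  by rewrite /covec trmx_mul trmx_delta -!mulmxA -!rowE !mxE.
have e : - (skew_mx *m g^T *m skew_mx) *m g = 1%:M.
  by rewrite mulNmx -!mulmxA (mulmxA g^T) gJ skew_mx_sqr opprK.
by rewrite -[RHS]mulmx1 -(mulmxV gs.1) mulmxA e mul1mx.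
Qed.

Definition transvec v (t : C) : 'M[C]_r.*2 := 1%:M + t *: (v *m covec v).

Lemma transvec_mul v t w : transvec v t *m w = w + (t * om v w) *: v.
Proof.
by rewrite mulmxDl mul1mx -scalemxAl -mulmxA covec_mul mul_mx_scalar scalerA.
Qed.

Lemma transvec_symplectic v t : in_Sp (transvec v t).
Proof.
apply: om_eq_symplectic => u w; rewrite !transvec_mul !omDr !omDl !omZl !omZr.
by rewrite omuu (omC u v); ring.
Qed.

Lemma transvec0 v : transvec v 0 = 1%:M.
Proof. by rewrite /transvec scale0r addr0. Qed.

Lemma transvecD v s t : transvec v s *m transvec v t = transvec v (s + t).
Proof.
apply: eq_mulcol => w; rewrite -mulmxA !transvec_mul omDr omZr omuu mulr0 addr0.
by rewrite -addrA -scalerDl [s + t]addrC mulrDl.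
Qed.

Lemma transvec_conj g v t :
  in_Sp g -> g *m transvec v t *m invmx g = transvec (g *m v) t.
Proof.
move=> gs; rewrite /transvec mulmxDr mulmxDl mulmx1 mulmxV ?gs.1 //.
rewrite -scalemxAr -scalemxAl mulmxA -(mulmxA (g *m v)).
by rewrite -{1}(covec_symplectic v gs) -(mulmxA (covec _)) mulmxV ?mulmx1 ?gs.1.
Qed.

End Form.

Section Generation.
Variables (C : numClosedFieldType) (r : nat).
Local Notation V := 'cV[C]_r.*2.
Implicit Types (u v w : V) (g h : 'M[C]_r.*2) (P Q : V -> Prop).
Local Notation om := (@symp_form C r).
Local Notation x_ := (@xvec C r).
Local Notation y_ := (@yvec C r).

(** P restricts the directions: transvections along vectors orthogonal to u fix u, so a suitable P
    protects what has already been arranged. *)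
Inductive transvec_gen P : 'M[C]_r.*2 -> Prop :=
| Transvec_gen1 : transvec_gen P 1%:M
| Transvec_genM v t g of P v & transvec_gen P g :
    transvec_gen P (transvec v t *m g).

Lemma transvec_gen_symplectic P g : transvec_gen P g -> in_Sp g.
Proof.
elim=> [|v t h _ _ hs]; first exact: symplectic1.
exact/symplecticM/hs/transvec_symplectic.
Qed.

Lemma transvec_gen_mul P g h :
  transvec_gen P g -> transvec_gen P h -> transvec_gen P (g *m h).
Proof.
move=> gP hP; elim: gP => [|v t k vP _ IH]; first by rewrite mul1mx.
by rewrite -mulmxA; apply: Transvec_genM.
Qed.

Lemma transvec_gen_transvec P v t : P v -> transvec_gen P (transvec v t).
Proof.
by move=> vP; rewrite -[transvec v t]mulmx1; apply: Transvec_genM => //; left.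
Qed.

Lemma transvec_gen_sub P Q g :
  (forall v, P v -> Q v) -> transvec_gen P g -> transvec_gen Q g.
Proof.
move=> PQ; elim=> [|v t h vP _ IH]; first by left.
by apply: Transvec_genM => //; apply: PQ.
Qed.

Lemma transvec_gen_fix P g u :
  (forall v, P v -> om v u = 0) -> transvec_gen P g -> g *m u = u.
Proof.
move=> Pu; elim=> [|v t h vP _ IH]; first by rewrite mul1mx.
by rewrite -mulmxA IH transvec_mul Pu // mulr0 scale0r addr0.
Qed.

Lemma transvec_genV P g : transvec_gen P g -> transvec_gen P (invmx g).
Proof.
elim=> [|v t h vP _ IH]; first by rewrite invmx1; left.
have hI : invmx (transvec v t) = transvec v (- t).
  have e : transvec v (- t) *m transvec v t = 1%:M.
    by rewrite transvecD addNr transvec0.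
  have [_ tu] := mulmx1_unit e.
  by rewrite -[RHS]mulmx1 -(mulmxV tu) mulmxA e mul1mx.
case: (boolP (h \in unitmx)) => hu; last first.
  by move: IH; rewrite /invmx (negbTE hu) unitmx_mul (negbTE hu) andbF => IH; right.
have tu : transvec v t \in unitmx by case: (transvec_symplectic v t).
have -> : invmx (transvec v t *m h) = invmx h *m transvec v (- t).
  rewrite -hI -[RHS]mulmx1 -(@mulmxV _ _ (transvec v t *m h)) ?unitmx_mul ?tu //.
  by rewrite !mulmxA mulmxKV // mulVmx // mul1mx.
by apply: transvec_gen_mul => //; apply: transvec_gen_transvec.
Qed.

(** The transvection shifts u by t om(u - w, u) times u - w, and om(u - w, u) = om(u, w); t makes
    this factor -1. *)
Lemma transvec_move u w : om u w != 0 ->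
  exists t, transvec (u - w) t *m u = w.
Proof.
move=> uw; exists (- (om u w)^-1).
rewrite transvec_mul omBl omuu sub0r -omC mulNr mulVf // scaleN1r.
by rewrite opprB addrC subrK.
Qed.

Lemma transvec_gen_move P u w :
  om u w != 0 -> P (u - w) -> exists2 h, transvec_gen P h & h *m u = w.
Proof.
move=> uw Puw; have [t tP] := transvec_move uw.
by exists (transvec (u - w) t) => //; apply: transvec_gen_transvec.
Qed.

Lemma transvec_gen_move2 P u z w :
  om u z != 0 -> P (u - z) -> om z w != 0 -> P (z - w) ->
  exists2 h, transvec_gen P h & h *m u = w.
Proof.
move=> uz Puz zw Pzw.
have [h1 h1P h1u] := transvec_gen_move uz Puz.
have [h2 h2P h2u] := transvec_gen_move zw Pzw.
exists (h2 *m h1); first exact: transvec_gen_mul.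
by rewrite -mulmxA h1u.
Qed.

Definition perp_upto k v :=
  forall i : 'I_r, (i < k)%N -> om v (x_ i) = 0 /\ om v (y_ i) = 0.

Lemma perp_uptoB k u v : perp_upto k u -> perp_upto k v -> perp_upto k (u - v).
Proof.
move=> ku kv i ik; have [ux uy] := ku i ik; have [vx vy] := kv i ik.
by rewrite !omBl ux uy vx vy subr0.
Qed.

Lemma perp_uptoD k u v : perp_upto k u -> perp_upto k v -> perp_upto k (u + v).
Proof.
move=> ku kv i ik; have [ux uy] := ku i ik; have [vx vy] := kv i ik.
by rewrite !omDl ux uy vx vy addr0.
Qed.

Definition fixes_upto k g :=
  forall i : 'I_r, (i < k)%N -> g *m x_ i = x_ i /\ g *m y_ i = y_ i.

Lemma perp_upto_coord (k i : 'I_r) : (k <= i)%N ->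
  perp_upto k (x_ i) /\ perp_upto k (y_ i).
Proof.
move=> ki; split=> j jk; rewrite !omxy (_ : (i == j) = false) ?oppr0 //;
  by apply/negbTE; rewrite neq_ltn (leq_trans jk ki) orbT.
Qed.

Lemma fixes_perp k g v : in_Sp g -> fixes_upto k g -> perp_upto k v ->
  perp_upto k (g *m v).
Proof.
move=> gs gf vp i ik; have [gx gy] := gf i ik.
by rewrite -{1}gx -{1}gy !symplectic_om //; apply: vp.
Qed.

Lemma transvec_gen_fixes k g h : transvec_gen (perp_upto k) h ->
  fixes_upto k g -> fixes_upto k (h *m g).
Proof.
move=> hg gf i ik; have [gx gy] := gf i ik; rewrite -!mulmxA gx gy.
by split; apply: transvec_gen_fix hg => v /(_ i ik) [].
Qed.

(* Transvections along vectors of the orthogonal complement of the first k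
   hyperbolic pairs act transitively on hyperbolic pairs of that complement. *)
Lemma transvec_gen_step (k : 'I_r) g : in_Sp g -> fixes_upto k g ->
  exists2 h, transvec_gen (fun => True) h & fixes_upto k.+1 (h *m g).
Proof.
move=> gs gf; have [px py] := perp_upto_coord (leqnn k).
have pgx := fixes_perp gs gf px; have pgy := fixes_perp gs gf py.
have gxy : om (g *m x_ k) (g *m y_ k) = 1 by rewrite symplectic_om // omxy eqxx.
have [h1 h1P h1x] : exists2 h, transvec_gen (perp_upto k) h & h *m (g *m x_ k) = x_ k.
  (* If g x and x are orthogonal, a vector pairing nontrivially with both serves as a stopover: g y,
     or y, or g y + y when g y is orthogonal to x and g x to y. *)
  have [gxx|gxx] := eqVneq (om (g *m x_ k) (x_ k)) 0; last first.
    by apply: transvec_gen_move => //; apply: perp_uptoB.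
  have [gyx|gyx] := eqVneq (om (g *m y_ k) (x_ k)) 0; last first.
    by apply: (@transvec_gen_move2 _ _ (g *m y_ k)); rewrite ?gxy ?oner_eq0 //;
       apply: perp_uptoB.
  have [gxy0|gxy0] := eqVneq (om (g *m x_ k) (y_ k)) 0; last first.
    apply: (@transvec_gen_move2 _ _ (y_ k)) => //; try exact: perp_uptoB.
    by rewrite omxy eqxx oppr_eq0 oner_eq0.
  apply: (@transvec_gen_move2 _ _ (g *m y_ k + y_ k)).
  - by rewrite omDr gxy gxy0 addr0 oner_eq0.
  - exact/perp_uptoB/perp_uptoD.
  - by rewrite omDl gyx omxy eqxx add0r oppr_eq0 oner_eq0.
  - by apply: perp_uptoB => //; apply: perp_uptoD.
pose g1 := h1 *m g.
have g1s : in_Sp g1 by apply: symplecticM gs; apply: transvec_gen_symplectic h1P.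
have g1f : fixes_upto k g1 by apply: transvec_gen_fixes.
have g1x : g1 *m x_ k = x_ k by rewrite -mulmxA.
have pg1y := fixes_perp g1s g1f py.
have xg1y : om (g1 *m y_ k) (x_ k) = - 1.
  by rewrite -{1}g1x symplectic_om // omxy eqxx.
(* The second stage uses only directions orthogonal to [x_ k], so the image of [x_ k] stays fixed.
   Such directions are available since g1 y and y both pair to -1 with x, and the stopover g1 y + x
   does too. *)
pose Q v := perp_upto k v /\ om v (x_ k) = 0.
have [h2 h2P h2y] : exists2 h, transvec_gen Q h & h *m (g1 *m y_ k) = y_ k.
  have [gyy|gyy] := eqVneq (om (g1 *m y_ k) (y_ k)) 0; last first.
    apply: transvec_gen_move => //; split; first exact: perp_uptoB.
    by rewrite omBl xg1y omxy eqxx opprK addNr.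
  apply: (@transvec_gen_move2 _ _ (g1 *m y_ k + x_ k)).
  - by rewrite omDr omuu add0r xg1y oppr_eq0 oner_eq0.
  - split; first exact/perp_uptoB/perp_uptoD.
    by rewrite omBl omDl omuu addr0 subrr.
  - by rewrite omDl gyy add0r omxy eqxx oner_eq0.
  - split; first by apply: perp_uptoB => //; apply: perp_uptoD.
    by rewrite omBl omDl omuu addr0 xg1y omxy eqxx opprK addNr.
exists (h2 *m h1).
  apply: transvec_gen_mul; first exact: transvec_gen_sub h2P.
  exact: transvec_gen_sub h1P.
rewrite -mulmxA -/g1 => i; rewrite ltnS leq_eqVlt => /orP[/eqP /val_inj ->|ik].
  by rewrite -!(mulmxA h2 g1) h2y g1x; split=> //; apply: transvec_gen_fix h2P => v [].
apply: transvec_gen_fixes ik => //.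
by apply: transvec_gen_sub h2P => v [].
Qed.

Lemma symplectic_transvec_gen g : in_Sp g -> transvec_gen (fun => True) g.
Proof.
move=> gs; have [h hg hgf] : exists2 h, transvec_gen (fun => True) h & fixes_upto r (h *m g).
  suff: forall k, (k <= r)%N ->
      exists2 h, transvec_gen (fun => True) h & fixes_upto k (h *m g).
    by apply.
  elim=> [|k IH] kr; first by exists 1%:M; [left | move=> i].
  have [h hg hgf] := IH (ltnW kr).
  have hgs : in_Sp (h *m g) by apply: symplecticM gs; apply: transvec_gen_symplectic hg.
  have [h' h'g h'gf] := @transvec_gen_step (Ordinal kr) _ hgs hgf.
  by exists (h' *m h); [apply: transvec_gen_mul | rewrite -mulmxA].
have hg1 : h *m g = 1%:M.
  apply: eq_mulcol => v; rewrite mul1mx {2}[v]vec_coord {1}[v]vec_coord mulmx_sumr.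
  apply: eq_bigr => i _; have [gx gy] := hgf i (ltn_ord i).
  by rewrite mulmxDr -!scalemxAr gx gy.
have [hu _] := mulmx1_unit hg1.
rewrite -[g]mul1mx -(mulVmx hu) -mulmxA hg1 mulmx1.
exact: transvec_genV.
Qed.

Definition eval_mx m n (t : C) (M : 'M[{poly C}]_(m, n)) : 'M[C]_(m, n) :=
  map_mx (horner_eval t) M.

(** In a factorization of g into transvections, every parameter t is replaced by t X. *)
Lemma symplectic_curve1 g : in_Sp g ->
  exists M : 'M[{poly C}]_r.*2,
    [/\ forall t, in_Sp (eval_mx t M), eval_mx 0 M = 1%:M & eval_mx 1 M = g].
Proof.
move/symplectic_transvec_gen; elim=> [|v t h _ _ [M [Ms M0 M1]]].
  by exists 1%:M; rewrite /eval_mx; split=> [t||]; rewrite map_mx1 //; apply: symplectic1.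
pose T : 'M[{poly C}]_r.*2 := 1%:M + (t *: 'X) *: map_mx polyC (v *m covec v).
have Te s : eval_mx s T = transvec v (s * t).
  rewrite /eval_mx /T map_mxD map_mx1 map_mxZ /= -map_mx_comp map_mx_id_in; last first.
    by move=> a b /=; rewrite /horner_eval hornerC.
  by rewrite /horner_eval hornerZ hornerX mulrC.
exists (T *m M); rewrite /eval_mx; split=> [s||];
  rewrite map_mxM -/(eval_mx _ T) -/(eval_mx _ M) Te.
- exact/symplecticM/Ms/transvec_symplectic.
- by rewrite M0 mul0r transvec0 mulmx1.
- by rewrite M1 mul1r.
Qed.

Lemma symplectic_curve g h : in_Sp g -> in_Sp h ->
  exists M : 'M[{poly C}]_r.*2,
    [/\ forall t, in_Sp (eval_mx t M), eval_mx 0 M = g & eval_mx 1 M = h].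
Proof.
move=> gs hs.
have [M [Ms M0 M1]] := symplectic_curve1 (symplecticM hs (symplecticV gs)).
exists (M *m map_mx polyC g).
have e t : eval_mx t (M *m map_mx polyC g) = eval_mx t M *m g.
  rewrite /eval_mx map_mxM -[map_mx _ (map_mx _ g)]map_mx_comp [X in _ *m X]map_mx_id_in //.
  by move=> a b /=; rewrite /horner_eval hornerC.
split=> [t||]; rewrite e.
- exact: symplecticM.
- by rewrite M0 mul1mx.
- by rewrite M1 mulmxKV //; case: gs.
Qed.

End Generation.

(** * Algebraic one-jets of curves *)

Section FunClosed.
Variables (F : comNzRingType) (T : Type).

(** A class with these closures contains every polynomial expression in its members. The instances
    are polynomial functions, Laurent polynomial functions, and functions with a gradient at a
    point; the first field stands in for functional extensionality. *)
Record fun_closed (Q : (T -> F) -> Prop) := FunClosed {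
  fun_closed_ext : forall f g, f =1 g -> Q f -> Q g;
  fun_closed_cst : forall c, Q (fun=> c);
  fun_closedD : forall f g, Q f -> Q g -> Q (fun t => f t + g t);
  fun_closedM : forall f g, Q f -> Q g -> Q (fun t => f t * g t) }.

Variables (Q : (T -> F) -> Prop) (QP : fun_closed Q).

Lemma fun_closed_sum (I : Type) (s : seq I) (P : pred I) (f : I -> T -> F) :
  (forall i, Q (f i)) -> Q (fun t => \sum_(i <- s | P i) f i t).
Proof.
move=> Qf; elim: s => [|i s IH].
  by apply: (fun_closed_ext QP) (fun_closed_cst QP 0) => t; rewrite big_nil.
case Pi: (P i).
  by apply: (fun_closed_ext QP) (fun_closedD QP (Qf i) IH) => t; rewrite big_cons Pi.
by apply: (fun_closed_ext QP) IH => t; rewrite big_cons Pi.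
Qed.

Lemma fun_closed_prod (I : Type) (s : seq I) (P : pred I) (f : I -> T -> F) :
  (forall i, Q (f i)) -> Q (fun t => \prod_(i <- s | P i) f i t).
Proof.
move=> Qf; elim: s => [|i s IH].
  by apply: (fun_closed_ext QP) (fun_closed_cst QP 1) => t; rewrite big_nil.
case Pi: (P i).
  by apply: (fun_closed_ext QP) (fun_closedM QP (Qf i) IH) => t; rewrite big_cons Pi.
by apply: (fun_closed_ext QP) IH => t; rewrite big_cons Pi.
Qed.

Lemma fun_closedX f k : Q f -> Q (fun t => f t ^+ k).
Proof.
move=> Qf; apply: (fun_closed_ext QP) (@fun_closed_prod _ (index_enum 'I_k) predT (fun=> f)
  (fun=> Qf)).
by move=> t; rewrite prodr_const card_ord.
Qed.

Lemma fun_closedN f : Q f -> Q (fun t => - f t).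
Proof.
move=> Qf; apply: (fun_closed_ext QP) (fun_closedM QP (fun_closed_cst QP (-1)) Qf).
by move=> t; rewrite mulN1r.
Qed.

Lemma fun_closed_meval n (P : mpoly.mpoly n F) (f : 'I_n -> T -> F) :
  (forall i, Q (f i)) -> Q (fun t => mpoly.meval (fun i => f i t) P).
Proof.
move=> Qf; apply: (fun_closed_ext QP) => [t|]; first by rewrite mpoly.mevalE.
apply: fun_closed_sum => m; apply: (fun_closedM QP); first exact: (fun_closed_cst QP).
by apply: fun_closed_prod => i; apply: fun_closedX.
Qed.

Lemma fun_closed_mulmx m n p (A : T -> 'M[F]_(m, n)) (B : T -> 'M[F]_(n, p)) :
  (forall i j, Q (fun t => A t i j)) -> (forall i j, Q (fun t => B t i j)) ->
  forall i j, Q (fun t => (A t *m B t) i j).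
Proof.
move=> QA QB i j; apply: (fun_closed_ext QP) => [t|]; first by rewrite mxE.
by apply: fun_closed_sum => k; apply: (fun_closedM QP).
Qed.

Lemma fun_closed_det n (A : T -> 'M[F]_n) :
  (forall i j, Q (fun t => A t i j)) -> Q (fun t => \det (A t)).
Proof.
move=> QA; apply: fun_closed_sum => s; apply: (fun_closedM QP).
  exact: (fun_closed_cst QP).
exact: fun_closed_prod.
Qed.

End FunClosed.

Section Jet.
Variable F : numFieldType.
Implicit Types (phi psi : F -> F) (p q : {poly F}) (a b c : F).

Lemma poly_eq0_fun p : (forall t, p.[t] = 0) -> p = 0.
Proof.
move=> p0; apply/eqP/negPn/negP => /max_poly_roots mp.
pose s : seq F := [seq i%:R | i <- iota 0 (size p)].
have := mp s; rewrite size_map size_iota ltnn => /(_ _ _)/negP; apply=> //.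
  by apply/allP => t _; rewrite rootE p0.
by rewrite map_inj_uniq ?iota_uniq // => i j /eqP; rewrite eqr_nat => /eqP.
Qed.

Definition polyfun phi := exists p, forall t, phi t = p.[t].

Lemma polyfun_closed : fun_closed polyfun.
Proof.
split.
- by move=> f g fg [p pf]; exists p => t; rewrite -fg.
- by move=> c; exists c%:P => t; rewrite hornerC.
- by move=> f g [p pf] [q qg]; exists (p + q) => t; rewrite hornerD pf qg.
- by move=> f g [p pf] [q qg]; exists (p * q) => t; rewrite hornerM pf qg.
Qed.

(** Zariski density on the affine line: (p - q) s vanishes at every point and s is not zero. *)
Lemma polyfun_eq phi psi s : polyfun phi -> polyfun psi -> s != 0 ->
  (forall t, s.[t] != 0 -> phi t = psi t) -> phi =1 psi.
Proof.
move=> [p pE] [q qE] s0 pq t.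
suff /eqP: (p - q) * s = 0.
  by rewrite mulf_eq0 (negbTE s0) orbF subr_eq0 pE qE => /eqP ->.
apply: poly_eq0_fun => u; rewrite hornerM !(hornerM, hornerD, hornerN) -pE -qE.
by have [->|/pq ->] := eqVneq s.[u] 0; rewrite ?mulr0 // subrr mul0r.
Qed.

(* phi agrees with a rational function regular at 0, with value a and
   derivative b there; phi is arbitrary at the poles. *)
Definition jet phi a b := exists p q,
  [/\ q.[0] != 0, forall t, q.[t] != 0 -> phi t * q.[t] = p.[t],
      p.[0] = a * q.[0] & p^`().[0] = b * q.[0] + a * q^`().[0]].

Lemma jet_ext phi psi a b : phi =1 psi -> jet phi a b -> jet psi a b.
Proof. by move=> e [p [q [q0 pq pa pb]]]; exists p, q; split=> // t; rewrite -e; apply: pq. Qed.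

Lemma jet_eq phi a b a' b' : jet phi a b -> a = a' -> b = b' -> jet phi a' b'.
Proof. by move=> + <- <-. Qed.

Lemma jet_poly p : jet (fun t => p.[t]) p.[0] p^`().[0].
Proof.
exists p, 1; rewrite hornerC derivC hornerC oner_eq0 !mulr1 mulr0 addr0.
by split=> // t _; rewrite hornerC mulr1.
Qed.

Lemma jet_cst c : jet (fun=> c) c 0.
Proof. by have := jet_poly c%:P; rewrite derivC !hornerC; apply: jet_ext => t; rewrite hornerC. Qed.

Lemma jet_id : jet id 0 1.
Proof. by have := jet_poly 'X; rewrite derivX hornerC hornerX; apply: jet_ext => t;
  rewrite hornerX. Qed.

Lemma jetD phi psi a b a' b' : jet phi a b -> jet psi a' b' ->
  jet (fun t => phi t + psi t) (a + a') (b + b').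
Proof.
move=> [p [q [q0 pq pa pb]]] [p' [q' [q'0 pq' pa' pb']]].
exists (p * q' + p' * q), (q * q'); split.
- by rewrite hornerM mulf_neq0.
- move=> t; rewrite hornerM mulf_eq0 negb_or => /andP[qt qt'].
  by rewrite !(hornerM, hornerD, hornerN) -pq // -pq' //; ring.
- by rewrite !(hornerM, hornerD, hornerN) pa pa'; ring.
- by rewrite !derivD !derivM !(hornerM, hornerD, hornerN) pa pb pa' pb'; ring.
Qed.

Lemma jetM phi psi a b a' b' : jet phi a b -> jet psi a' b' ->
  jet (fun t => phi t * psi t) (a * a') (b * a' + a * b').
Proof.
move=> [p [q [q0 pq pa pb]]] [p' [q' [q'0 pq' pa' pb']]].
exists (p * p'), (q * q'); split.
- by rewrite hornerM mulf_neq0.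
- move=> t; rewrite hornerM mulf_eq0 negb_or => /andP[qt qt'].
  by rewrite !(hornerM, hornerD, hornerN) -pq // -pq' //; ring.
- by rewrite !(hornerM, hornerD, hornerN) pa pa'; ring.
- by rewrite !derivM !(hornerM, hornerD, hornerN) pa pb pa' pb'; ring.
Qed.

Lemma jetV phi a b : a != 0 -> jet phi a b ->
  jet (fun t => (phi t)^-1) a^-1 (- b / a ^+ 2).
Proof.
move=> a0 [p [q [q0 pq pa pb]]]; exists (q * q), (p * q); split.
- by rewrite hornerM pa !mulf_neq0.
- move=> t; rewrite hornerM mulf_eq0 negb_or => /andP[pt qt].
  rewrite hornerM mulrA -pq // mulKf //.
  by apply: contra_neq pt => pt; rewrite -pq // pt mul0r.
- by rewrite !(hornerM, hornerD, hornerN) pa; field.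
- by rewrite !derivM !(hornerM, hornerD, hornerN) pa pb; field.
Qed.

Lemma jetZ c phi a b : jet phi a b -> jet (fun t => c * phi t) (c * a) (c * b).
Proof. by move=> /(jetM (jet_cst c)); rewrite mul0r add0r. Qed.

Lemma jetN phi a b : jet phi a b -> jet (fun t => - phi t) (- a) (- b).
Proof.
by move=> /(jetZ (-1)); rewrite !mulN1r; apply: jet_ext => t; rewrite mulN1r.
Qed.

Lemma jet_sum (I : Type) (s : seq I) (P : pred I) (phi : I -> F -> F) (a b : I -> F) :
  (forall i, jet (phi i) (a i) (b i)) ->
  jet (fun t => \sum_(i <- s | P i) phi i t) (\sum_(i <- s | P i) a i)
      (\sum_(i <- s | P i) b i).
Proof.
move=> h; elim: s => [|i s IH].
  by rewrite !big_nil; apply: jet_ext (jet_cst 0) => t; rewrite big_nil.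
rewrite !big_cons; case Pi: (P i).
  by apply: jet_ext (jetD (h i) IH) => t; rewrite big_cons Pi.
by apply: jet_ext IH => t; rewrite big_cons Pi.
Qed.

(** Multiplying numerator and denominator by s turns the exceptional points into poles, where a jet
    demands nothing. *)
Lemma jet_congr s phi psi a b : s.[0] != 0 ->
  (forall t, s.[t] != 0 -> phi t = psi t) -> jet phi a b -> jet psi a b.
Proof.
move=> s0 e [p [q [q0 pq pa pb]]]; exists (p * s), (q * s); split.
- by rewrite hornerM mulf_neq0.
- move=> t; rewrite hornerM mulf_eq0 negb_or => /andP[qt st].
  by rewrite -e // mulrA pq // hornerM.
- by rewrite !(hornerM, hornerD, hornerN) pa; ring.
- by rewrite !derivM !(hornerM, hornerD, hornerN) pa pb; ring.
Qed.

(** The two rational functions agree off finitely many points of an infinite field, hence p q' = p'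
    q. Evaluating this identity and its derivative at 0 gives the two equalities. *)
Lemma jet_uniq phi a b a' b' : jet phi a b -> jet phi a' b' -> a = a' /\ b = b'.
Proof.
move=> [p [q [q0 pq pa pb]]] [p' [q' [q'0 pq' pa' pb']]].
have e : p * q' = p' * q.
  have nz : q * q' != 0.
    by apply: contra_neq (mulf_neq0 q0 q'0) => /(congr1 (horner^~ 0)); rewrite hornerM hornerC.
  apply/eqP; rewrite -subr_eq0 -[_ == _]orbF -(negbTE nz) -mulf_eq0.
  apply/eqP/poly_eq0_fun => t; rewrite !(hornerM, hornerD, hornerN).
  have [->|qt] := eqVneq q.[t] 0; first by rewrite mul0r mulr0.
  have [->|qt'] := eqVneq q'.[t] 0; first by rewrite !mulr0.
  by rewrite -pq // -pq' //; ring.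
have cancel u v : u * (q.[0] * q'.[0]) = v * (q.[0] * q'.[0]) -> u = v.
  by move/(mulIf (mulf_neq0 q0 q'0)).
have aa : a = a'.
  apply: cancel; have := congr1 (horner^~ 0) e; rewrite !hornerM pa pa' => h.
  by apply: (etrans _ (etrans h _)); ring.
split=> //; apply: cancel; subst a'.
have := congr1 (fun s : {poly F} => s^`().[0]) e.
rewrite !derivM !(hornerM, hornerD) pa pa' pb pb' => h.
apply: (addIr (a * q^`().[0] * q'.[0] + a * q.[0] * q'^`().[0])).
by apply: (etrans _ (etrans h _)); ring.
Qed.

End Jet.

Section MatrixJet.
Variable F : numFieldType.

Definition mjet m n (phi : F -> 'M[F]_(m, n)) (A B : 'M[F]_(m, n)) :=
  forall i j, jet (fun t => phi t i j) (A i j) (B i j).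

Lemma mjet_uniq m n (phi : F -> 'M[F]_(m, n)) A B A' B' :
  mjet phi A B -> mjet phi A' B' -> B = B'.
Proof. by move=> h h'; apply/matrixP=> i j; have [] := jet_uniq (h i j) (h' i j). Qed.

Lemma mjet_ext m n (phi psi : F -> 'M[F]_(m, n)) A B :
  phi =1 psi -> mjet phi A B -> mjet psi A B.
Proof. by move=> e h i j; apply: jet_ext (h i j) => t; rewrite e. Qed.

Lemma mjet_eq m n (phi : F -> 'M[F]_(m, n)) A B A' B' :
  mjet phi A B -> A = A' -> B = B' -> mjet phi A' B'.
Proof. by move=> + <- <-. Qed.

Lemma mjet_cst m n (A : 'M[F]_(m, n)) : mjet (fun=> A) A 0.
Proof. by move=> i j; rewrite mxE; apply: jet_cst. Qed.

Lemma mjetM m n p (phi : F -> 'M[F]_(m, n)) (psi : F -> 'M[F]_(n, p)) A B A' B' :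
  mjet phi A B -> mjet psi A' B' ->
  mjet (fun t => phi t *m psi t) (A *m A') (B *m A' + A *m B').
Proof.
move=> h h' i j; rewrite !mxE -big_split /=.
apply: jet_ext (jet_sum _ _ (fun k => jetM (h i k) (h' k j))) => t.
by rewrite mxE.
Qed.

Lemma mjetD m n (phi psi : F -> 'M[F]_(m, n)) A B A' B' :
  mjet phi A B -> mjet psi A' B' ->
  mjet (fun t => phi t + psi t) (A + A') (B + B').
Proof.
by move=> h h' i j; rewrite !mxE; apply: jet_ext (jetD (h i j) (h' i j)) => t; rewrite mxE.
Qed.

Lemma mjetZ m n (f : F -> F) a b (A : 'M[F]_(m, n)) :
  jet f a b -> mjet (fun t => f t *: A) (a *: A) (b *: A).
Proof.
move=> h i j; rewrite !mxE; have := jetM h (jet_cst (A i j)).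
by rewrite mulr0 addr0; apply: jet_ext => t; rewrite mxE.
Qed.

Lemma mjet_congr s m n (phi psi : F -> 'M[F]_(m, n)) A B : s.[0] != 0 ->
  (forall t, s.[t] != 0 -> phi t = psi t) -> mjet phi A B -> mjet psi A B.
Proof. by move=> s0 e h i j; apply: jet_congr s0 _ (h i j) => t /e ->. Qed.

(** The chain rule along every curve through a, with one covector c for all curves; this uniformity
    makes the differential of a representation linear. *)
Definition has_gradient n (a : 'I_n -> F) (f : ('I_n -> F) -> F) :=
  exists c : 'I_n -> F, forall (phi : 'I_n -> F -> F) b,
    (forall k, jet (phi k) (a k) (b k)) ->
    jet (fun t => f (phi^~ t)) (f a) (\sum_k c k * b k).

Lemma has_gradient_closed n (a : 'I_n -> F) : fun_closed (has_gradient a).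
Proof.
split.
- move=> f g fg [c cP]; exists c => phi b h; rewrite -fg.
  by apply: jet_ext (cP _ _ h) => t; rewrite fg.
- move=> c; exists (fun=> 0) => phi b h; rewrite big1 => [|k _]; first exact: jet_cst.
  by rewrite mul0r.
- move=> f g [c cP] [d dP]; exists (fun k => c k + d k) => phi b h.
  rewrite (eq_bigr (fun k => c k * b k + d k * b k)) => [|k _]; last by rewrite mulrDl.
  by rewrite big_split; apply: jetD; [apply: cP | apply: dP].
- move=> f g [c cP] [d dP]; exists (fun k => g a * c k + f a * d k) => phi b h.
  apply: jet_eq (jetM (cP _ _ h) (dP _ _ h)) _ _ => //.
  rewrite mulr_suml mulr_sumr -big_split; apply: eq_bigr => k _ /=; ring.
Qed.

Lemma meval_has_gradient n (P : mpoly.mpoly n F) (a : 'I_n -> F) :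
  has_gradient a (fun v => mpoly.meval v P).
Proof.
apply: (fun_closed_meval (has_gradient_closed a)) => i.
exists (fun k => (k == i)%:R) => phi b h.
rewrite (bigD1 i) //= eqxx mul1r big1 ?addr0 => [|k /negbTE ->]; last by rewrite mul0r.
exact: h.
Qed.

End MatrixJet.

Section Laurent.
Variable F : numFieldType.

Definition laurent (phi : F -> F) := exists N (p : {poly F}),
  forall z, z != 0 -> phi z * z ^+ N = p.[z].

Lemma laurent_closed : fun_closed laurent.
Proof.
split.
- by move=> f g fg [N [p pE]]; exists N, p => z z0; rewrite -fg pE.
- by move=> c; exists 0, c%:P => z _; rewrite hornerC mulr1.
- move=> f g [N [p pE]] [N' [p' pE']]; exists (N + N')%N, (p * 'X^N' + p' * 'X^N) => z z0.
  by rewrite !(hornerD, hornerM, hornerXn) -pE // -pE' // exprD; ring.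
- move=> f g [N [p pE]] [N' [p' pE']]; exists (N + N')%N, (p * p') => z z0.
  by rewrite hornerM -pE // -pE' // exprD; ring.
Qed.

Lemma laurent_id : laurent id.
Proof. by exists 0, 'X => z _; rewrite hornerX mulr1. Qed.

Lemma laurentV : laurent (fun z => z^-1).
Proof. by exists 1, 1 => z z0; rewrite hornerC expr1 mulVf. Qed.

Lemma laurent_uniform (I : finType) (phi : I -> F -> F) : (forall i, laurent (phi i)) ->
  exists N (p : I -> {poly F}), forall i z, z != 0 -> phi i z * z ^+ N = (p i).[z].
Proof.
move=> /fin_all_exists [N NP]; have [p pP] := fin_all_exists NP.
exists (\sum_i N i)%N, (fun i => p i * 'X^(\sum_(j | j != i) N j)) => i z z0.
by rewrite (bigD1 i) //= exprD mulrA pP // hornerM hornerXn.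
Qed.

End Laurent.

(** * Weights and the differential of a representation *)

Section Torus.
Variables (C : numClosedFieldType) (r : nat).
Implicit Types (z : 'I_r -> C).
Local Notation om := (@symp_form C r).
Local Notation x_ := (@xvec C r).
Local Notation y_ := (@yvec C r).

Lemma torus_mx_diag z : torus_elt z =
  diag_mx (\row_k (if odd k then (z (half_coord k))^-1 else z (half_coord k))).
Proof.
apply/matrixP=> a b; rewrite /torus_elt summxE [RHS]mxE !mxE.
rewrite (bigD1 (half_coord b)) //= big1 ?addr0 => [|i ib].
  case: (coordP a) => i _; case: (coordP b) => j _;
    rewrite !mxE ?half_xcoord ?half_ycoord !eq_coord ?andbF ?andbT ?mulr0 ?addr0 ?add0r //;
    have [->|] := eqVneq i j; rewrite ?eqxx ?mulr1 ?mulr1n ?mulr0 //.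
move: ib; case: (coordP b) => j _; rewrite ?half_xcoord ?half_ycoord => /negbTE ij;
  by rewrite !mxE !eq_coord ![j == i]eq_sym ij !andbF !mulr0 addr0.
Qed.

Lemma torus_mul_coord z m (A : 'M[C]_(r.*2, m)) i j :
  ((torus_elt z *m A) (xcoord i) j = z i * A (xcoord i) j)
  * ((torus_elt z *m A) (ycoord i) j = (z i)^-1 * A (ycoord i) j).
Proof.
by rewrite torus_mx_diag; split; rewrite mul_diag_mx !mxE /= odd_double ?half_xcoord ?half_ycoord.
Qed.

Lemma torus_xy z i : (torus_elt z *m x_ i = z i *: x_ i)
  * (torus_elt z *m y_ i = (z i)^-1 *: y_ i).
Proof.
by split; apply/matrixP=> a b; rewrite ord1; case: (coordP a) => j _;
  rewrite torus_mul_coord !mxE !eq_coord !andbT ?mulr0 //; have [->|] := eqVneq j i;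
  rewrite ?mulr0.
Qed.

Definition torus_pt z := forall i, z i != 0.

Lemma torus_symplectic z : torus_pt z -> in_Sp (torus_elt z).
Proof.
move=> z0; apply: om_eq_symplectic => u v; apply: eq_bigr => i _.
by rewrite !torus_mul_coord; have := z0 i; move: (z i) => a a0; field.
Qed.

Lemma torusM z w : torus_elt z *m torus_elt w = torus_elt (fun i => z i * w i).
Proof.
rewrite !torus_mx_diag mulmx_diag; congr diag_mx; apply/rowP=> k; rewrite !mxE.
by case: ifP; rewrite // invfM.
Qed.

Lemma torus1 : torus_elt (fun=> 1) = 1%:M :> 'M[C]_r.*2.
Proof.
by rewrite torus_mx_diag -diag_const_mx; congr diag_mx; apply/rowP=> k; rewrite !mxE invr1 if_same.
Qed.

Definition torus_at (i : 'I_r) (a : C) : 'I_r -> C := fun j => if j == i then a else 1.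

Lemma torus_at_pt i (a : C) : a != 0 -> torus_pt (torus_at i a).
Proof. by move=> z0 j; rewrite /torus_at; case: ifP; rewrite ?oner_eq0. Qed.

Lemma eq_torus z w : z =1 w -> torus_elt z = torus_elt w.
Proof. by move=> zw; apply: eq_bigr => i _; rewrite zw. Qed.

End Torus.

Section Differential.
Variables (C : numClosedFieldType) (r n : nat).
Implicit Types (u v w : 'cV[C]_r.*2) (g h : 'M[C]_r.*2).
Local Notation om := (@symp_form C r).
Local Notation x_ := (@xvec C r).
Local Notation y_ := (@yvec C r).
Variable rep : 'M[C]_r.*2 -> 'M[C]_n.
Hypothesis rep_sp : is_poly_rep rep.

(** Curves need to lie in the group only off the zeros of some s with s(0) nonzero, which admits the
    torus curves. D lives on all matrices, but the second clause determines it only on velocities of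
    curves in the group. *)
Definition differential (D : 'M[C]_r.*2 -> 'M[C]_n) := linear D /\
  forall (c : C -> 'M[C]_r.*2) X (s : {poly C}), s.[0] != 0 ->
    (forall t, s.[t] != 0 -> in_Sp (c t)) -> mjet c 1%:M X ->
    mjet (rep \o c) 1%:M (D X).

Lemma differential_exists : exists D, differential D.
Proof.
have [rep1 _ repP] := rep_sp.
(* For each matrix entry, c is the gradient at the identity of a polynomial that represents this
   entry on the group. *)
have /fin_all_exists [c cP] (ab : 'I_n * 'I_n) : exists c : 'I_(r.*2 * r.*2) -> C,
    forall (phi : C -> 'M[C]_r.*2) X (s : {poly C}), s.[0] != 0 ->
    (forall t, s.[t] != 0 -> in_Sp (phi t)) -> mjet phi 1%:M X ->
    jet (fun t => rep (phi t) ab.1 ab.2) ((1%:M : 'M_n) ab.1 ab.2)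
      (\sum_k c k * mxvec X 0 k).
  have [P PE] := repP ab.1 ab.2.
  have [c cP] := meval_has_gradient P (fun k => mxvec (1%:M : 'M[C]_r.*2) 0 k).
  exists c => phi X s s0 sphi jphi.
  rewrite -rep1 PE; last exact: symplectic1.
  apply: (jet_congr s0 (phi := fun t => mpoly.meval (fun k => mxvec (phi t) 0 k) P)).
    by move=> t /sphi /PE ->.
  apply: cP => k; case/mxvec_indexP: k => i j; rewrite !mxvecE.
  by apply: jet_ext (jphi i j) => t; rewrite mxvecE.
exists (fun X => \matrix_(a, b) \sum_k c (a, b) k * mxvec X 0 k); split.
  move=> a X Y; apply/matrixP=> i j; rewrite !mxE mulr_sumr -big_split.
  by apply: eq_bigr => k _; rewrite linearP !mxE /=; ring.
move=> phi X s s0 sphi jphi i j; rewrite [X in jet _ _ X]mxE.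
exact: (cP (i, j) _ _ s).
Qed.

Lemma rep_inv g : in_Sp g -> rep g *m rep (invmx g) = 1%:M.
Proof.
have [rep1 repM _] := rep_sp => gs; rewrite -repM //; last exact: symplecticV.
by rewrite mulmxV ?gs.1.
Qed.

Variables (D : 'M[C]_r.*2 -> 'M[C]_n) (Dd : differential D).

Definition quad_mx u v : 'M[C]_r.*2 := u *m covec v + v *m covec u.

(* The action of the element u v of Sym^2 C^(2r), identified with the Lie
   algebra sp_2r. *)
Definition dquad u v : 'M[C]_n := D (quad_mx u v).

Lemma differentialD X Y : D (X + Y) = D X + D Y.
Proof. by have := Dd.1 1 X Y; rewrite !scale1r. Qed.
Lemma differential0 : D 0 = 0.
Proof. by apply: (addrI (D 0)); rewrite -differentialD !addr0. Qed.
Lemma differentialZ a X : D (a *: X) = a *: D X.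
Proof. by have := Dd.1 a X 0; rewrite differential0 !addr0. Qed.
Lemma differentialN X : D (- X) = - D X.
Proof. by rewrite -scaleN1r differentialZ scaleN1r. Qed.

Lemma quad_mxC u v : quad_mx u v = quad_mx v u.
Proof. by rewrite /quad_mx addrC. Qed.
Lemma quad_mxDl u v w : quad_mx (u + v) w = quad_mx u w + quad_mx v w.
Proof. by rewrite /quad_mx mulmxDl covecD mulmxDr addrACA. Qed.
Lemma quad_mxZl a u v : quad_mx (a *: u) v = a *: quad_mx u v.
Proof. by rewrite /quad_mx -scalemxAl covecZ -scalemxAr scalerDr. Qed.

Lemma dquadC u v : dquad u v = dquad v u.
Proof. by rewrite /dquad quad_mxC. Qed.
Lemma dquadDl u v w : dquad (u + v) w = dquad u w + dquad v w.
Proof. by rewrite /dquad quad_mxDl differentialD. Qed.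
Lemma dquadDr u v w : dquad u (v + w) = dquad u v + dquad u w.
Proof. by rewrite dquadC dquadDl !(dquadC _ u). Qed.
Lemma dquadZl a u v : dquad (a *: u) v = a *: dquad u v.
Proof. by rewrite /dquad quad_mxZl differentialZ. Qed.
Lemma dquadZr a u v : dquad u (a *: v) = a *: dquad u v.
Proof. by rewrite dquadC dquadZl dquadC. Qed.
Lemma dquad_diag v : dquad v v = 2 *: D (v *m covec v).
Proof. by rewrite -differentialZ scaler_nat mulr2n. Qed.

(** The velocity of [rep (transvec v t)] at t = 0. Identities are proved for these squares by
    differentiating along transvections and reach [dquad] by polarization. *)
Definition dsquare v : 'M[C]_n := D (v *m covec v).

Lemma mjet_transvec v : mjet (transvec v) 1%:M (v *m covec v).
Proof.
apply: mjet_eq (mjetD (mjet_cst 1%:M) (mjetZ (v *m covec v) (jet_id _))) _ _.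
  by rewrite scale0r addr0.
by rewrite scale1r add0r.
Qed.

Lemma mjet_rep_transvec v : mjet (rep \o transvec v) 1%:M (dsquare v).
Proof.
apply: (Dd.2 _ _ 1); rewrite ?hornerC ?oner_eq0 //; last exact: mjet_transvec.
by move=> t _; apply: transvec_symplectic.
Qed.

Lemma quad_mx_polar u v : quad_mx u v =
  (u + v) *m covec (u + v) - u *m covec u - v *m covec v.
Proof.
rewrite covecD mulmxDr !mulmxDl /quad_mx.
move: (u *m _) (v *m _) (u *m _) (v *m _) => a b c d.
by apply/matrixP=> i j; rewrite !mxE; ring.
Qed.

Lemma dquad_polarE u v : dquad u v = dsquare (u + v) - dsquare u - dsquare v.
Proof.
rewrite /dquad quad_mx_polar /dsquare.
move: (_ *m covec (u + v)) (u *m _) (v *m _) => a b c.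
by rewrite (differentialD (a - b)) (differentialD a) !differentialN.
Qed.

Lemma dquad_polar (f : 'M[C]_n -> 'M[C]_n) (k : 'cV[C]_r.*2 -> 'cV[C]_r.*2) :
  (forall a b, f (a + b) = f a + f b) -> (forall a, f (- a) = - f a) ->
  (forall u v, k (u + v) = k u + k v) ->
  (forall v, f (dsquare v) = dsquare (k v)) ->
  forall u v, f (dquad u v) = dquad (k u) (k v).
Proof.
move=> fD fN kD fk u v.
by rewrite (dquad_polarE u) (dquad_polarE (k u)) -(kD u) -(fk u) -(fk v) -(fk (u + v)) !fD !fN.
Qed.

(** Equivariance under the adjoint action: conjugating the curve [transvec v] by g gives the curve
    [transvec (g *m v)], and jets are unique. *)
Lemma rep_dquad g u v : in_Sp g ->
  rep g *m dquad u v *m rep (invmx g) = dquad (g *m u) (g *m v).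
Proof.
have [rep1 repM _] := rep_sp => gs.
pose f A := rep g *m A *m rep (invmx g).
rewrite -/(f _); apply: (dquad_polar (f := f) (k := mulmx g)) => [a b|a|a b|w].
- by rewrite /f mulmxDr mulmxDl.
- by rewrite /f mulmxN mulNmx.
- by rewrite mulmxDr.
have j1 := mjetM (mjetM (mjet_cst (rep g)) (mjet_rep_transvec w)) (mjet_cst (rep (invmx g))).
have j2 := mjet_rep_transvec (g *m w).
have e t : rep g *m (rep \o transvec w) t *m rep (invmx g) = (rep \o transvec (g *m w)) t.
  have tw := transvec_symplectic w t; have gV := symplecticV gs.
  rewrite /= -(transvec_conj w t gs) (repM _ _ (symplecticM gs tw) gV).
  by rewrite (repM _ _ gs tw).
have := mjet_uniq (mjet_ext e j1) j2.
by rewrite mul0mx add0r mulmx0 addr0 => <-.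
Qed.

Lemma rep_dquad_comm g u v : in_Sp g ->
  rep g *m dquad u v = dquad (g *m u) (g *m v) *m rep g.
Proof.
have [rep1 repM _] := rep_sp => gs.
rewrite -rep_dquad // -!mulmxA.
by rewrite -repM ?mulVmx ?rep1 ?mulmx1 ?gs.1 //; apply: symplecticV.
Qed.

Definition comm (A B : 'M[C]_n) := A *m B - B *m A.

(** The derivative at t = 0 of [rep_dquad_comm] for g = [transvec v t], whose right-hand side [Q t]
    is quadratic in t. *)
Lemma comm_dquad1 v u w : comm (dsquare v) (dquad u w)
  = om v u *: dquad v w + om v w *: dquad u v.
Proof.
have jT := mjet_rep_transvec v.
pose Q t := dquad (transvec v t *m u) (transvec v t *m w).
have jQ : mjet Q (dquad u w) (om v u *: dquad v w + om v w *: dquad u v).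
  have jX : jet (fun t : C => t) 0 1 := jet_id _.
  have j1 := mjetD (mjetD (mjetD (mjet_cst (dquad u w))
     (mjetZ (om v u *: dquad v w) jX)) (mjetZ (om v w *: dquad u v) jX))
     (mjetZ ((om v u * om v w) *: dquad v v) (jetM jX jX)).
  apply: mjet_eq (mjet_ext _ j1) _ _.
  - move=> t; rewrite /Q !transvec_mul.
    move: (om v u) (om v w) => a b.
    rewrite (dquadDl u) (dquadDr u) (dquadDr (_ *: v) w).
    rewrite (dquadZr _ u) (dquadZl _ v w) (dquadZl _ v) (dquadZr _ v) scalerA.
    move: (dquad u w) (dquad v w) (dquad u v) (dquad v v) => e f g h.
    by apply/matrixP=> i j; rewrite !mxE; ring.
  - move: (dquad u w) (_ *: dquad v w) (_ *: dquad u v) (_ *: dquad v v) => a b c d.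
    by rewrite mul0r !scale0r !addr0.
  - move: (_ *: dquad v w) (_ *: dquad u v) (_ *: dquad v v) => b c d.
    by rewrite mul0r mulr0 addr0 !scale1r scale0r addr0 add0r.
have e t : (rep \o transvec v) t *m dquad u w = Q t *m (rep \o transvec v) t.
  by rewrite /= rep_dquad_comm //; apply: transvec_symplectic.
have := mjet_uniq (mjet_ext e (mjetM jT (mjet_cst (dquad u w)))) (mjetM jQ jT).
by rewrite mulmx0 addr0 mulmx1 /comm => ->; rewrite addrK.
Qed.

(** The bracket of the Lie algebra on Sym^2: [comm_dquad1] polarized in v. *)
Lemma comm_dquad v v' u w : comm (dquad v v') (dquad u w) =
  om v u *: dquad v' w + om v' u *: dquad v w
  + (om v w *: dquad u v' + om v' w *: dquad u v).
Proof.
have cB A B Y : comm (A - B) Y = comm A Y - comm B Y.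
  rewrite /comm mulmxBl mulmxBr.
  move: (A *m Y) (B *m Y) (Y *m A) (Y *m B) => a b c d.
  by apply/matrixP=> i j; rewrite !mxE; ring.
rewrite dquad_polarE (cB (_ - _)) cB !comm_dquad1 (omDl v) (omDl v).
rewrite (dquadDl v) (dquadDr u).
move: (dquad v w) (dquad v' w) (dquad u v) (dquad u v') => a b c d.
by apply/matrixP=> i j; rewrite !mxE; ring.
Qed.

End Differential.

(** * Simultaneous diagonalization of the torus *)

Section OneParameter.
Variables (F : numFieldType) (n : nat) (f : F -> 'M[F]_n).
Hypothesis fM : forall z w, z != 0 -> w != 0 -> f (z * w) = f z *m f w.
Hypothesis f1 : f 1 = 1%:M.
Hypothesis f_laurent : forall i j, laurent (fun z => f z i j).

Lemma coef_uniq K (a b : 'I_K -> F) :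
  (forall z, z != 0 -> \sum_(k < K) z ^+ k * a k = \sum_(k < K) z ^+ k * b k) -> a =1 b.
Proof.
move=> ab k; pose p := \poly_(i < K) (if insub i is Some j then a j - b j else 0).
suff /(congr1 (fun q : {poly F} => q`_k)) : p = 0.
  by rewrite coef_poly ltn_ord valK coef0 => /eqP; rewrite subr_eq0 => /eqP.
(* The hypothesis says nothing at z = 0; the factor X covers that point. *)
suff /eqP: 'X * p = 0 by rewrite mulf_eq0 polyX_eq0 => /eqP.
apply: poly_eq0_fun => z; rewrite hornerM hornerX.
have [->|/ab e] := eqVneq z 0; first by rewrite mul0r.
rewrite horner_poly; apply/eqP; rewrite mulf_eq0; apply/orP; right.
move/eqP: e; rewrite -subr_eq0 -sumrB; congr (_ == _); apply: eq_bigr => i _.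
by rewrite valK -mulrBr mulrC.
Qed.

(** The [pi k] are the coefficients in f(z) = sum of z^(k - N) pi_k. Comparing coefficients of z in
    f(z w) = f(z) f(w), and in the opposite order, gives the eigenvalue equations. *)
Lemma one_param_spectrum : exists K N (pi : 'I_K -> 'M[F]_n),
  [/\ \sum_k pi k = 1%:M,
      forall k w, w != 0 -> pi k *m f w = (w ^+ k / w ^+ N) *: pi k
    & forall k w, w != 0 -> f w *m pi k = (w ^+ k / w ^+ N) *: pi k].
Proof.
have [N [p pE]] := laurent_uniform (fun ij : 'I_n * 'I_n => f_laurent ij.1 ij.2).
pose K := (\max_ij size (p ij))%N.
pose pi (k : 'I_K) : 'M[F]_n := \matrix_(i, j) (p (i, j))`_k.
have fpi z : z != 0 -> z ^+ N *: f z = \sum_(k < K) z ^+ k *: pi k.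
  move=> z0; apply/matrixP=> i j; rewrite mxE mulrC (pE (i, j)) // summxE.
  rewrite (@horner_coef_wide _ K); last exact: leq_bigmax.
  by apply: eq_bigr => k _; rewrite !mxE mulrC.
have fpi' z : z != 0 -> f z = z ^- N *: \sum_(k < K) z ^+ k *: pi k.
  by move=> z0; rewrite -fpi // scalerA mulVf ?expf_neq0 // scale1r.
exists K, N, pi; split.
- rewrite -f1 fpi' ?oner_eq0 // expr1n invr1 scale1r.
  by apply: eq_bigr => k _; rewrite expr1n scale1r.
- move=> k w w0; apply/matrixP=> i j; move: k; apply: coef_uniq => z z0.
  have : z ^+ N *: (f z *m f w) = z ^+ N *: f (z * w) by rewrite fM.
  rewrite scalemxAl fpi // (fpi' (z * w)) ?mulf_neq0 // scalerA.
  move=> /matrixP/(_ i j); rewrite mulmx_suml summxE mxE summxE.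
  rewrite [X in X = _](eq_bigr (fun k : 'I_K => z ^+ k * (pi k *m f w) i j)); last first.
    by move=> k _; rewrite -scalemxAl mxE.
  move=> ->; rewrite mulr_sumr; apply: eq_bigr => k _; rewrite !mxE !exprMn.
  by field; rewrite !expf_neq0.
- move=> k w w0; apply/matrixP=> i j; move: k; apply: coef_uniq => z z0.
  have : z ^+ N *: (f w *m f z) = z ^+ N *: f (w * z) by rewrite fM.
  rewrite scalemxAr fpi // (fpi' (w * z)) ?mulf_neq0 // scalerA.
  move=> /matrixP/(_ i j); rewrite mulmx_sumr summxE mxE summxE.
  rewrite [X in X = _](eq_bigr (fun k : 'I_K => z ^+ k * (f w *m pi k) i j)); last first.
    by move=> k _; rewrite -scalemxAr mxE.
  move=> ->; rewrite mulr_sumr; apply: eq_bigr => k _; rewrite !mxE !exprMn.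
  by field; rewrite !expf_neq0.
Qed.

Lemma pow2_inj k m N : (2 ^+ k / 2 ^+ N == 2 ^+ m / 2 ^+ N :> F) = (k == m).
Proof.
rewrite (inj_eq (mulIf _)) ?invr_eq0 ?expf_neq0 ?pnatr_eq0 //.
by apply: inj_eq; apply: ieexprIn; rewrite ?ltr0n // gt_eqF // ltr1n.
Qed.

Lemma one_param_diagonalizable : diagonalizable (f 2).
Proof.
have [K [N [pi [pi1 piR _]]]] := one_param_spectrum.
have n20 : (2 : F) != 0 by rewrite pnatr_eq0.
apply/diagonalizablePeigen.
exists [seq 2 ^+ val k / 2 ^+ N | k <- enum 'I_K].
  by rewrite map_inj_uniq ?enum_uniq // => k m /eqP; rewrite pow2_inj => /eqP /val_inj.
apply/eqmxP; rewrite submx1 -pi1 /= big_map big_enum summx_sub // => k _.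
by apply: (sumsmx_sup k) => //; apply/eigenspaceP; rewrite piR.
Qed.

(** Distinct powers of 2 are different in F, so an eigenvector of f(2) alone is concentrated on a
    single [pi m], hence is a weight vector for every w. *)
Lemma one_param_weight (x : 'rV[F]_n) d : x != 0 -> x *m f 2 = d *: x ->
  exists m : int, forall w, w != 0 -> x *m f w = w ^ m *: x.
Proof.
have [K [N [pi [pi1 piR piL]]]] := one_param_spectrum.
have n20 : (2 : F) != 0 by rewrite pnatr_eq0.
move=> x0 xd.
have dpi k : (d - 2 ^+ val k / 2 ^+ N) *: (x *m pi k) = 0.
  apply/eqP; rewrite scalerBl subr_eq0 scalemxAl -xd -mulmxA piL //.
  by rewrite -scalemxAr.
have [m xm] : exists m, x *m pi m != 0.
  apply/existsP; apply: contraNT x0 => /existsPn h.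
  rewrite -[x]mulmx1 -pi1 mulmx_sumr big1 // => k _.
  by apply/eqP; have := h k; rewrite negbK.
have dm : d = 2 ^+ val m / 2 ^+ N.
  by have /eqP := dpi m; rewrite scaler_eq0 (negbTE xm) orbF subr_eq0 => /eqP.
have xE : x = x *m pi m.
  rewrite -{1}[x]mulmx1 -pi1 mulmx_sumr (bigD1 m) //= big1 ?addr0 // => k km.
  have /eqP := dpi k; rewrite scaler_eq0 dm subr_eq0 pow2_inj.
  by rewrite [m == k :> nat]eq_sym [k == m :> nat](negbTE km) => /eqP.
exists (m%:Z - N%:Z) => w w0.
by rewrite {1}xE -mulmxA piR // -scalemxAr -xE expfzDr // -exprnN.
Qed.

End OneParameter.

Lemma row_diag_mul (F : comNzRingType) m n (d : 'rV[F]_m) (B : 'M[F]_(m, n)) j :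
  row j (diag_mx d *m B) = d 0 j *: row j B.
Proof. by apply/rowP => k; rewrite mul_diag_mx !mxE. Qed.

Section WeightBasis.
Variables (C : numClosedFieldType) (r n : nat).
Variable rep : 'M[C]_r.*2 -> 'M[C]_n.
Hypothesis rep_sp : is_poly_rep rep.

Definition monomial (z : 'I_r -> C) (mu : 'rV[int]_r) : C := \prod_i z i ^ mu 0 i.

Let rep_at i (a : C) := rep (torus_elt (torus_at i a)).

Lemma rep_atM i a b : a != 0 -> b != 0 -> rep_at i (a * b) = rep_at i a *m rep_at i b.
Proof.
case: rep_sp => _ repM _ a0 b0; rewrite /rep_at -repM; first last.
- exact/torus_symplectic/torus_at_pt.
- exact/torus_symplectic/torus_at_pt.
rewrite torusM; congr (rep _); apply: eq_torus => j; rewrite /torus_at.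
by case: ifP; rewrite ?mulr1.
Qed.

Lemma rep_at1 i : rep_at i 1 = 1%:M.
Proof.
case: rep_sp => rep1 _ _; rewrite -rep1 /rep_at -torus1; congr (rep _).
by apply: eq_torus => j; rewrite /torus_at if_same.
Qed.

Lemma rep_at_laurent i a b : laurent (fun z => rep_at i z a b).
Proof.
case: rep_sp => _ _ repP; have [P PE] := repP a b.
have [N [p pE]] : laurent (fun z : C =>
    mpoly.meval (fun k => mxvec (torus_elt (torus_at i z)) 0 k) P).
  apply: (fun_closed_meval (laurent_closed _)) => k.
  case/mxvec_indexP: k => c d.
  apply: (fun_closed_ext (laurent_closed _)) => [z|]; first by rewrite mxvecE torus_mx_diag !mxE.
  case: eqP => _; last exact: (fun_closed_cst (laurent_closed _) 0).
  case: (odd c); rewrite /torus_at; case: (half_coord c == i) => /=.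
  - exact: laurentV.
  - exact: (fun_closed_cst (laurent_closed _) _).
  - exact: laurent_id.
  - exact: (fun_closed_cst (laurent_closed _) _).
exists N, p => z z0; rewrite -pE // -PE //.
exact/torus_symplectic/torus_at_pt.
Qed.

(** The operators [rep_at i 2] commute and are diagonalizable; the rows of B form a common
    eigenbasis, which [one_param_weight] extends from 2 to all parameters. *)
Lemma weight_basis : exists (B : 'M[C]_n) (mu : 'I_n -> 'rV[int]_r), B \in unitmx /\
  forall z, torus_pt z ->
    B *m rep (torus_elt z) = diag_mx (\row_j monomial z (mu j)) *m B.
Proof.
have n20 : (2 : C) != 0 by rewrite pnatr_eq0.
have [B Bu BP] : codiagonalizable [seq rep_at i 2 | i <- enum 'I_r].
  apply/codiagonalizableP; split; last first.
    move=> _ /mapP[i _ ->]; apply: one_param_diagonalizable.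
    - exact: rep_atM.
    - exact: rep_at1.
    - exact: rep_at_laurent.
  move=> _ _ /mapP[i _ ->] /mapP[j _ ->]; case: rep_sp => _ repM _.
  have s k : in_Sp (torus_elt (torus_at k (2 : C))) by apply/torus_symplectic/torus_at_pt.
  rewrite /comm_mx /rep_at -!repM // !torusM; congr rep; apply: eq_torus => k.
  by rewrite mulrC.
have Brow j : row j B != 0.
  apply: contraTneq Bu => B0; rewrite -row_free_unit; apply/negP => /row_freeP[B' BB'].
  have := congr1 (row j) BB'; rewrite row_mul B0 mul0mx => /esym.
  by rewrite rowE mulmx1 => /matrixP/(_ 0 j); rewrite !mxE !eqxx => /eqP; rewrite oner_eq0.
have eig i j : exists m : int, forall w, w != 0 -> row j B *m rep_at i w = w ^ m *: row j B.
  have : rep_at i 2 \in [seq rep_at i 2 | i <- enum 'I_r] by apply/mapP; exists i;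
    rewrite ?mem_enum.
  move=> /(allP BP) /diagonalizable_forPex[d /(simmxP Bu)] /= e.
  apply: (one_param_weight _ _ _ (Brow j) (d := d 0 j)).
  - exact: rep_atM.
  - exact: rep_at1.
  - exact: rep_at_laurent.
  by rewrite -row_mul e row_diag_mul.
have /fin_all_exists [m mP] (ij : 'I_r * 'I_n) := eig ij.1 ij.2.
exists B, (fun j => \row_i m (i, j)); split=> // z z0.
apply/row_matrixP=> j; rewrite row_mul row_diag_mul [X in X *: _]mxE.
have [rep1 repM _] := rep_sp.
(* The coordinates of z are switched on one at a time, each contributing one one-parameter
   factor. *)
have gen (s : seq 'I_r) : uniq s ->
    row j B *m rep (torus_elt (fun i => if i \in s then z i else 1))
    = (\prod_(i <- s) z i ^ m (i, j)) *: row j B.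
  elim: s => [_|i s IH /= /andP[i_s /IH {}IH]].
    by rewrite big_nil scale1r (eq_torus (w := fun=> 1)) // torus1 rep1 mulmx1.
  have -> : torus_elt (fun k => if k \in i :: s then z k else 1) =
      torus_elt (torus_at i (z i)) *m torus_elt (fun k => if k \in s then z k else 1).
    rewrite torusM; apply: eq_torus => k; rewrite /torus_at inE.
    have [->|_] := eqVneq k i; last by rewrite mul1r.
    by rewrite (negbTE i_s) mulr1.
  rewrite repM; first last.
  - by apply: torus_symplectic => k; case: ifP; rewrite ?oner_eq0.
  - exact/torus_symplectic/torus_at_pt.
  rewrite mulmxA -/(rep_at i _) (mP (i, j)) // -scalemxAl IH scalerA.
  by rewrite big_cons.
rewrite (eq_torus (w := fun i => if i \in enum 'I_r then z i else 1)); last first.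
  by move=> i; rewrite mem_enum.
rewrite gen ?enum_uniq // big_enum /monomial; congr (_ *: _).
by apply: eq_bigr => i _; rewrite mxE.
Qed.

End WeightBasis.

Section Subspace.
Variables (F : fieldType) (n : nat) (P : 'cV[F]_n -> Prop).

Definition subspace_prop := P 0 /\ forall a u v, P u -> P v -> P (a *: u + v).

(** U grows by one vector at a time, using excluded middle, until it exhausts P; the codimension
    bounds the number of steps. This makes irreducibility applicable to subspaces given by a
    proposition. *)
Lemma vspace_of_subspace_prop : subspace_prop ->
  exists U : {vspace 'cV[F]_n}, forall v, v \in U <-> P v.
Proof.
move=> [P0 Pl].
suff H k (U : {vspace 'cV[F]_n}) : (forall v,
  v \in U -> P v) -> (\dim {: 'cV[F]_n} - \dim U <= k)%N ->
    exists U : {vspace 'cV[F]_n}, forall v, v \in U <-> P v.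
  by apply: (H _ 0%VS _ (leqnn _)) => v; rewrite memv0 => /eqP ->.
elim: k U => [|k IH] U UP Uk.
  have UT : U = fullv.
    by apply/eqP; rewrite eqEdim subvf -subn_eq0 -leqn0.
  by exists U => v; split; [apply: UP | rewrite UT memvf].
have [[v [Pv vU]]|nex] := boolp.EM (exists v, P v /\ v \notin U); last first.
  exists U => v; split; first exact: UP.
  by move=> Pv; apply: boolp.contrapT => /negP vU; apply: nex; exists v.
apply: (IH (U + <[v]>)%VS).
  move=> _ /memv_addP[u uU [_ /vlineP[a ->] ->]].
  by rewrite addrC; apply: Pl => //; apply: UP.
have lt : (\dim U < \dim (U + <[v]>))%N.
  rewrite ltn_neqAle dimvS ?addvSl // andbT; apply: contraNneq vU => e.
  have -> : U = (U + <[v]>)%VS by apply/eqP; rewrite eqEdim addvSl e leqnn.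
  by rewrite memvE addvSr.
move: Uk; rewrite !leq_subLR => Uk; apply: (leq_trans Uk).
by rewrite addnS -addSn leq_add2r.
Qed.

End Subspace.

Section DiagRep.
Variables (C : numClosedFieldType) (r n : nat).
Local Notation V := 'cV[C]_r.*2.

Definition rep_irreducible (rep : 'M[C]_r.*2 -> 'M[C]_n) := forall P : 'cV[C]_n -> Prop,
  subspace_prop P -> (forall g v, in_Sp g -> P v -> P (rep g *m v)) ->
  (exists2 v, v != 0 & P v) -> forall v, P v.

(** The representation written in a basis of weight vectors; [mu] lists the weights with
    multiplicity. *)
Record diag_rep (rep : 'M[C]_r.*2 -> 'M[C]_n) (mu : 'I_n -> 'rV[int]_r) : Prop := DiagRep {
  diag_rep_sp : is_poly_rep rep;
  diag_rep_gt0 : (0 < n)%N;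
  diag_rep_irr : rep_irreducible rep;
  diag_rep_torus : forall z, torus_pt z ->
    rep (torus_elt z) = diag_mx (\row_j monomial z (mu j)) }.

Lemma sp_irreducible_prop rep : is_irreducible_rep rep -> rep_irreducible rep.
Proof.
move=> [n0 irr] P Ps Prep [v v0 Pv] w.
have [U UP] := vspace_of_subspace_prop Ps.
case: (irr U) => [g u gs|U0|UT].
- by rewrite !UP; apply: Prep.
- by move/UP: Pv; rewrite U0 memv0 (negbTE v0).
- by apply/UP; rewrite UT memvf.
Qed.

Lemma diag_rep_exists rep : is_poly_rep rep -> is_irreducible_rep rep ->
  exists B mu, B \in unitmx /\ diag_rep (fun g => B *m rep g *m invmx B) mu.
Proof.
move=> rs irr; have [B [mu [Bu BP]]] := weight_basis rs.
have [rep1 repM repP] := rs.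
exists B, mu; split=> //; split.
- split.
  + by rewrite rep1 mulmx1 mulmxV.
  + by move=> g h gs hs; rewrite repM // !mulmxA mulmxKV.
  + move=> a b.
    have [P PE] := fin_all_exists (fun ij : 'I_n * 'I_n => repP ij.1 ij.2).
    exists (\sum_i \sum_j mpoly.mpolyC (r.*2 * r.*2) (B a j * invmx B i b) * P (j, i)) => g gs.
    rewrite !mxE raddf_sum; apply: eq_bigr => i _.
    rewrite mxE mulr_suml raddf_sum; apply: eq_bigr => j _ /=.
    by rewrite mpoly.mevalM mpoly.mevalC (PE (j, i)) //=; ring.
- by case: irr.
- move=> P [P0 Pl] Prep [v v0 Pv] w.
  have /(_ (fun u => P (B *m u))) := sp_irreducible_prop irr.
  move=> /(_ _ _ _ (invmx B *m w)); rewrite mulKVmx //; apply.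
  + by split=> [|a x y Px Py]; rewrite ?mulmx0 // mulmxDr -scalemxAr; apply: Pl.
  + by move=> g x gs /(Prep g _ gs); rewrite -!mulmxA mulKmx.
  + exists (invmx B *m v); last by rewrite mulKVmx.
    by apply: contraNneq v0 => e; rewrite -[v](mulKVmx Bu) e mulmx0.
- by move=> z z0; rewrite BP // mulmxK.
Qed.

End DiagRep.

(** * The Casimir operator *)

Section Casimir.
Variables (C : numClosedFieldType) (r : nat).
Local Notation V := 'cV[C]_r.*2.
Local Notation x_ := (@xvec C r).
Local Notation y_ := (@yvec C r).

Definition bilinear_form (T : V -> V -> C) :=
  (forall a u v w, T (a *: u + v) w = a * T u w + T v w)
  /\ (forall a u v w, T w (a *: u + v) = a * T w u + T w v).

Lemma linear_sum_delta (f : V -> C) (u : V) :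
  (forall a v w, f (a *: v + w) = a * f v + f w) ->
  f u = \sum_k u k 0 * f (delta_mx k 0).
Proof.
move=> fl; have f0 : f 0 = 0.
  by have := fl 1 0 0; rewrite scale1r addr0 mul1r => /eqP;
    rewrite addrC -subr_eq subrr eq_sym => /eqP.
rewrite {1}[u](matrix_sum_delta u).
elim: (index_enum _) => [|k s IH]; first by rewrite !big_nil.
by rewrite !big_cons big_ord1 fl IH.
Qed.

(** Contraction of T with the invariant bivector sum of [x_i] wedge [y_i]. *)
Definition symp_trace (T : V -> V -> C) := \sum_(i < r) (T (x_ i) (y_ i) - T (y_ i) (x_ i)).

Lemma bilinear_form_delta T u v : bilinear_form T ->
  T u v = \sum_k \sum_l u k 0 * v l 0 * T (delta_mx k 0) (delta_mx l 0).
Proof.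
move=> [Tl Tr].
rewrite (linear_sum_delta u (fun a x y => Tl a x y v)); apply: eq_bigr => k _.
rewrite (linear_sum_delta v (fun a x y => Tr a x y (delta_mx k 0))) mulr_sumr.
by apply: eq_bigr => l _; rewrite mulrA.
Qed.

Lemma symp_trace_mul T g : bilinear_form T ->
  symp_trace (fun u v => T (g *m u) (g *m v)) =
  \sum_k \sum_l symp_form (row k g)^T (row l g)^T * T (delta_mx k 0) (delta_mx l 0).
Proof.
move=> Tb; have TE u v := bilinear_form_delta u v Tb.
rewrite /symp_trace (eq_bigr (fun i => \sum_k \sum_l
  (g k (xcoord i) * g l (ycoord i) - g k (ycoord i) * g l (xcoord i)) *
    T (delta_mx k 0) (delta_mx l 0))).
  rewrite exchange_big; apply: eq_bigr => k _; rewrite exchange_big; apply: eq_bigr => l _ /=.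
  by rewrite -mulr_suml /symp_form; congr (_ * _); apply: eq_bigr => i _; rewrite !mxE.
move=> i _; rewrite (TE (g *m x_ i)) (TE (g *m y_ i)) -sumrB; apply: eq_bigr => k _.
rewrite -sumrB; apply: eq_bigr => l _; rewrite -!colE !mxE; ring.
Qed.

(** The transpose of a symplectic matrix also preserves the form: [g J g^T = J] follows from the
    formula for the inverse. *)
Lemma symplectic_rows g k l : in_Sp g ->
  symp_form (row k g)^T (row l g)^T = skew_mx C r k l.
Proof.
move=> gs; have e : g *m skew_mx C r *m g^T = skew_mx C r.
  have := mulmxV gs.1; rewrite symplectic_inv // mulmxN !mulmxA => e1.
  have := congr1 (mulmx^~ (skew_mx C r)) e1.
  rewrite mulNmx mul1mx -(mulmxA _ (skew_mx C r) (skew_mx C r)) skew_mx_sqr.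
  by rewrite mulmxN mulmx1 opprK.
rewrite -[in RHS]e omE /covec trmxK -!row_mul -[(row l g)^T]/(_).
by rewrite !mxE; apply: eq_bigr => a _; rewrite !mxE.
Qed.

Lemma symp_trace_invariant T g : bilinear_form T -> in_Sp g ->
  symp_trace (fun u v => T (g *m u) (g *m v)) = symp_trace T.
Proof.
move=> Tb gs; rewrite symp_trace_mul //.
have -> : symp_trace T = symp_trace (fun u v => T (1%:M *m u) (1%:M *m v)).
  by apply: eq_bigr => i _; rewrite !mul1mx.
rewrite symp_trace_mul //; apply: eq_bigr => k _; apply: eq_bigr => l _.
by rewrite !symplectic_rows //; apply: symplectic1.
Qed.

Variables (n : nat) (rep : 'M[C]_r.*2 -> 'M[C]_n).
Hypothesis rep_sp : is_poly_rep rep.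
Variables (D : 'M[C]_r.*2 -> 'M[C]_n) (Dd : differential rep D).
Local Notation dq := (dquad D).

(** The product of (a b) and (c d) in Sym^2, contracted in a, c and in b, d: a scalar multiple of
    the usual Casimir element. It is defined entrywise because [symp_trace] takes scalar values. *)
Definition casimir : 'M[C]_n := \matrix_(p, q)
  symp_trace (fun a c => symp_trace (fun b d => (dq a b *m dq c d) p q)).

Lemma dquad_mul_bilinear1 a c p q :
  bilinear_form (fun b d => (dq a b *m dq c d) p q).
Proof.
split=> s u v w; rewrite (dquadDr Dd) (dquadZr Dd).
  by rewrite mulmxDl -scalemxAl mxE [X in X + _]mxE.
by rewrite mulmxDr -scalemxAr mxE [X in X + _]mxE.
Qed.

Lemma dquad_mul_bilinear2 p q :
  bilinear_form (fun a c => symp_trace (fun b d => (dq a b *m dq c d) p q)).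
Proof.
have key1 s (A B X : 'M[C]_n) : ((s *: A + B) *m X) p q = s * (A *m X) p q + (B *m X) p q.
  by rewrite mulmxDl -scalemxAl mxE [X in X + _]mxE.
have key2 s (A B X : 'M[C]_n) : (X *m (s *: A + B)) p q = s * (X *m A) p q + (X *m B) p q.
  by rewrite mulmxDr -scalemxAr mxE [X in X + _]mxE.
have lin s u v w : dq (s *: u + v) w = s *: dq u w + dq v w.
  by rewrite (dquadDl Dd) (dquadZl Dd).
have arith (s a b c d : C) : s * a + b - (s * c + d) = s * (a - c) + (b - d) by ring.
split=> s u v w; rewrite /symp_trace mulr_sumr -big_split; apply: eq_bigr => i _ /=.
  rewrite (lin s u v (x_ i)).
  rewrite (lin s u v (y_ i)).
  rewrite 2!key1.
  exact: arith.
rewrite (lin s u v (x_ i)) (lin s u v (y_ i)) 2!key2.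
exact: arith.
Qed.

Lemma casimirE : casimir = \sum_(i < r) \sum_(j < r)
  (dq (x_ i) (x_ j) *m dq (y_ i) (y_ j) - dq (x_ i) (y_ j) *m dq (y_ i) (x_ j)
   - (dq (y_ i) (x_ j) *m dq (x_ i) (y_ j) - dq (y_ i) (y_ j) *m dq (x_ i) (x_ j))).
Proof.
apply/matrixP=> p q; rewrite mxE summxE; apply: eq_bigr => i _.
rewrite summxE -sumrB; apply: eq_bigr => j _.
move: (_ *m _) (_ *m _) (_ *m _) (_ *m _) => a b c d.
by rewrite !mxE.
Qed.

Lemma casimir_comm g : in_Sp g -> rep g *m casimir = casimir *m rep g.
Proof.
move=> gs.
have [rep1 repM _] := rep_sp.
have gV := rep_inv rep_sp gs.
have Vg : rep (invmx g) *m rep g = 1%:M.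
  by rewrite -repM ?mulVmx ?gs.1 //; apply: symplecticV.
suff e : rep g *m casimir *m rep (invmx g) = casimir.
  by rewrite -[in RHS]e -!mulmxA Vg mulmx1.
have conjM A B : rep g *m (A *m B) *m rep (invmx g)
    = (rep g *m A *m rep (invmx g)) *m (rep g *m B *m rep (invmx g)).
  by rewrite -!mulmxA (mulmxA (rep (invmx g)) (rep g)) Vg mul1mx.
have conjq a b c d : rep g *m (dq a b *m dq c d) *m rep (invmx g)
    = dq (g *m a) (g *m b) *m dq (g *m c) (g *m d).
  by rewrite conjM (rep_dquad rep_sp Dd a b gs) (rep_dquad rep_sp Dd c d gs).
transitivity (\matrix_(p, q) symp_trace (fun a c => symp_trace (fun b d =>
   (dq (g *m a) (g *m b) *m dq (g *m c) (g *m d)) p q))); last first.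
  apply/matrixP=> p q; rewrite !mxE.
  rewrite -[RHS](symp_trace_invariant (dquad_mul_bilinear2 p q) gs).
  rewrite /symp_trace; apply: eq_bigr => i _; congr (_ - _).
    exact: (symp_trace_invariant (dquad_mul_bilinear1 (g *m x_ i) (g *m y_ i) p q) gs).
  exact: (symp_trace_invariant (dquad_mul_bilinear1 (g *m y_ i) (g *m x_ i) p q) gs).
rewrite casimirE mulmx_sumr mulmx_suml; apply/matrixP=> p q; rewrite mxE summxE.
apply: eq_bigr => i _; rewrite mulmx_sumr mulmx_suml summxE /symp_trace -sumrB.
apply: eq_bigr => j _; rewrite -!conjq.
move: (dq (x_ i) _ *m _) (dq (x_ i) _ *m _) (dq (y_ i) _ *m _) (dq (y_ i) _ *m _) => a b c d.
rewrite !mulmxBr !mulmxBl.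
move: (_ *m _) (_ *m _) (_ *m _) (_ *m _) => a' b' c' d'.
by rewrite !mxE.
Qed.

Lemma schur (A : 'M[C]_n) : (0 < n)%N -> rep_irreducible rep ->
  (forall g, in_Sp g -> rep g *m A = A *m rep g) -> exists c, A = c%:M.
Proof.
move=> n0 irr Acomm.
have [c] : exists c, root (char_poly A^T) c.
  apply/closed_rootP; rewrite size_char_poly.
  by case: n n0.
rewrite -eigenvalue_root_char => /eigenvalueP[v vA v0]; exists c.
apply: eq_mulcol => w; rewrite mul_scalar_mx; move: w.
apply: (irr (fun w => A *m w = c *: w)).
- split=> [|a x y Ax Ay]; first by rewrite mulmx0 scaler0.
  by rewrite mulmxDr -scalemxAr Ax Ay scalerDr !scalerA mulrC.
- by move=> g x gs Ax; rewrite mulmxA -Acomm // -mulmxA Ax -scalemxAr.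
- exists v^T; first by rewrite trmx_eq0.
  by rewrite -[A]trmxK -trmx_mul vA linearZ.
Qed.

Lemma casimir_scalar : (0 < n)%N -> rep_irreducible rep -> exists c, casimir = c%:M.
Proof. by move=> n0 irr; apply: schur => //; apply: casimir_comm. Qed.

End Casimir.

Lemma jet_exprz (F : numFieldType) (m : int) : jet (fun t : F => (1 + t) ^ m) 1 m%:~R.
Proof.
have j1 : jet (fun t : F => 1 + t) 1 1.
  by have := jetD (jet_cst 1) (jet_id F); rewrite addr0 add0r.
have jn k : jet (fun t : F => (1 + t) ^+ k) 1 k%:R.
  elim: k => [|k IH]; first exact: jet_ext (jet_cst 1).
  apply: jet_eq (jet_ext _ (jetM j1 IH)) _ _; first by move=> t; rewrite exprS.
    by rewrite mulr1.
  by rewrite !mul1r -natr1 addrC.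
case: m => [k|k]; first exact: jn.
apply: jet_eq (jetV (oner_neq0 _) (jn k.+1)) _ _; first by rewrite invr1.
by rewrite expr1n divr1 NegzE mulrNz.
Qed.

(** Cyclicity gives tr(T A B) = a tr(A T B) = a tr(T B A). Both the sum and the trace of the
    commutator are then multiples of tr(T B A), by a + 1 and a - 1. *)
Lemma mxtrace_pair (F : fieldType) n (T A B : 'M[F]_n) a :
  T *m A = a *: (A *m T) -> a != 1 ->
  \tr (T *m (A *m B)) + \tr (T *m (B *m A))
  = (a + 1) / (a - 1) * \tr (T *m (A *m B - B *m A)).
Proof.
move=> TA a1.
have e : \tr (T *m (A *m B)) = a * \tr (T *m (B *m A)).
  by rewrite mulmxA TA -scalemxAl linearZ /= -mulmxA mxtrace_mulC mulmxA.
rewrite mulmxBr linearB /= e; move: (\tr _) => b.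
by field; rewrite subr_eq0.
Qed.

(** * The differential equation for the character *)

Section TraceIdentity.
Variables (C : numClosedFieldType) (r n : nat).
Local Notation x_ := (@xvec C r).
Local Notation y_ := (@yvec C r).

(* Regularity: torus_elt z has 2r distinct eigenvalues. *)
Definition torus_regular (z : 'I_r -> C) := [/\ torus_pt z,
  forall i j, z i * z j != 1 & forall i j, i != j -> z i != z j].

(* The logarithmic derivative of the Weyl denominator in the i-th coordinate
   direction. *)
Definition dlog_denominator (z : 'I_r -> C) i :=
  (z i + (z i)^-1) / (z i - (z i)^-1)
  + \sum_(j | j != i) (z i - (z i)^-1) / (z i + (z i)^-1 - (z j + (z j)^-1)).

(** The roots e_i + e_j and e_i - e_j together contribute a single fraction in the variables a + 1/a
    and b + 1/b. *)
Lemma dlog_term a b : a != 0 -> b != 0 -> a * b != 1 -> a != b :> C ->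
  (a * b + 1) / (a * b - 1) + (a + b) / (a - b)
  = 2 * ((a - a^-1) / (a + a^-1 - (b + b^-1))).
Proof.
move=> a0 b0 ab1 ab.
have h : a + a^-1 - (b + b^-1) = (a * b - 1) * (a - b) / (a * b) by field; apply/andP.
rewrite h; field; rewrite a0 b0 !subr_eq0 ab1 ab /=.
by [].
Qed.

Variables (rep : 'M[C]_r.*2 -> 'M[C]_n) (mu : 'I_n -> 'rV[int]_r).
Hypothesis dr : diag_rep rep mu.
Variables (D : 'M[C]_r.*2 -> 'M[C]_n) (Dd : differential rep D).
Local Notation dq := (dquad D).
Let rep_sp := diag_rep_sp dr.

Definition weight_mx i : 'M[C]_n := diag_mx (\row_j ((mu j) 0 i)%:~R).

Definition torus_tangent (i : 'I_r) : 'M[C]_r.*2 :=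
  diag_mx (\row_k (if half_coord k == i then (if odd k then -1 else 1) else 0)).

Lemma quad_mx_xy i : quad_mx (x_ i) (y_ i) = - torus_tangent i.
Proof.
apply/matrixP=> a b; rewrite !mxE !big_ord1.
case: (coordP a) => j _; case: (coordP b) => k _;
  rewrite !covecE !mxE !eq_coord ?half_xcoord ?half_ycoord ?andbT /=;
  have [ji|ji] := eqVneq j i; have [ki|ki] := eqVneq k i; try subst j; try subst k;
  rewrite ?eqxx ?(negbTE ji) ?(negbTE ki) ?[i == k]eq_sym ?(negbTE ki);
  rewrite ?mulr0 ?mul0r ?addr0 ?add0r ?mulr0n ?mul0rn ?oppr0 ?mulr1n ?mul1r ?opprK //.
Qed.

Lemma mjet_torus i :
  mjet (fun t => torus_elt (torus_at i (1 + t))) 1%:M (torus_tangent i).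
Proof.
have j1 : jet (fun t : C => 1 + t) 1 1 by apply: jet_ext (jet_exprz C 1).
have jV : jet (fun t : C => (1 + t)^-1) 1 (-1) := jet_exprz C (-1).
move=> a b; rewrite !mxE.
apply: jet_ext (fun t => esym (congr1 (fun A : 'M_ _ => A a b) (torus_mx_diag _))) _.
apply: (jet_ext (phi := fun t => (if odd a then (torus_at i (1 + t) (half_coord a))^-1
   else torus_at i (1 + t) (half_coord a)) *+ (a == b))).
  by move=> t; rewrite !mxE.
case: (a == b); last by rewrite mulr0n; apply: jet_cst.
rewrite mulr1n /torus_at; case: (half_coord a == i) => /=.
  by case: (odd a).
by case: (odd a); rewrite ?invr1; apply: jet_cst.
Qed.

(** Along [z_i = 1 + t] the weight m acts by (1 + t)^m, with derivative m. The sign comes from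
    [quad_mx_xy]. *)
Lemma dquad_xy i : dq (x_ i) (y_ i) = - weight_mx i.
Proof.
rewrite /dquad quad_mx_xy (differentialN Dd); congr (- _).
have s0 : (1 + 'X : {poly C}).[0] != 0 by rewrite !hornerE oner_eq0.
have sE t : (1 + 'X : {poly C}).[t] != 0 -> torus_pt (torus_at i (1 + t)).
  by rewrite !hornerE => t0; apply: torus_at_pt.
have j1 := Dd.2 _ _ _ s0 (fun t h => torus_symplectic (sE t h)) (mjet_torus i).
apply: (mjet_uniq (A' := 1%:M) j1).
apply: (mjet_congr s0 (phi := fun t => diag_mx (\row_j monomial (torus_at i (1 + t)) (mu j)))).
  by move=> t /sE h; rewrite /= (diag_rep_torus dr).
move=> a b; rewrite !mxE.
apply: (jet_ext (phi := fun t => (1 + t) ^ (mu a) 0 i *+ (a == b))).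
  move=> t; rewrite !mxE /monomial (bigD1 i) //= /torus_at eqxx big1 ?mulr1 //.
  by move=> j /negbTE ->; rewrite exp1rz.
case: (a == b); last by rewrite !mulr0n; apply: jet_cst.
rewrite !mulr1n; exact: jet_exprz.
Qed.

(** The bracket of opposite root vectors for e_i + e_j. For i = j all four terms of [comm_dquad]
    survive instead of two, whence the factor 1 + (i == j). *)
Lemma comm_dquad_plus i j :
  dq (x_ i) (x_ j) *m dq (y_ i) (y_ j) - dq (y_ i) (y_ j) *m dq (x_ i) (x_ j)
  = - (1 + (i == j)%:R) *: (weight_mx i + weight_mx j).
Proof.
have := comm_dquad rep_sp Dd (x_ i) (x_ j) (y_ i) (y_ j); rewrite /comm => ->.
rewrite !omxy !eqxx (dquadC _ (y_ i)) (dquadC _ (y_ i) (x_ i)).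
have [<-|ij] := eqVneq i j.
  rewrite ?eqxx !dquad_xy; move: (weight_mx i) => a.
  by apply/matrixP => p q; rewrite !mxE /=; ring.
rewrite !dquad_xy.
move: (weight_mx i) (weight_mx j) (dq _ _) (dq _ _) => a b c d.
by apply/matrixP => p q; rewrite !mxE /=; ring.
Qed.

Lemma comm_dquad_minus i j : i != j ->
  dq (x_ i) (y_ j) *m dq (y_ i) (x_ j) - dq (y_ i) (x_ j) *m dq (x_ i) (y_ j)
  = weight_mx i - weight_mx j.
Proof.
move=> ij.
have := comm_dquad rep_sp Dd (x_ i) (y_ j) (y_ i) (x_ j); rewrite /comm => ->.
rewrite !omxy !eqxx (dquadC _ (y_ j)) (dquadC _ (y_ i) (x_ i)) !dquad_xy.
move: (weight_mx i) (weight_mx j) (dq _ _) (dq _ _) => a b c d.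
by apply/matrixP => p q; rewrite !mxE /=; ring.
Qed.

Variable z : 'I_r -> C.
Hypothesis zreg : torus_regular z.
Let T := rep (torus_elt z).

Definition torus_char : C := \sum_j monomial z (mu j).
Definition torus_char1 i : C := \sum_j monomial z (mu j) * ((mu j) 0 i)%:~R.
Definition torus_char2 i : C := \sum_j monomial z (mu j) * ((mu j) 0 i)%:~R ^+ 2.

Lemma torus_diag : T = diag_mx (\row_j monomial z (mu j)).
Proof. by rewrite /T (diag_rep_torus dr) //; case: zreg. Qed.

Lemma tr_torus : \tr T = torus_char.
Proof. by rewrite torus_diag mxtrace_diag; apply: eq_bigr => j _; rewrite mxE. Qed.

Lemma tr_torus1 i : \tr (T *m weight_mx i) = torus_char1 i.
Proof.
rewrite torus_diag mulmx_diag mxtrace_diag.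
by apply: eq_bigr => j _; rewrite !mxE.
Qed.

Lemma tr_torus2 i : \tr (T *m (weight_mx i *m weight_mx i)) = torus_char2 i.
Proof.
rewrite torus_diag !mulmx_diag mxtrace_diag.
by apply: eq_bigr => j _; rewrite !mxE expr2.
Qed.

Lemma torus_dquad u v a b : torus_elt z *m u = a *: u -> torus_elt z *m v = b *: v ->
  T *m dq u v = (a * b) *: (dq u v *m T).
Proof.
move=> ua vb; rewrite /T (rep_dquad_comm rep_sp Dd); last by apply: torus_symplectic; case: zreg.
by rewrite ua vb (dquadZl Dd) (dquadZr Dd) scalerA scalemxAl.
Qed.

Lemma tr_plus i j :
  \tr (T *m (dq (x_ i) (x_ j) *m dq (y_ i) (y_ j)))
  + \tr (T *m (dq (y_ i) (y_ j) *m dq (x_ i) (x_ j)))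
  = - ((1 + (i == j)%:R) * ((z i * z j + 1) / (z i * z j - 1)) * (torus_char1 i + torus_char1 j)).
Proof.
have [z0 z1 _] := zreg.
rewrite (mxtrace_pair _ (torus_dquad (torus_xy z i).1 (torus_xy z j).1)) //.
rewrite comm_dquad_plus -scalemxAr linearZ /= mulmxDr linearD /= !tr_torus1; ring.
Qed.

Lemma tr_minus i j : i != j ->
  \tr (T *m (dq (x_ i) (y_ j) *m dq (y_ i) (x_ j)))
  + \tr (T *m (dq (y_ i) (x_ j) *m dq (x_ i) (y_ j)))
  = (z i + z j) / (z i - z j) * (torus_char1 i - torus_char1 j).
Proof.
move=> ij; have [z0 _ zn] := zreg.
rewrite (mxtrace_pair _ (torus_dquad (torus_xy z i).1 (torus_xy z j).2)); last first.
  apply: contra_neq (zn _ _ ij) => e.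
  by rewrite -[RHS]mul1r -e mulfVK.
rewrite comm_dquad_minus // mulmxBr linearB /= !tr_torus1; congr (_ * _).
by field; rewrite z0 subr_eq0 zn.
Qed.

(** The products of [dq (x_ i) (y_ i)] with itself give second derivatives of the character. The
    other terms pair opposite root vectors, and [mxtrace_pair] turns them into first derivatives.
    This [casimir] carries a factor -2 relative to the sum of squares of weights, hence -c/2. *)
Lemma casimir_trace c : casimir D = c%:M ->
  - c / 2 * torus_char
  = \sum_i torus_char2 i + 2 * \sum_i torus_char1 i * dlog_denominator z i.
Proof.
move=> casc; have [z0 z1 zn] := zreg.
have n2 : (2 : C) != 0 by rewrite pnatr_eq0.
(* [s] and [d] are (a + 1)/(a - 1) at the values a of the roots e_i + e_j and e_i - e_j. *)
pose s i j := (z i * z j + 1) / (z i * z j - 1).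
pose d i j := (z i + z j) / (z i - z j).
pose th i := torus_char1 i.
have trc : c * torus_char = \sum_i (- (4 * s i i * th i + 2 * torus_char2 i)
    - \sum_(j | j != i) (s i j * (th i + th j) + d i j * (th i - th j))).
  have -> : c * torus_char = \tr (T *m casimir D).
    by rewrite casc mul_mx_scalar linearZ /= tr_torus.
  rewrite casimirE mulmx_sumr linear_sum; apply: eq_bigr => i _.
  rewrite mulmx_sumr linear_sum /= (bigD1 i) //= -sumrN; congr (_ + _).
    rewrite !mulmxBr !linearB /=.
    have := tr_plus i i; rewrite eqxx.
    move: (\tr (T *m (dq (x_ i) (x_ i) *m _))) (\tr (T *m (dq (y_ i) (y_ i) *m _))) => a b ab.
    rewrite (dquadC _ (y_ i) (x_ i)) dquad_xy mulmxN !mulNmx opprK tr_torus2.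
    move: ab; rewrite -/(th i) -/(s i i) => ab.
    have -> : a - torus_char2 i - (torus_char2 i - b) = (a + b) - 2 * torus_char2 i by ring.
    by rewrite ab /=; ring.
  apply: eq_bigr => j ji; rewrite !mulmxBr !linearB /=.
  have := tr_plus i j; have := tr_minus (i := i) (j := j).
  rewrite [i == j]eq_sym ji => /(_ isT).
  move: (\tr (T *m (dq (x_ i) (x_ j) *m _))) (\tr (T *m (dq (x_ i) (y_ j) *m _)))
    (\tr (T *m (dq (y_ i) (x_ j) *m _))) (\tr (T *m (dq (y_ i) (y_ j) *m _))) => a1 a2 a3 a4 e1 e2.
  have -> : a1 - a2 - (a3 - a4) = (a1 + a4) - (a2 + a3) by ring.
  by rewrite e1 e2 (negbTE ji) -/(th i) -/(th j) -/(s i j) -/(d i j) /=; ring.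
(* [s] is symmetric and [d] antisymmetric, so exchanging i and j turns the terms in [th j] into
   terms in [th i]. *)
have sym : \sum_i \sum_(j | j != i) (s i j * (th i + th j) + d i j * (th i - th j))
    = 2 * \sum_i \sum_(j | j != i) (s i j + d i j) * th i.
  have e : \sum_i \sum_(j | j != i) (s i j - d i j) * th j
      = \sum_i \sum_(j | j != i) (s i j + d i j) * th i.
    rewrite (exchange_big_dep predT) //=; apply: eq_bigr => i _.
    under eq_bigl do rewrite eq_sym.
    apply: eq_bigr => j ji; congr (_ * _).
    rewrite /s /d [z j * z i]mulrC [z j + z i]addrC -[z j - z i]opprB invrN mulrN opprK.
    by [].
  rewrite mulr_natl mulr2n -{1}e -big_split; apply: eq_bigr => i _ /=.
  by rewrite -big_split; apply: eq_bigr => j _ /=; ring.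
rewrite mulrAC mulNr trc sumrB sumrN sym.
have dl i : th i * dlog_denominator z i = s i i * th i + 2^-1 * \sum_(j | j != i) (s i j +
  d i j) * th i.
  rewrite /dlog_denominator mulrDr; congr (_ + _).
    rewrite mulrC /s; congr (_ * _).
    have -> : z i - (z i)^-1 = (z i * z i - 1) / z i by field.
    by field; rewrite z0 subr_eq0 z1.
  rewrite mulr_sumr mulr_sumr; apply: eq_bigr => j ji.
  rewrite /s /d dlog_term //; last by apply: zn; rewrite eq_sym.
  by rewrite -mulrA mulKf // mulrC.
under [X in _ = _ + 2 * X]eq_bigr do rewrite dl.
rewrite big_split /= -mulr_sumr big_split /= -!mulr_sumr.
under eq_bigr do rewrite -mulrA.
rewrite -mulr_sumr.
by field.
Qed.

End TraceIdentity.

(** * The Weyl denominator *)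

Section WeylSum.
Variable r : nat.

Lemma weyl_signE (w : weyl_group r) : weyl_sign w = (-1) ^+ w.1 * \prod_i (-1) ^+ (w.2 i).
Proof.
rewrite /weyl_sign; set A := lin1_mx _.
have -> : A = perm_mx w.1 *m diag_mx (\row_i (-1) ^+ (w.2 i)).
  apply/matrixP=> i j; rewrite mul_mx_diag !mxE eqxx /=.
  by rewrite mulrC (can2_eq (permKV _) (permK _)) eq_sym.
rewrite det_mulmx det_perm det_diag; congr (_ * _).
by apply: eq_bigr => i _; rewrite mxE.
Qed.

(** For a fixed permutation the sum over signs factors over the coordinates; what remains is the
    Leibniz formula. G is general so as to cover both powers of torus coordinates and entries of
    powers of g. *)
Lemma weyl_sum_det (K : comNzRingType) (G : 'I_r -> int -> K) (l : 'rV[int]_r) :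
  \sum_(w : weyl_group r) (weyl_sign w)%:~R * \prod_i G i (weyl_act w l 0 i)
  = \det (\matrix_(i, j) (G i (l 0 j) - G i (- l 0 j))).
Proof.
transitivity (\sum_(p : 'S_r) \sum_(e : {ffun 'I_r -> bool}) (-1) ^+ p *
    \prod_i ((-1) ^+ e i * G i ((-1) ^+ e i * l 0 ((p^-1)%g i)))).
  rewrite pair_bigA; apply: eq_bigr => -[p e] _.
  rewrite weyl_signE /= rmorphM rmorphXn rmorphN1 rmorph_prod -mulrA -big_split /=.
  congr (_ * _); apply: eq_bigr => i _; rewrite rmorphXn rmorphN1 mxE /=.
  by [].
rewrite (reindex_inj invg_inj); apply: eq_bigr => p _ /=.
rewrite -mulr_sumr odd_permV -(bigA_distr_bigA (fun i (b : bool) =>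
  (-1) ^+ b * G i ((-1) ^+ b * l 0 ((p^-1)^-1%g i)))).
congr (_ * _); apply: eq_bigr => i _; rewrite big_bool invgK mxE.
by rewrite expr1 expr0 !mul1r !mulN1r addrC.
Qed.

End WeylSum.

Section Denominator.
Variables (C : numFieldType).

(** [cheby k] is the Chebyshev polynomial of the second kind U_(k-1) at X/2, computed together with
    its successor. *)
Fixpoint cheby_pair (k : nat) : {poly C} * {poly C} :=
  if k is k'.+1 then let: (p, q) := cheby_pair k' in (q, 'X * q - p) else (0, 1).
Definition cheby k := (cheby_pair k).1.

Lemma chebySS k : cheby k.+2 = 'X * cheby k.+1 - cheby k.
Proof. by rewrite /cheby /=; case: (cheby_pair k). Qed.

Lemma size_cheby k : (size (cheby k) <= k)%N.
Proof.
suff : (size (cheby k) <= k)%N /\ (size (cheby k.+1) <= k.+1)%N by case.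
elim: k => [|k [IH1 IH2]]; first by rewrite /cheby /= size_poly0 size_poly1.
split=> //; rewrite chebySS (leq_trans (size_polyD _ _)) // geq_max size_polyN.
by rewrite (leq_trans (size_polyMleq _ _)) ?size_polyX ?(leq_trans IH1) // ltnW.
Qed.

Lemma chebyP (z : C) k : z != 0 ->
  z ^+ k - z ^- k = (z - z^-1) * (cheby k).[z + z^-1].
Proof.
move=> z0.
suff : z ^+ k - z ^- k = (z - z^-1) * (cheby k).[z + z^-1] /\
  z ^+ k.+1 - z ^- k.+1 = (z - z^-1) * (cheby k.+1).[z + z^-1] by case.
elim: k => [|k [IH1 IH2]].
  by rewrite /cheby /= horner0 hornerC expr0 invr1 subrr mulr0 mulr1 !expr1.
split=> //; rewrite chebySS !(hornerD, hornerM, hornerX, hornerN) mulrBr mulrCA -IH1 -IH2.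
by rewrite !exprS; field; rewrite expf_neq0.
Qed.

Variable r : nat.
Implicit Types (z : 'I_r -> C).

Definition denominator z : C :=
  \det (\matrix_(i < r, j < r) (z i ^ weyl_vector r 0 j - z i ^ (- weyl_vector r 0 j))).

(** Once z_i - 1/z_i is taken out of each row, the entries are polynomials of degree below r in z_i
    + 1/z_i, so a Vandermonde matrix splits off the coefficient matrix [U]. The constant [eps] = det
    U stays implicit because only the logarithmic derivative matters. *)
Lemma denominator_prod : exists eps : C, forall z, (forall i, z i != 0) ->
  denominator z = eps * ((\prod_i (z i - (z i)^-1)) *
    \prod_(i < r) \prod_(j < r | (i < j)%N) ((z j + (z j)^-1) - (z i + (z i)^-1))).
Proof.
pose U := \matrix_(m < r, j < r) (cheby (r - j))`_m.
exists (\det U) => z z0.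
have -> : denominator z = \det (diag_mx (\row_i (z i - (z i)^-1)) *m
    (Vandermonde r (\row_i (z i + (z i)^-1)))^T *m U).
  congr (\det _); apply/matrixP=> i j; rewrite -mulmxA mul_diag_mx !mxE.
  have -> : (r%:Z - j%:Z) = (r - j)%N%:Z by rewrite subzn // ltnW.
  rewrite -exprnN -exprnP chebyP //; congr (_ * _).
  rewrite (@horner_coef_wide _ r) ?(leq_trans (size_cheby _)) ?leq_subr //.
  by apply: eq_bigr => m _; rewrite !mxE mulrC.
rewrite !det_mulmx det_diag det_tr det_Vandermonde mulrC; congr (_ * (_ * _)).
  by apply: eq_bigr => i _; rewrite mxE.
by apply: eq_bigr => i _; apply: eq_bigr => j _; rewrite !mxE.
Qed.

(** Derivatives are written as a i * l i so that the logarithmic derivatives l i simply add up. *)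
Lemma jet_prod_log (F : numFieldType) (I : Type) (s : seq I) (P : pred I)
    (phi : I -> F -> F) (a l : I -> F) :
  (forall i, P i -> jet (phi i) (a i) (a i * l i)) ->
  jet (fun t => \prod_(i <- s | P i) phi i t) (\prod_(i <- s | P i) a i)
      (\prod_(i <- s | P i) a i * \sum_(i <- s | P i) l i).
Proof.
move=> h; elim: s => [|i s IH].
  by rewrite !big_nil mulr0; apply: jet_ext (jet_cst 1) => t; rewrite big_nil.
rewrite !big_cons; case Pi: (P i); last by apply: jet_ext IH => t; rewrite big_cons Pi.
apply: jet_ext (jet_eq (jetM (h i Pi) IH) (erefl _) _).
  by move=> t; rewrite big_cons Pi.
by ring.
Qed.

End Denominator.

Section DenominatorDerivative.
Variables (C : numClosedFieldType) (r : nat).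
Variables (z : 'I_r -> C) (k : 'I_r).
Hypothesis zreg : torus_regular z.

Let zt t : 'I_r -> C := fun i => if i == k then z i * (1 + t) else z i.

(** The denominator is differentiated twice along z_k (1 + t): termwise as an alternating sum of
    monomials, and logarithmically as a product. [jet_uniq] equates the results. *)
Lemma denominator_dlog : \sum_(w : weyl_group r) (weyl_sign w)%:~R *
    (monomial z (weyl_act w (weyl_vector r)) * (weyl_act w (weyl_vector r) 0 k)%:~R)
  = denominator z * dlog_denominator z k.
Proof.
have [z0 z1 zn] := zreg.
have j1 : jet (fun t => denominator (zt t)) (denominator z)
    (\sum_(w : weyl_group r) (weyl_sign w)%:~R *
    (monomial z (weyl_act w (weyl_vector r)) * (weyl_act w (weyl_vector r) 0 k)%:~R)).
  have dE z' : denominator z' = \sum_(w : weyl_group r) (weyl_sign w)%:~R *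
      monomial z' (weyl_act w (weyl_vector r)).
    by rewrite (weyl_sum_det (fun i m => z' i ^ m)).
  rewrite dE; apply: (jet_ext (phi := fun t => \sum_(w : weyl_group r) (weyl_sign w)%:~R *
      monomial (zt t) (weyl_act w (weyl_vector r)))) => [t|]; first by rewrite dE.
  apply: jet_sum => w; apply: jetZ; set m := weyl_act _ _.
  have := jetZ (monomial z m) (jet_exprz C (m 0 k)); rewrite mulr1.
  apply: jet_ext => t; rewrite /monomial (bigD1 k) //= [RHS](bigD1 k) //= /zt eqxx.
  rewrite expfzMl mulrAC; congr (_ * _).
  by apply: eq_bigr => i /negbTE ->.
have [eps epsP] := denominator_prod C r.
have jz i : jet (zt^~ i) (z i) ((i == k)%:R * z i).
  rewrite /zt; case: eqP => _; last by rewrite mul0r; apply: jet_cst.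
  apply: jet_eq (jet_ext _ (jetZ (z i) (jet_exprz C 1))) _ _ => //; rewrite ?mulr1 //.
  by rewrite mul1r.
have jV i : jet (fun t => (zt t i)^-1) (z i)^-1 (- ((i == k)%:R * (z i)^-1)).
  by apply: jet_eq (jetV (z0 i) (jz i)) _ _ => //; field.
have jf i : jet (fun t => zt t i - (zt t i)^-1) (z i - (z i)^-1)
    ((i == k)%:R * (z i + (z i)^-1)).
  by apply: jet_eq (jetD (jz i) (jetN (jV i))) _ _ => //; ring.
have jw i : jet (fun t => zt t i + (zt t i)^-1) (z i + (z i)^-1)
    ((i == k)%:R * (z i - (z i)^-1)).
  by apply: jet_eq (jetD (jz i) (jV i)) _ _ => //; ring.
pose f i := z i - (z i)^-1; pose w i := z i + (z i)^-1.
have f0 i : f i != 0.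
  have -> : f i = (z i * z i - 1) / z i by rewrite /f; field.
  by rewrite mulf_neq0 ?invr_eq0 ?subr_eq0.
have w0 i j : j != i -> w j - w i != 0.
  move=> ij; have -> : w j - w i = (z j * z i - 1) * (z j - z i) / (z j * z i).
    by rewrite /w; field; rewrite !z0.
  by rewrite !mulf_neq0 ?invr_eq0 ?mulf_neq0 ?subr_eq0 ?zn.
have jF : jet (fun t => \prod_i (zt t i - (zt t i)^-1)) (\prod_i f i)
    (\prod_i f i * \sum_i (i == k)%:R * w i / f i).
  apply: jet_prod_log => i _; apply: jet_eq (jf i) (erefl _) _.
  by rewrite -/(w i); have := f0 i; move: (f i) => a a0; field.
have jW : jet (fun t => \prod_(i < r) \prod_(j < r | (i < j)%N)
      ((zt t j + (zt t j)^-1) - (zt t i + (zt t i)^-1)))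
    (\prod_(i < r) \prod_(j < r | (i < j)%N) (w j - w i))
    (\prod_(i < r) \prod_(j < r | (i < j)%N) (w j - w i) *
     \sum_(i < r) \sum_(j < r | (i < j)%N) ((j == k)%:R * f j - (i == k)%:R * f i) / (w j - w i)).
  apply: jet_prod_log => i _; apply: jet_prod_log => j ij.
  apply: jet_eq (jetD (jw j) (jetN (jw i))) (erefl _) _.
  rewrite -/(w i) -/(w j) -/(f i) -/(f j).
  have := w0 i j; rewrite neq_ltn ij orbT => /(_ isT).
  by move: (w j - w i) => a a0; field.
have s0 : (1 + 'X : {poly C}).[0] != 0 by rewrite !hornerE oner_eq0.
have sE t : (1 + 'X : {poly C}).[t] != 0 -> forall i, zt t i != 0.
  rewrite !hornerE => t0 i; rewrite /zt; case: (i == k); last exact: z0.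
  by rewrite mulf_neq0 ?z0.
have {}j1 := jet_congr s0 (fun t h => epsP _ (sE t h)) j1.
have [_ ->] := jet_uniq j1 (jetZ eps (jetM jF jW)).
rewrite epsP // -/f -/w.
set F := \prod_i f i; set W := \prod_(i < r) _.
rewrite -!mulrA; congr (_ * _).
have -> : \sum_i (i == k)%:R * w i / f i = w k / f k.
  rewrite (bigD1 k) //= eqxx mul1r big1 ?addr0 // => i /negbTE ->.
  by rewrite !mul0r.
have -> : \sum_(i < r) \sum_(j < r | (i < j)%N) ((j == k)%:R * f j - (i == k)%:R * f i) /
  (w j - w i)
    = \sum_(j | j != k) f k / (w k - w j).
  transitivity (\sum_(i < r | (i < k)%N) f k / (w k - w i)
      + \sum_(j < r | (k < j)%N) f k / (w k - w j)); last first.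
    rewrite [RHS](bigID (fun j : 'I_r => (j < k)%N)) /=; congr (_ + _).
      by apply: eq_bigl => j; rewrite -val_eqE neq_ltn; case: ltngtP.
    by apply: eq_bigl => j; rewrite -val_eqE neq_ltn; case: ltngtP.
  rewrite (eq_bigr (fun i : 'I_r => \sum_(j < r | (i < j)%N) (j == k)%:R * f j / (w j - w i)
      + \sum_(j < r | (i < j)%N) (i == k)%:R * f i / (w i - w j))); last first.
    move=> i _; rewrite -big_split; apply: eq_bigr => j ij /=.
    by rewrite -[w i - w j]opprB invrN mulrN mulrBl.
  rewrite big_split /=; congr (_ + _).
    rewrite [RHS]big_mkcond /=; apply: eq_bigr => i _; case: ifP => ik.
      rewrite (bigD1 k) //= eqxx mul1r big1 ?addr0 // => j /andP[_ /negbTE ->].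
      by rewrite !mul0r.
    rewrite big1 // => j ij; case: eqP => [jk|_]; last by rewrite !mul0r.
    by rewrite jk ik in ij.
  rewrite (bigD1 k) //= [X in _ + X]big1 ?addr0 => [|i /negbTE ik].
    by apply: eq_bigr => j _; rewrite eqxx mul1r.
  by rewrite big1 // => j _; rewrite ik !mul0r.
rewrite /dlog_denominator -/(w k) -/(f k); ring.
Qed.

End DenominatorDerivative.

(** * Linear independence of Laurent monomials on regular points *)

Section Independence.

(** The lowest digit is divisible by b and smaller than b in absolute value, hence zero; then divide
    by b. *)
Lemma digits_inj (b : nat) (d : nat -> int) k : (forall i, `|d i| < b%:Z) ->
  \sum_(i < k) d i * b%:Z ^+ i = 0 -> forall i, (i < k)%N -> d i = 0.
Proof.
elim: k d => // k IH d db; rewrite big_ord_recl expr0 mulr1.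
have -> : \sum_(i < k) d (lift ord0 i) * b%:Z ^+ (lift ord0 i)
    = b%:Z * \sum_(i < k) d i.+1 * b%:Z ^+ i.
  by rewrite mulr_sumr; apply: eq_bigr => i _; rewrite /bump /= exprS; ring.
set S := \sum_(i < k) _ => e.
have S0 : S = 0.
  apply/eqP/negPn/negP => Sn0; have := db 0; have : d 0%N = - (b%:Z * S).
    by apply/eqP; rewrite -addr_eq0 e.
  by move: (d 0%N) S Sn0 {e} => *; nia.
have d0 : d 0%N = 0 by move: e; rewrite S0 mulr0 addr0.
by case=> // i; rewrite ltnS; apply: (IH (fun i => d i.+1)).
Qed.

Lemma PoszX (b k : nat) : (b ^ k)%N%:Z = b%:Z ^+ k.
Proof. by elim: k => [|k IH]; rewrite ?expr0 // expnS PoszM IH exprS. Qed.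

Variables (C : numClosedFieldType) (r : nat).

Lemma monomialD (z : 'I_r -> C) a b : torus_pt z ->
  monomial z (a + b) = monomial z a * monomial z b.
Proof.
move=> z0; rewrite /monomial -big_split; apply: eq_bigr => i _ /=.
by rewrite mxE expfzDr.
Qed.

(** Kronecker substitution: at z_k = x^(b^k) an exponent vector becomes the integer with base-b
    digits given by its coordinates, so different vectors give different powers of the one variable
    x. Coefficients are summed over fibers because [nu] may repeat values. *)
Lemma monomial_indep (I : finType) (a : I -> C) (nu : I -> 'rV[int]_r) :
  (forall z, torus_regular z -> \sum_i a i * monomial z (nu i) = 0) ->
  forall nu0, \sum_(i | nu i == nu0) a i = 0.
Proof.
move=> h nu0.
(* M bounds every digit of a difference [nu i - nu0], and b exceeds M. *)
pose M : nat := (\sum_i \sum_k `|nu i 0%R k| + \sum_k `|nu0 0%R k|)%N.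
pose b := (M.*2 + 2)%N.
have Mi i k : (`|nu i 0%R k| + `|nu0 0%R k| <= M)%N.
  apply: leq_add; last by rewrite (bigD1 k) //= leq_addr.
  by rewrite (bigD1 i) //= (bigD1 k) //= -addnA leq_addr.
pose enc (m : 'rV[int]_r) : int := \sum_(k < r) m 0 k * b%:Z ^+ k.
have enc_inj i : enc (nu i) = enc nu0 -> nu i = nu0.
  move=> e; apply/rowP => k.
  pose d (j : nat) : int := if insub j is Some k then nu i 0 k - nu0 0 k else 0.
  suff : d k = 0 by rewrite /d valK => /eqP; rewrite subr_eq0 => /eqP.
  apply: (@digits_inj b d r) => //.
    rewrite /d => j; case: insubP => [k' _ _|_]; last by rewrite normr0 /b; lia.
    by have := Mi i k'; rewrite /b; lia.
  under eq_bigr do rewrite /d valK mulrBl.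
  by rewrite sumrB -/(enc _) -/(enc nu0) e subrr.
(* A shift that makes all exponents nonnegative, so that [p] is a polynomial. *)
pose K : nat := (\sum_i `|enc (nu i)| + `|enc nu0|)%N.
have Ki i : 0 <= enc (nu i) + K%:Z by rewrite /K (bigD1 i) //=; lia.
have K0 : 0 <= enc nu0 + K%:Z by rewrite /K; lia.
pose p : {poly C} := \sum_i a i *: 'X^(absz (enc (nu i) + K%:Z)).
have b2 : (1 < b)%N by rewrite /b; lia.
have p0 : p = 0.
  apply/eqP/negPn/negP => /max_poly_roots mp.
  (* The values x = 2, 3, ... make z regular, since the powers of such x are pairwise distinct; they
     outnumber the possible roots of [p]. *)
  pose s : seq C := [seq i.+2%:R | i <- iota 0 (size p)].
  have := mp s; rewrite size_map size_iota ltnn => /(_ _ _)/negP; apply=> //; last first.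
    by rewrite map_inj_uniq ?iota_uniq // => i j /eqP; rewrite eqr_nat => /eqP [].
  apply/allP => _ /mapP[t _ ->]; rewrite rootE.
  pose x : C := t.+2%:R.
  have x0 : x != 0 by rewrite pnatr_eq0.
  pose z (k : 'I_r) : C := x ^+ (b ^ k).
  have x_inj m m' : x ^+ m = x ^+ m' -> m = m'.
    by apply: ieexprIn; rewrite ?ltr0n // gt_eqF // ltr1n.
  have zreg : torus_regular z.
    split=> [k|k l|k l kl]; first by rewrite expf_neq0.
      rewrite /z -exprD -[1](expr0 x); apply/eqP => /x_inj /eqP.
      by rewrite addn_eq0 expn_eq0; lia.
    by apply: contra_neq kl => /x_inj /eqP; rewrite eqn_exp2l // => /eqP /val_inj.
  have zE m : monomial z m = x ^ (enc m).
    rewrite /monomial /enc; elim/big_rec2: _ => [|k y1 y2 _ ->]; first by rewrite expr0z.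
    rewrite expfzDr //; congr (_ * _).
    by rewrite /z exprnP exprz_exp mulrC; congr (_ ^ (_ * _)); rewrite PoszX.
  have /(congr1 (fun y => y * x ^+ K)) := h z zreg.
  rewrite mul0r mulr_suml => e; rewrite -[X in _ == X]e /p horner_sum; apply/eqP.
  apply: eq_bigr => i _; rewrite hornerZ hornerXn zE -mulrA; congr (_ * _).
  by rewrite (exprnP x K) -expfzDr // exprnP; congr (_ ^ _); have := Ki i; lia.
have := congr1 (fun q : {poly C} => q`_(absz (enc nu0 + K%:Z))) p0.
rewrite coef0 /p coef_sum => e; rewrite -[RHS]e [LHS]big_mkcond /=.
apply: eq_bigr => i _; rewrite coefZ coefXn.
case: eqP => [->|ne]; first by rewrite eqxx mulr1.
case: eqP => [e'|_]; last by rewrite mulr0.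
case: ne; apply: enc_inj; have := Ki i; lia.
Qed.

End Independence.

(** * The product of character and denominator as an eigenfunction *)

Section Laplace.
Variables (C : numClosedFieldType) (r n : nat).
Local Notation rho := (weyl_vector r).

Lemma denominatorE (z : 'I_r -> C) : denominator z =
  \sum_(w : weyl_group r) (weyl_sign w)%:~R * monomial z (weyl_act w rho).
Proof. by rewrite (weyl_sum_det (fun i m => z i ^ m)). Qed.

Definition sqnorm (m : 'rV[int]_r) : int := \sum_i m 0 i ^+ 2.

Lemma sqnorm_act w m : sqnorm (weyl_act w m) = sqnorm m.
Proof.
rewrite /sqnorm [RHS](reindex_inj (@perm_inj _ w.1^-1%g)) /=; apply: eq_bigr => i _.
by rewrite mxE exprMn sqrr_sign mul1r.
Qed.

Variables (rep : 'M[C]_r.*2 -> 'M[C]_n) (mu : 'I_n -> 'rV[int]_r).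
Hypothesis dr : diag_rep rep mu.

Definition char_exponent (p : 'I_n * weyl_group r) := mu p.1 + weyl_act p.2 rho.

Lemma char_denominator (z : 'I_r -> C) : torus_pt z ->
  \sum_p (weyl_sign p.2)%:~R * monomial z (char_exponent p) = torus_char mu z * denominator z.
Proof.
move=> z0; rewrite /torus_char denominatorE big_distrlr pair_bigA.
by apply: eq_bigr => -[j w] _ /=; rewrite monomialD //=; ring.
Qed.

(** [casimir_trace] times the denominator. In |mu + w rho|^2 the cross term 2 <mu, w rho> produces
    the first-order part of that equation, through [denominator_dlog]. *)
Lemma laplace : exists c : C, forall z : 'I_r -> C, torus_regular z ->
  \sum_p ((weyl_sign p.2)%:~R * ((sqnorm (char_exponent p))%:~R - c)) * monomial z
    (char_exponent p) = 0.
Proof.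
have [D Dd] := differential_exists (diag_rep_sp dr).
have [c0 c0P] := casimir_scalar (diag_rep_sp dr) Dd (diag_rep_gt0 dr) (diag_rep_irr dr).
(* The eigenvalue of [casimir_trace], shifted by |w rho|^2 = |rho|^2. *)
exists (- c0 / 2 + (sqnorm rho)%:~R) => z zreg; have [z0 _ _] := zreg.
have ct := casimir_trace dr Dd zreg c0P.
have dd k := denominator_dlog k zreg.
pose a j := monomial z (mu j).
pose b w := (weyl_sign w)%:~R * monomial z (weyl_act w rho) : C.
transitivity (denominator z * (\sum_i torus_char2 mu z i + 2 * \sum_i torus_char1 mu z i *
  dlog_denominator z i
    - (- c0 / 2 * torus_char mu z))); last by rewrite ct subrr mulr0.
transitivity (\sum_j \sum_w a j * b w *
   (\sum_i (mu j 0 i)%:~R ^+ 2 + 2 * (\sum_i (mu j 0 i)%:~R * (weyl_act w rho 0 i)%:~R) -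
     (- c0 / 2))).
  rewrite pair_bigA; apply: eq_bigr => -[j w] _ /=.
  rewrite /char_exponent monomialD //= -/(a j).
  have -> : (sqnorm (mu j + weyl_act w rho))%:~R = \sum_i (mu j 0 i)%:~R ^+ 2
     + 2 * (\sum_i (mu j 0 i)%:~R * (weyl_act w rho 0 i)%:~R) + (sqnorm rho)%:~R :> C.
    rewrite -(sqnorm_act w rho) /sqnorm !rmorph_sum mulr_sumr -!big_split.
    by apply: eq_bigr => i _ /=; rewrite mxE rmorphXn rmorphD /= rmorphXn /=; ring.
  by rewrite /b; ring.
pose A j : C := \sum_i (mu j 0 i)%:~R ^+ 2.
pose B j : C := \sum_i (mu j 0 i)%:~R * dlog_denominator z i.
have bs : \sum_w b w = denominator z by rewrite denominatorE.
have bd i : \sum_w b w * (weyl_act w rho 0 i)%:~R = denominator z * dlog_denominator z i.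
  by rewrite -dd; apply: eq_bigr => w _; rewrite /b mulrA.
have eA : \sum_i torus_char2 mu z i = \sum_j a j * A j.
  by rewrite exchange_big; apply: eq_bigr => j _; rewrite mulr_sumr.
have eB : \sum_i torus_char1 mu z i * dlog_denominator z i = \sum_j a j * B j.
  rewrite (eq_bigr (fun i => \sum_j a j * ((mu j 0 i)%:~R * dlog_denominator z i))).
    by rewrite exchange_big; apply: eq_bigr => j _; rewrite mulr_sumr.
  by move=> i _; rewrite mulr_suml; apply: eq_bigr => j _; rewrite /a mulrA.
have eB' j : \sum_w b w * (\sum_i (mu j 0 i)%:~R * (weyl_act w rho 0 i)%:~R)
    = denominator z * B j.
  rewrite (eq_bigr (fun w => \sum_i (mu j 0 i)%:~R * (b w * (weyl_act w rho 0 i)%:~R))).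
    rewrite exchange_big mulr_sumr; apply: eq_bigr => i _ /=.
    by rewrite -mulr_sumr bd mulrCA.
  by move=> w _; rewrite mulr_sumr; apply: eq_bigr => i _; rewrite mulrCA.
transitivity (\sum_j denominator z * (a j * A j + 2 * (a j * B j) - (- c0 / 2) * a j)).
  apply: eq_bigr => j _; rewrite -/(A j).
  transitivity (\sum_w (a j * (A j - (- c0 / 2)) * b w
     + a j * 2 * (b w * (\sum_i (mu j 0 i)%:~R * (weyl_act w rho 0 i)%:~R)))).
    by apply: eq_bigr => w _; ring.
  by rewrite big_split /= -!mulr_sumr bs eB'; ring.
rewrite -mulr_sumr sumrB big_split /= -!mulr_sumr eA eB.
by [].
Qed.

End Laplace.

Lemma abel_sum (d N : nat -> int) n :
  \sum_(i < n) d i * N i = \sum_(i < n) (\sum_(j < i.+1) d j) * (N i - N i.+1)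
    + (\sum_(j < n) d j) * N n.
Proof.
elim: n => [|n IH]; first by rewrite !big_ord0 mul0r addr0.
by rewrite !big_ord_recr /= IH; ring.
Qed.

(** * The dominance order and the Weyl group action *)

Section Dominance.
Variable r : nat.
Implicit Types (l m nu : 'rV[int]_r) (w : weyl_group r).

(** Extending by 0 beyond position r lets Abel summation use the difference following the last
    coordinate. *)
Definition ext l (i : nat) : int := if insub i is Some k then l 0 k else 0.

Lemma ext_ord l (i : 'I_r) : ext l i = l 0 i.
Proof. by rewrite /ext valK. Qed.

Lemma ext_ge l i : (r <= i)%N -> ext l i = 0.
Proof. by rewrite /ext; case: insubP => // k /=; rewrite ltnNge => /negbTE ->. Qed.

Lemma extD l m i : ext (l + m) i = ext l i + ext m i.
Proof. by rewrite /ext; case: insubP => [k _ _|_]; rewrite ?mxE ?addr0. Qed.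

Lemma extB l m i : ext (l - m) i = ext l i - ext m i.
Proof. by rewrite /ext; case: insubP => [k _ _|_]; rewrite ?mxE ?subr0. Qed.

Definition psum k l : int := \sum_(i < k) ext l i.

Lemma psumD k l m : psum k (l + m) = psum k l + psum k m.
Proof. by rewrite /psum -big_split; apply: eq_bigr => i _; rewrite extD. Qed.

Lemma psumB k l m : psum k (l - m) = psum k l - psum k m.
Proof. by rewrite /psum -sumrB; apply: eq_bigr => i _; rewrite extB. Qed.

Lemma psum0 k : psum k 0 = 0.
Proof. by rewrite -[0 in LHS](subrr (0 : 'rV[int]_r)) psumB subrr. Qed.

Lemma psum_ord k l : (k <= r)%N -> psum k l = \sum_(i < r | (i < k)%N) l 0 i.
Proof.
move=> kr; rewrite /psum (big_ord_widen _ (ext l) kr).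
by apply: eq_bigr => i _; rewrite ext_ord.
Qed.

Lemma psum_inj l m : (forall k, (k <= r)%N -> psum k l = psum k m) -> l = m.
Proof.
move=> e; apply/rowP => i; rewrite -!ext_ord.
have := e i.+1 (ltn_ord i); have := e i (ltnW (ltn_ord i)).
by rewrite /psum !big_ord_recr /= => -> /addrI.
Qed.

(** Comparison of pairings with the fundamental weights e_1 + ... + e_k. It follows from [weight_le]
    and, unlike a list of roots, adds up and compares directly. *)
Definition pdom m l := forall k, (k <= r)%N -> psum k m <= psum k l.

Lemma pdomD m l m' l' : pdom m l -> pdom m' l' -> pdom (m + m') (l + l').
Proof. by move=> h h' k kr; rewrite !psumD lerD ?h ?h'. Qed.

Lemma pdomD_eq m l m' l' : pdom m l -> pdom m' l' -> m + m' = l + l' ->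
  m = l /\ m' = l'.
Proof.
move=> h h' e.
have ml : m = l.
  apply: psum_inj => k kr; have := congr1 (psum k) e; rewrite !psumD.
  by have := h k kr; have := h' k kr; lia.
by split=> //; move: e; rewrite ml => /addrI.
Qed.

Lemma psum_std k (i : 'I_r) : (k <= r)%N -> psum k (std_weight i) = (i < k)%N%:R.
Proof.
move=> kr; rewrite psum_ord // big_mkcond (bigD1 i) //= big1 ?addr0.
  by rewrite mxE !eqxx; case: ifP.
by move=> j /negbTE ji; rewrite mxE ji andbF if_same.
Qed.

Lemma pos_root_psum a k : pos_root a -> (k <= r)%N -> 0 <= psum k a.
Proof.
move=> + kr; case/orP=> [/existsP[i /existsP[j /andP[ij /orP[]]]]|/existsP[j]] /eqP ->.
- by rewrite psumB !psum_std // subr_ge0 ler_nat; have := ij; do 2 case: ltnP => ? //; lia.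
- by rewrite psumD !psum_std // addr_ge0 ?ler0n.
- by rewrite mulr2n psumD !psum_std // addr_ge0 ?ler0n.
Qed.

Lemma weight_le_pdom m l : weight_le m l -> pdom m l.
Proof.
move=> [s sP e] k kr; rewrite -subr_ge0 -psumB e.
elim: s sP {e} => [|a s IH] /=; first by rewrite big_nil psum0.
by case/andP => ap /IH sp; rewrite big_cons psumD addr_ge0 // pos_root_psum.
Qed.

Definition dominant l := (forall i j : 'I_r, (i <= j)%N -> l 0 j <= l 0 i)
  /\ (forall i, 0 <= l 0 i).

Definition sdominant l := (forall i j : 'I_r, (i < j)%N -> l 0 j < l 0 i)
  /\ (forall i, 0 < l 0 i).

Lemma sdominant_dominant l : sdominant l -> dominant l.
Proof.
move=> [h1 h2]; split=> [i j|i]; last exact: ltW.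
by rewrite leq_eqVlt => /orP[/eqP /val_inj -> //|/h1 /ltW].
Qed.

Lemma dominantD_s l m : dominant l -> sdominant m -> sdominant (l + m).
Proof.
move=> [h1 h2] [h3 h4]; split=> [i j ij|i]; rewrite !mxE.
  by rewrite ler_ltD ?h1 ?h3 // ltnW.
by rewrite ltr_wpDl ?h2 ?h4.
Qed.

Lemma weyl_vector_sdominant : sdominant (weyl_vector r).
Proof. by split=> [i j ij|i]; rewrite !mxE; have := ltn_ord i; lia. Qed.

Lemma weyl_act_pdom w l : dominant l -> pdom (weyl_act w l) l.
Proof.
move=> [ld l0] k kr; rewrite !psum_ord //.
(* The threshold between the first k coordinates of l, all at least t, and the others, all at most
   t. After subtracting t from each of k chosen coordinates, the best choice is visibly the first
   k. *)
pose t := ext l k.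
have tlt (j : 'I_r) : (j < k)%N -> t <= l 0 j.
  rewrite /t /ext; case: insubP => [k' _ k'k|_] jk; last exact: l0.
  by apply: ld; rewrite k'k ltnW.
have tge (j : 'I_r) : (k <= j)%N -> l 0 j <= t.
  move=> kj; have kr' : (k < r)%N by apply: leq_ltn_trans kj _.
  by rewrite /t -(ext_ord l j) (ext_ord l (Ordinal kr')) ext_ord; apply: ld.
apply: (@le_trans _ _ (\sum_(i < r | (i < k)%N) l 0 (w.1^-1%g i))).
  apply: ler_sum => i _; rewrite mxE; have := l0 (w.1^-1%g i).
  by case: (w.2 i); rewrite ?expr1 ?expr0; lia.
rewrite (reindex_inj (@perm_inj _ w.1)) /=.
under eq_bigr do rewrite permK.
have cnt : \sum_(j < r | (w.1 j < k)%N) t = \sum_(j < r | (j < k)%N) t.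
  by rewrite [RHS](reindex_inj (@perm_inj _ w.1)).
rewrite -(lerD2r (- \sum_(j < r | (j < k)%N) t)) -{1}cnt -!sumrB.
rewrite [leLHS]big_mkcond [leRHS]big_mkcond /=; apply: ler_sum => j _.
case: (ltnP j k) => jk; first by have := tlt _ jk; case: ifP; lia.
by have := tge _ jk; case: ifP; lia.
Qed.

Lemma weyl_act_stab w l : sdominant l -> weyl_act w l = l -> w = (1%g, [ffun=> false]).
Proof.
move=> [ld l0] /rowP e; case: w e => p s e.
have sF i : s i = false.
  apply/negP => si; have := e i; rewrite mxE /= si expr1.
  by have := l0 (p^-1%g i); have := l0 i; lia.
have l_inj i j : l 0 i = l 0 j -> i = j.
  move=> lij; apply/eqP/negPn; rewrite neq_ltn; apply/negP => /orP[] /ld;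
  by rewrite lij ltxx.
congr (_, _); last by apply/ffunP => i; rewrite ffunE.
apply: invg_inj; apply/permP => i; rewrite invg1 perm1.
by apply: l_inj; rewrite -[RHS]e mxE /= sF expr0 mul1r.
Qed.

(** |l|^2 - |nu|^2 is the sum of (l - nu)_i (l + nu)_i. Abel summation writes it with the
    nonnegative partial sums of l - nu, multiplied by the positive descents of l + nu; it vanishes
    only if all these partial sums do. *)
Lemma sqnorm_sdominant_inj nu l : dominant nu -> sdominant l -> pdom nu l ->
  sqnorm nu = sqnorm l -> nu = l.
Proof.
move=> [nd n0] [ld l0] dom e.
pose N i := ext (l + nu) i; pose d i := ext (l - nu) i.
have N_gt (i : 'I_r) : N i.+1 < N i.
  rewrite /N [ext _ i]ext_ord; have [ir|ir] := ltnP i.+1 r.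
    rewrite (ext_ord _ (Ordinal ir)) !mxE.
    apply: ltr_leD; first exact: ld.
    exact: nd.
  by rewrite ext_ge // mxE ltr_wpDr ?n0 ?l0.
have S0 : \sum_(i < r) psum i.+1 (l - nu) * (N i - N i.+1) = 0.
  have := abel_sum d N r; rewrite [N r]ext_ge // mulr0 addr0 => <-.
  transitivity (sqnorm l - sqnorm nu); last by rewrite e subrr.
  rewrite /sqnorm -sumrB; apply: eq_bigr => i _.
  by rewrite /d /N !ext_ord !mxE; ring.
have p0 (i : 'I_r) : 0 <= psum i.+1 (l - nu) by rewrite psumB subr_ge0 dom.
have t0 (i : 'I_r) : 0 <= psum i.+1 (l - nu) * (N i - N i.+1).
  by rewrite mulr_ge0 // subr_ge0 ltW.
move/eqP: S0; rewrite psumr_eq0 => [/allP S0|i _]; last exact: t0.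
apply: psum_inj => -[_|k kr]; first by rewrite /psum !big_ord0.
have := S0 (Ordinal kr); rewrite mem_index_enum => /(_ isT) /=.
rewrite mulf_eq0 [X in _ || X]subr_eq0 [N k == _]gt_eqF ?orbF; last exact: (N_gt (Ordinal kr)).
by rewrite psumB subr_eq0 => /eqP.
Qed.

(** Take the orbit element with the largest pairing against rho. Swapping an increasing pair or
    flipping a negative coordinate would enlarge it, since rho is strictly decreasing and
    positive. *)
Lemma exists_dominant nu : exists w, dominant (weyl_act w nu).
Proof.
pose h l : int := \sum_(i < r) (r%:Z - i%:Z) * l 0 i.
pose w0 : weyl_group r := (1%g, [ffun=> false]).
pose w := [arg max_(w > w0) h (weyl_act w nu)]%O.
have wmax w' : h (weyl_act w' nu) <= h (weyl_act w nu).
  by rewrite /w; case: arg_maxP => // v _ /(_ w'); apply.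
exists w; set l := weyl_act w nu.
have swap (i j : 'I_r) : (i < j)%N -> l 0 j <= l 0 i.
  move=> ij; rewrite leNgt; apply/negP => lij.
  pose t := tperm i j.
  pose w' : weyl_group r := ((w.1 * t)%g, [ffun k => w.2 (t k)]).
  have l'E k : weyl_act w' nu 0 k = l 0 (t k).
    by rewrite !mxE /= ffunE invMg permM tpermV.
  have := wmax w'; rewrite leNgt => /negP; apply.
  have ji : j != i by rewrite neq_ltn ij orbT.
  rewrite /h (bigD1 i) //= (bigD1 j) //= [ltRHS](bigD1 i) //= [X in _ < _ + X](bigD1 j) //=.
  rewrite !l'E tpermL tpermR.
  have -> : \sum_(k < r | (k != i) && (k != j)) (r%:Z - k%:Z) * weyl_act w' nu 0 k
      = \sum_(k < r | (k != i) && (k != j)) (r%:Z - k%:Z) * l 0 k.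
    by apply: eq_bigr => k /andP[ki kj]; rewrite l'E tpermD // eq_sym.
  rewrite !addrA ltrD2r -/l; move: (l 0 i) (l 0 j) lij => a b ab.
  have := ltn_ord j; nia.
have pos (i : 'I_r) : 0 <= l 0 i.
  rewrite leNgt; apply/negP => li.
  pose w' : weyl_group r := (w.1, [ffun k => w.2 k (+) (k == i)]).
  have l'E k : weyl_act w' nu 0 k = (-1) ^+ (k == i) * l 0 k.
    by rewrite !mxE /= ffunE signr_addb mulrA [_ ^+ (k == i) * _]mulrC.
  have := wmax w'; rewrite leNgt => /negP; apply.
  rewrite /h (bigD1 i) //= [ltRHS](bigD1 i) //= l'E eqxx expr1.
  have -> : \sum_(k < r | k != i) (r%:Z - k%:Z) * weyl_act w' nu 0 k
      = \sum_(k < r | k != i) (r%:Z - k%:Z) * l 0 k.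
    by apply: eq_bigr => k /negbTE ki; rewrite l'E ki mul1r.
  rewrite ltrD2r -/l; move: (l 0 i) li => a a0.
  have := ltn_ord i; nia.
split=> // i j; rewrite leq_eqVlt => /orP[/eqP /val_inj -> //|]; exact: swap.
Qed.

End Dominance.

(** * Conjugation into the torus and Weyl invariance of the character *)

Section TorusConj.
Variables (C : numClosedFieldType) (r : nat).
Local Notation om := (@symp_form C r).
Local Notation x_ := (@xvec C r).
Local Notation y_ := (@yvec C r).

Lemma form_basis_in_Sp (h : 'M[C]_r.*2) :
  (forall k l, om (col k h) (col l h) = om (delta_mx k 0) (delta_mx l 0)) -> in_Sp h.
Proof.
move=> hh; apply: om_eq_symplectic => u v.
have b1 : bilinear_form (fun u v => om (h *m u) (h *m v)).
  by split=> a x y w; rewrite mulmxDr -scalemxAr ?omDl ?omZl ?omDr ?omZr.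
have b2 : bilinear_form om.
  by split=> a x y w; rewrite ?omDl ?omZl ?omDr ?omZr.
rewrite (bilinear_form_delta u v b1) (bilinear_form_delta u v b2).
by apply: eq_bigr => k _; apply: eq_bigr => l _; rewrite -!colE hh.
Qed.

(** Eigenvectors whose eigenvalues do not multiply to 1 are orthogonal. By regularity the u i and
    the rescaled v i then form a symplectic basis, the columns of h. *)
Lemma torus_conj (g : 'M[C]_r.*2) (z : 'I_r -> C) (u v : 'I_r -> 'cV[C]_r.*2) :
  in_Sp g -> torus_regular z ->
  (forall i, g *m u i = z i *: u i) -> (forall i, g *m v i = (z i)^-1 *: v i) ->
  (forall i, om (u i) (v i) != 0) ->
  exists2 h, in_Sp h & g *m h = h *m torus_elt z.
Proof.
move=> gs [z0 z1 zn] gu gv uv0.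
pose v' i := (om (u i) (v i))^-1 *: v i.
have gv' i : g *m v' i = (z i)^-1 *: v' i.
  by rewrite -scalemxAr gv !scalerA mulrC.
have orth a b p q : g *m p = a *: p -> g *m q = b *: q -> a * b != 1 -> om p q = 0.
  move=> ga gb ab; have := symplectic_om p q gs; rewrite ga gb omZl omZr mulrA => /eqP.
  by rewrite -subr_eq0 -{2}[om p q]mul1r -mulrBl mulf_eq0 subr_eq0 (negbTE ab) => /eqP.
have uu i j : om (u i) (u j) = 0 := orth _ _ _ _ (gu i) (gu j) (z1 i j).
have vv i j : om (v' i) (v' j) = 0.
  apply: orth (gv' i) (gv' j) _; rewrite -invfM; apply: contra (z1 j i) => /eqP e.
  by rewrite mulrC -[_ * _]invrK e invr1.
have uv i j : om (u i) (v' j) = (i == j)%:R.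
  have [->|ij] := eqVneq i j; first by rewrite omZr mulVf.
  apply: orth (gu i) (gv' j) _; apply: contra (zn _ _ ij) => /eqP e.
  by rewrite -[z j]mul1r -e mulfVK.
pose h : 'M[C]_r.*2 := \matrix_(a,
  k) (if odd k then v' (half_coord k) a 0 else u (half_coord k) a 0).
have hx i : col (xcoord i) h = u i.
  by apply/colP => a; rewrite !mxE /= odd_double half_xcoord.
have hy i : col (ycoord i) h = v' i.
  by apply/colP => a; rewrite !mxE /= odd_double half_ycoord.
exists h.
  apply: form_basis_in_Sp => k l; case: (coordP k) => i _; case: (coordP l) => j _;
    rewrite ?hx ?hy -?[delta_mx (xcoord _) 0]/(xvec _ _) -?[delta_mx (ycoord _) 0]/(yvec _
      _) omxy //.
  by rewrite omC uv eq_sym.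
apply: eq_mulcol => w; rewrite -!mulmxA [w]vec_coord !mulmx_sumr; apply: eq_bigr => i _.
rewrite !mulmxDr -!scalemxAr !torus_xy -!scalemxAr -!colE hx hy gu gv'.
by rewrite !scalerA.
Qed.

(** The action on torus points dual to [weyl_act], in the sense of [monomial_weyl_point]. *)
Definition weyl_point (w : weyl_group r) (z : 'I_r -> C) : 'I_r -> C :=
  fun k => if w.2 (w.1 k) then (z (w.1 k))^-1 else z (w.1 k).

Lemma weyl_point_regular w z : torus_regular z -> torus_regular (weyl_point w z).
Proof.
move=> [z0 z1 zn].
have zn' i j : i != j -> z (w.1 i) != z (w.1 j).
  by move=> ij; apply: zn; rewrite (inj_eq perm_inj).
have divE (a b : C) : b != 0 -> (a * b^-1 == 1) = (a == b).
  by move=> b0; rewrite -(inj_eq (mulIf b0)) mulfVK // mul1r.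
have invE (a : C) : (a^-1 == 1) = (a == 1) by rewrite invr_eq1.
split=> [k|i j|i j ij]; rewrite /weyl_point.
- by case: ifP; rewrite ?invr_eq0.
- have [<-|ij] := eqVneq i j.
    by case: ifP; rewrite -?invfM ?invr_eq1.
  case: ifP; case: ifP => _ _.
  + by rewrite -invfM invr_eq1.
  + by rewrite mulrC divE // eq_sym zn'.
  + by rewrite divE // zn'.
  + by [].
- case: ifP; case: ifP => _ _.
  + by rewrite (inj_eq invr_inj) zn'.
  + by rewrite -divE // -invfM invr_eq1.
  + by rewrite eq_sym -divE // -invfM invr_eq1.
  + exact: zn'.
Qed.

Lemma monomial_weyl_point w z m : torus_pt z ->
  monomial (weyl_point w z) m = monomial z (weyl_act w m).
Proof.
move=> z0; rewrite /monomial [RHS](reindex_inj (@perm_inj _ w.1)) /=.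
apply: eq_bigr => k _; rewrite /weyl_point mxE permK.
by case: ifP => _; rewrite ?expr1 ?expr0 ?mul1r // mulN1r exprz_inv.
Qed.

Lemma alternant_weyl_point w (z : 'I_r -> C) (l : 'rV[int]_r) :
  \det (\matrix_(i, j) (weyl_point w z i ^ l 0 j - weyl_point w z i ^ (- l 0 j)))
  = (weyl_sign w)%:~R * \det (\matrix_(i < r, j < r) (z i ^ l 0 j - z i ^ (- l 0 j))).
Proof.
set M := (X in _ * \det X).
have -> : \matrix_(i, j) (weyl_point w z i ^ l 0 j - weyl_point w z i ^ (- l 0 j))
    = diag_mx (\row_i (-1) ^+ (w.2 (w.1 i))) *m (perm_mx w.1 *m M).
  rewrite -row_permE; apply/matrixP=> i j; rewrite mul_diag_mx !mxE /weyl_point.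
  case: ifP => _; last by rewrite expr0 mul1r.
  by rewrite expr1 mulN1r opprB !exprz_inv opprK.
rewrite !det_mulmx det_diag det_perm mulrA; congr (_ * _).
rewrite weyl_signE rmorphM rmorphXn rmorphN1 rmorph_prod mulrC; congr (_ * _).
rewrite [RHS](reindex_inj (@perm_inj _ w.1)) /=.
by apply: eq_bigr => i _; rewrite mxE rmorphXn rmorphN1.
Qed.

Variables (n : nat) (rep : 'M[C]_r.*2 -> 'M[C]_n) (mu : 'I_n -> 'rV[int]_r).
Hypothesis dr : diag_rep rep mu.

(** The two torus elements are conjugate in the group: [torus_conj] applies to the standard basis,
    with x and y exchanged where the sign changes. *)
Lemma torus_char_weyl_point w z : torus_regular z ->
  torus_char mu (weyl_point w z) = torus_char mu z.
Proof.
move=> zreg; have zw := weyl_point_regular w zreg.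
have [z0 _ _] := zreg; have [zw0 _ _] := zw.
pose u k := if w.2 (w.1 k) then y_ (w.1 k) else x_ (w.1 k).
pose v k := if w.2 (w.1 k) then x_ (w.1 k) else y_ (w.1 k).
have [h hs hg] : exists2 h, in_Sp h & torus_elt z *m h = h *m torus_elt (weyl_point w z).
  apply: (torus_conj (torus_symplectic z0) zw (u := u) (v := v)) => k;
    rewrite /u /v /weyl_point; case: ifP => _; rewrite ?torus_xy ?invrK //.
  - by rewrite omxy eqxx oppr_eq0 oner_eq0.
  - by rewrite omxy eqxx oner_eq0.
have [_ repM _] := diag_rep_sp dr.
have tz := torus_symplectic z0; have tzw := torus_symplectic zw0.
rewrite -(tr_torus dr zw) -(tr_torus dr zreg).
have e : rep (torus_elt z) *m rep h = rep h *m rep (torus_elt (weyl_point w z)).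
  by rewrite -!repM // hg.
have hV := rep_inv (diag_rep_sp dr) hs.
rewrite -[rep (torus_elt z)]mulmx1 -hV mulmxA e mxtrace_mulC mulmxA.
by rewrite (mulmx1C hV) mul1mx.
Qed.

End TorusConj.

(** * Multiplicity one of the highest weight *)

Section Subspaces.
Variables (F : fieldType) (n : nat) (P : 'cV[F]_n -> Prop).
Hypothesis Ps : subspace_prop P.

Lemma subspace_propD u v : P u -> P v -> P (u + v).
Proof. by move=> Pu Pv; rewrite -[u]scale1r; apply: Ps.2. Qed.

Lemma subspace_propZ a u : P u -> P (a *: u).
Proof. by move=> Pu; rewrite -[_ *: _]addr0; apply: Ps.2 => //; case: Ps. Qed.

Lemma subspace_prop_sum (I : Type) (s : seq I) (u : I -> 'cV[F]_n) :
  (forall i, P (u i)) -> P (\sum_(i <- s) u i).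
Proof.
move=> Pu; elim: s => [|i s IH]; first by rewrite big_nil; case: Ps.
by rewrite big_cons; apply: subspace_propD.
Qed.

End Subspaces.

Section Infinitesimal.
Variables (C : numClosedFieldType) (r n : nat).
Variable rep : 'M[C]_r.*2 -> 'M[C]_n.
Hypothesis rep_sp : is_poly_rep rep.
Variables (D : 'M[C]_r.*2 -> 'M[C]_n) (Dd : differential rep D).
Local Notation dq := (dquad D).

(** The differential equation is the jet at s = 0 of the one-parameter law for
    [transvec v (s + t)]. *)
Lemma rep_transvec_poly v : exists p : 'I_n -> 'I_n -> {poly C},
  (forall t, rep (transvec v t) = \matrix_(a, b) (p a b).[t]) /\
  (forall a b, (p a b)^`() = \sum_c dsquare D v a c *: p c b).
Proof.
have [rep1 repM repP] := rep_sp.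
have pf (ab : 'I_n * 'I_n) : polyfun (fun t => rep (transvec v t) ab.1 ab.2).
  have [P PE] := repP ab.1 ab.2.
  apply: (fun_closed_ext (polyfun_closed C)) => [t|].
    by rewrite PE //; apply: transvec_symplectic.
  apply: (fun_closed_meval (polyfun_closed C)) => k; case/mxvec_indexP: k => i j.
  exists (((1%:M : 'M[C]_r.*2) i j)%:P + ((v *m covec v) i j) *: 'X) => t.
  rewrite mxvecE /transvec [LHS]mxE [X in _ + X]mxE.
  by rewrite hornerD hornerC hornerZ hornerX mulrC.
have [p pE] := fin_all_exists pf.
have pM t : rep (transvec v t) = \matrix_(a, b) (p (a, b)).[t].
  by apply/matrixP=> a b; rewrite mxE -pE.
exists (fun a b => p (a, b)); split=> // a b.
apply/eqP; rewrite -subr_eq0; apply/eqP/poly_eq0_fun => t.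
rewrite hornerD hornerN horner_sum; apply/eqP; rewrite subr_eq0; apply/eqP.
have j1 := mjetM (mjet_rep_transvec Dd v) (mjet_cst (rep (transvec v t))).
have j2 := jet_poly (p (a, b) \Po ('X + t%:P)).
have e s : ((rep \o transvec v) s *m rep (transvec v t)) a b = (p (a, b) \Po ('X + t%:P)).[s].
  rewrite /= -repM ?transvecD; try exact: transvec_symplectic.
  by rewrite (pE (a, b)) horner_comp hornerD hornerX hornerC.
have [_] := jet_uniq (jet_ext e (j1 a b)) j2.
rewrite deriv_comp derivD derivX derivC addr0 mulr1 horner_comp hornerD hornerX hornerC add0r => <-.
rewrite mulmx0 addr0 mxE; apply: eq_bigr => c _.
by rewrite hornerZ pM mxE.
Qed.

Variable P : 'cV[C]_n -> Prop.
Hypothesis Ps : subspace_prop P.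

(** The equation for p' gives T 0 = 1 and (k + 1) T (k + 1) = [dsquare D v] T k. So rep of a
    transvection is the exponential of t [dsquare D v], a finite sum because its entries are
    polynomials. *)
Lemma transvec_stable v t u : (forall w, P w -> P (dsquare D v *m w)) -> P u ->
  P (rep (transvec v t) *m u).
Proof.
move=> Pv Pu; have [p [pE dp]] := rep_transvec_poly v.
pose T k : 'M[C]_n := \matrix_(a, b) (p a b)`_k.
have T0 : T 0%N = 1%:M.
  have [rep1 _ _] := rep_sp; rewrite -rep1 -(transvec0 v) pE.
  by apply/matrixP=> a b; rewrite !mxE horner_coef0.
have TS k : T k.+1 = k.+1%:R^-1 *: (dsquare D v *m T k).
  apply/matrixP=> a b; have := congr1 (fun q : {poly C} => q`_k) (dp a b).
  rewrite coef_deriv coef_sum !mxE => e.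
  have k0 : (k.+1%:R : C) != 0 by rewrite pnatr_eq0.
  apply: (mulIf k0); rewrite mulr_natr e mulrAC mulVf // mul1r.
  by apply: eq_bigr => c _; rewrite coefZ mxE.
have PT k : P (T k *m u).
  elim: k => [|k IH]; first by rewrite T0 mul1mx.
  by rewrite TS -scalemxAl -mulmxA; apply: (subspace_propZ Ps); apply: Pv.
pose K := (\max_(ab : 'I_n * 'I_n) size (p ab.1 ab.2))%N.
have -> : rep (transvec v t) *m u = \sum_(k < K) t ^+ k *: (T k *m u).
  rewrite pE -[RHS](_ : (\sum_(k < K) t ^+ k *: T k) *m u = _); last first.
    by rewrite mulmx_suml; apply: eq_bigr => k _; rewrite scalemxAl.
  congr (_ *m _); apply/matrixP=> a b; rewrite mxE summxE (@horner_coef_wide _ K).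
    by apply: eq_bigr => k _; rewrite !mxE mulrC.
  exact: (@leq_bigmax _ (fun ab : 'I_n * 'I_n => size (p ab.1 ab.2)) (a, b)).
by apply: (subspace_prop_sum Ps) => k; apply: (subspace_propZ Ps).
Qed.

Definition bvec (s : bool * 'I_r) : 'cV[C]_r.*2 := if s.1 then yvec C s.2 else xvec C s.2.

Lemma dquad_stable u w x : (forall s t x, P x -> P (dq (bvec s) (bvec t) *m x)) ->
  P x -> P (dq u w *m x).
Proof.
move=> Pb.
have ext1 (f : 'cV[C]_r.*2 -> 'M[C]_n) : (forall a b c, f (a *: b + c) = a *: f b + f c) ->
    (forall s x, P x -> P (f (bvec s) *m x)) -> forall u x, P x -> P (f u *m x).
  move=> fl fb {}u {}x Px.
  have f0 : f 0 = 0.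
    by have := fl (-1) 0 0; rewrite scaler0 addr0 scaleN1r addNr.
  rewrite [u]vec_coord.
  elim: (index_enum _) => [|i s IH]; first by rewrite big_nil f0 mul0mx; case: Ps.
  rewrite big_cons -addrA !fl !mulmxDl -!scalemxAl.
  apply: Ps.2; first exact: (fb (false, i)).
  by apply: Ps.2 => //; apply: (fb (true, i)).
move: u x; apply: (ext1 (fun u => dq u w)) => [a b c|s x Px];
  first by rewrite (dquadDl Dd) (dquadZl Dd).
move: w x Px; apply: (ext1 (fun u => dq (bvec s) u)) => [a b c|t x Px].
  by rewrite (dquadDr Dd) (dquadZr Dd).
exact: Pb.
Qed.

Lemma rep_stable : (forall s t x, P x -> P (dq (bvec s) (bvec t) *m x)) ->
  forall g x, in_Sp g -> P x -> P (rep g *m x).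
Proof.
move=> Pb g x /symplectic_transvec_gen; have [rep1 repM _] := rep_sp.
elim=> [|v t h _ hg IH] Px; first by rewrite rep1 mul1mx.
rewrite repM; [|exact: transvec_symplectic|exact: transvec_gen_symplectic hg].
rewrite -mulmxA; apply: transvec_stable; last exact: IH.
move=> w Pw.
have -> : dsquare D v = 2^-1 *: dq v v.
  by rewrite (dquad_diag Dd) scalerA mulVf ?scale1r // pnatr_eq0.
by rewrite -scalemxAl; apply: (subspace_propZ Ps); apply: dquad_stable.
Qed.

End Infinitesimal.

Section HighestWeight.
Variables (C : numClosedFieldType) (r n : nat).
Variable rep : 'M[C]_r.*2 -> 'M[C]_n.
Variable mu : 'I_n -> 'rV[int]_r.
Hypothesis dr : diag_rep rep mu.
Variables (D : 'M[C]_r.*2 -> 'M[C]_n) (Dd : differential rep D).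
Local Notation dq := (dquad D).
Local Notation bvec := (@bvec C r).
Let rep_sp := diag_rep_sp dr.

Definition bweight (s : bool * 'I_r) : 'rV[int]_r := (-1) ^+ s.1 *: std_weight s.2.

Lemma monomial_inj (a b : 'rV[int]_r) :
  (forall z : 'I_r -> C, torus_pt z -> monomial z a = monomial z b) -> a = b.
Proof.
move=> e; have h (z : 'I_r -> C) : torus_regular z ->
    \sum_(i : bool) (-1) ^+ i * monomial z (if i then a else b) = 0.
  by move=> [z0 _ _]; rewrite big_bool /= e // expr1 expr0; ring.
have := monomial_indep h a; rewrite big_mkcond big_bool /= eqxx expr1 expr0.
case: eqP => [->//|_]; rewrite addr0 => /eqP.
by rewrite oppr_eq0 oner_eq0.
Qed.

Lemma torus_bvec z s : torus_pt z -> torus_elt z *m bvec s = monomial z (bweight s) *: bvec s.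
Proof.
move=> z0; case: s => b i.
have -> : monomial z (bweight (b, i)) = z i ^ ((-1) ^+ b).
  rewrite /monomial (bigD1 i) //= !mxE !eqxx mulr1 big1 ?mulr1 // => j /negbTE ji.
  by rewrite !mxE ji andbF mulr0.
by case: b; rewrite /bvec /= torus_xy.
Qed.

Lemma dquad_weight s t j k : dq (bvec s) (bvec t) j k != 0 ->
  mu j = bweight s + bweight t + mu k.
Proof.
move=> n0; apply: monomial_inj => z z0.
have e := rep_dquad_comm rep_sp Dd (bvec s) (bvec t) (torus_symplectic z0).
move: e; rewrite !torus_bvec // (dquadZl Dd) (dquadZr Dd) scalerA (diag_rep_torus dr z0).
move=> /matrixP/(_ j k); rewrite mul_diag_mx mul_mx_diag !mxE mulrAC => /(mulIf n0) ->.
by rewrite !monomialD.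
Qed.

Variables (lam : 'rV[int]_r) (j0 : 'I_n).
Hypothesis mu_j0 : mu j0 = lam.
Hypothesis mu_le : forall j, pdom (mu j) lam.

(** The sign of the root [bweight s + bweight t], witnessed by a single partial sum, which is
    exactly what clashes with [mu_le]. *)
Definition raising s t := exists2 k, (k <= r)%N & 0 < psum k (bweight s + bweight t).
Definition lowering s t := exists2 k, (k <= r)%N & psum k (bweight s + bweight t) < 0.

Lemma psum_bweight k s : (k <= r)%N -> psum k (bweight s) = (-1) ^+ s.1 * (s.2 < k)%N%:R.
Proof.
move=> kr; rewrite -psum_std // /bweight; case: s => -[] i /=.
  by rewrite expr1 scaleN1r mulN1r -[- _]add0r psumB psum0 add0r.
by rewrite expr0 scale1r mul1r.
Qed.

Lemma raising_or_lowering s t :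
  [\/ raising s t, lowering s t | exists i, (s = (false, i) /\ t = (true,
    i)) \/ (s = (true, i) /\ t = (false, i))].
Proof.
case: s => b i; case: t => c j.
have [ij|ij] := leqP i j.
- have [bc|bc] := eqVneq b c.
    subst c; have lt := ltn_ord j; case: b; [constructor 2 | constructor 1];
      by exists r => //; rewrite psumD !psum_bweight //= !ltn_ord.
  have [e|ij'] := eqVneq i j.
    subst j; constructor 3; exists i.
    by case: b c bc => -[] //= _; [right|left].
  have {}ij : (i < j)%N by rewrite ltn_neqAle ij' ij.
  have lt := ltn_ord i; case: b c bc => -[] //= _; [constructor 2 | constructor 1];
    by exists i.+1 => //; rewrite psumD !psum_bweight //= ltnSn ltnS leqNgt ij /=.
- have [bc|bc] := eqVneq b c.
    subst c; case: b; [constructor 2 | constructor 1];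
      by exists r => //; rewrite psumD !psum_bweight //= !ltn_ord.
  have lt := ltn_ord j; case: b c bc => -[] //= _; [constructor 1 | constructor 2];
    by exists j.+1 => //; rewrite psumD !psum_bweight //= ltnSn ltnS leqNgt ij /=.
Qed.

Local Notation top := (delta_mx j0 0 : 'cV[C]_n).

Lemma raising_top s t : raising s t -> dq (bvec s) (bvec t) *m top = 0.
Proof.
move=> [k kr kp]; apply/colP => j; rewrite -colE mxE [RHS]mxE.
apply/eqP/negPn/negP => /dquad_weight e.
by have := mu_le j kr; rewrite e psumD mu_j0; lia.
Qed.

Lemma lowering_row s t j (u : 'cV[C]_n) : lowering s t -> mu j = lam ->
  (dq (bvec s) (bvec t) *m u) j 0 = 0.
Proof.
move=> [k kr kp] muj; rewrite mxE big1 // => i _.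
have [->|/dquad_weight e] := eqVneq (dq (bvec s) (bvec t) j i) 0; first by rewrite mul0r.
by have := mu_le i kr; have := congr1 (psum k) e; rewrite psumD muj; lia.
Qed.

Lemma cartan_top i : dq (bvec (false, i)) (bvec (true, i)) *m top = (- (lam 0 i)%:~R) *: top.
Proof.
rewrite /bvec /= (dquad_xy dr Dd) mulNmx scaleNr; congr (- _).
apply/colP => j; rewrite -colE !mxE eqxx andbT.
by have [->|ne] := eqVneq j j0; rewrite ?mulr0n ?mulr0 // mulr1n mulr1 mu_j0.
Qed.

(* Words in the lowering operators applied to the top vector; the index bounds
   the word length. *)
Inductive lower_span : nat -> 'cV[C]_n -> Prop :=
| Lower_top k a : lower_span k (a *: top)
| Lower_add k u v of lower_span k u & lower_span k v : lower_span k (u + v)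
| Lower_mul k s t u of lowering s t & lower_span k u :
    lower_span k.+1 (dq (bvec s) (bvec t) *m u)
| Lower_S k u of lower_span k u : lower_span k.+1 u.

Lemma lower_spanZ k a u : lower_span k u -> lower_span k (a *: u).
Proof.
elim=> {k u} [k b|k u v _ IHu _ IHv|k s t u st _ IH|k u _ IH].
- by rewrite scalerA; exact: Lower_top.
- by rewrite scalerDr; apply: Lower_add.
- by rewrite scalemxAr; apply: Lower_mul.
- exact: Lower_S.
Qed.

(** A non-lowering operator is moved to the right past the lowering ones until it meets the top
    vector, which it kills or scales. Each exchange leaves a commutator, a combination of operators
    [dq] applied to a shorter word, so the length bound is kept. *)
Lemma lower_span_dquad k u : lower_span k u -> forall s t,
  lower_span k.+1 (dq (bvec s) (bvec t) *m u)
  /\ (~ lowering s t -> lower_span k (dq (bvec s) (bvec t) *m u)).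
Proof.
move=> uk s t.
suff h : ~ lowering s t -> lower_span k (dq (bvec s) (bvec t) *m u).
  split=> //; have [st|/h] := boolp.EM (lowering s t); [exact: Lower_mul | exact: Lower_S].
elim: uk s t => {k u} [k a|k u v uk IHu vk IHv|k s' t' u st' uk IH|k u uk IH] s t st.
- rewrite -scalemxAr; apply: lower_spanZ.
  case: (raising_or_lowering s t) => [/raising_top ->||[i [[-> ->]|[-> ->]]]] //.
  + by rewrite -(scale0r top); exact: Lower_top.
  + by rewrite cartan_top; exact: Lower_top.
  + by rewrite dquadC cartan_top; exact: Lower_top.
- by rewrite mulmxDr; apply: Lower_add; [apply: IHu | apply: IHv].
- have all_dq a b : lower_span k.+1 (dq (bvec a) (bvec b) *m u).
    by have [ab|/IH] := boolp.EM (lowering a b); [exact: Lower_mul | exact: Lower_S].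
  have := comm_dquad rep_sp Dd (bvec s) (bvec t) (bvec s') (bvec t'); rewrite /comm.
  move/eqP; rewrite subr_eq => /eqP e; rewrite mulmxA e !mulmxDl -!scalemxAl.
  apply: Lower_add; last first.
    by rewrite -mulmxA; apply: Lower_mul => //; apply: IH.
  by apply: Lower_add; apply: Lower_add; apply: lower_spanZ.
- exact/Lower_S/IH.
Qed.

Lemma lower_spanW k m u : (k <= m)%N -> lower_span k u -> lower_span m u.
Proof.
by move=> /subnKC <-; elim: (m - k)%N => [|d IH] uk; rewrite ?addn0 // addnS; apply/Lower_S/IH.
Qed.

(** By irreducibility the words span everything. Yet a coordinate j different from j0 of weight lam
    vanishes on all of them: a lowering operator could reach weight lam only from a weight not
    dominated by lam. *)
Lemma highest_weight_mult1 j : mu j = lam -> j = j0.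
Proof.
move=> muj; apply/eqP/negPn/negP => jj0.
pose P u := exists k, lower_span k u.
have Ps : subspace_prop P.
  split=> [|a u v [k uk] [m vm]]; first by exists 0%N; rewrite -(scale0r top); exact: Lower_top.
  exists (maxn k m); apply: Lower_add.
    by apply/lower_spanZ/lower_spanW/uk/leq_maxl.
  exact/lower_spanW/vm/leq_maxr.
have Pd s t x : P x -> P (dq (bvec s) (bvec t) *m x).
  by move=> [k /lower_span_dquad/(_ s t)[h _]]; exists k.+1.
have Pall : forall v, P v.
  apply: (diag_rep_irr dr Ps); first exact: (rep_stable rep_sp Dd Ps Pd).
  exists top; last by exists 0%N; rewrite -[top]scale1r; exact: Lower_top.
  by apply/eqP => /matrixP/(_ j0 0)/eqP; rewrite !mxE !eqxx oner_eq0.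
have [k] := Pall (delta_mx j 0).
suff h u : lower_span k u -> u j 0 = 0.
  by move/h/eqP; rewrite mxE !eqxx oner_eq0.
elim=> {k u} [k a|k u v _ IHu _ IHv|k s t u st _ _|//].
- by rewrite !mxE (negbTE jj0) mulr0.
- by rewrite mxE IHu IHv addr0.
- exact: lowering_row.
Qed.

End HighestWeight.

Lemma sum_fibers (K : nzRingType) (I : finType) (T : choiceType) (nu : I -> T) (a : I -> K)
  (f : T -> K) :
  (forall x, \sum_(i | nu i == x) a i = 0) -> \sum_i a i * f (nu i) = 0.
Proof.
move=> h; pose s := undup [seq nu i | i <- enum I].
transitivity (\sum_(x <- s) \sum_(i | nu i == x) a i * f (nu i)).
  rewrite (exchange_big_dep predT) //=; apply: eq_bigr => i _.
  rewrite (big_rem (nu i)) /=; last by rewrite mem_undup map_f ?mem_enum.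
  rewrite eqxx big_seq_cond big1 ?addr0 // => x /andP[xs /eqP e].
  by move: xs; rewrite -e mem_rem_uniqF // undup_uniq.
rewrite big1 // => x _.
rewrite (eq_bigr (fun i => a i * f x)) => [|i /eqP -> //].
by rewrite -mulr_suml h mul0r.
Qed.

(** * The character formula on the torus and on the whole group *)

Section WeylAct.
Variable r : nat.

Lemma weyl_act_inj w : injective (@weyl_act r w).
Proof.
move=> a b /rowP e; apply/rowP => k; have := e (w.1 k); rewrite !mxE permK.
by apply: mulfI; rewrite signr_eq0.
Qed.

Lemma weyl_sign1 : weyl_sign ((1%g, [ffun=> false]) : weyl_group r) = 1.
Proof.
by rewrite weyl_signE /= odd_perm1 expr0 mul1r big1 // => i _; rewrite ffunE.
Qed.

Lemma weyl_act1 (l : 'rV[int]_r) : weyl_act (1%g, [ffun=> false]) l = l.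
Proof. by apply/rowP => i; rewrite mxE /= ffunE expr0 mul1r invg1 perm1. Qed.

End WeylAct.

Section TorusFormula.
Variables (C : numClosedFieldType) (r n : nat).
Variable rep : 'M[C]_r.*2 -> 'M[C]_n.
Variable mu : 'I_n -> 'rV[int]_r.
Hypothesis dr : diag_rep rep mu.
Variables (lam : 'rV[int]_r) (j0 : 'I_n).
Hypothesis lam_dom : dominant lam.
Hypothesis mu_j0 : mu j0 = lam.
Hypothesis mu_le : forall j, pdom (mu j) lam.
Local Notation rho := (weyl_vector r).
Local Notation L := (lam + rho).

Lemma shifted_weight_sdominant : sdominant L.
Proof. exact/dominantD_s/weyl_vector_sdominant. Qed.

Lemma char_exponent_pdom p : pdom (char_exponent mu p) L.
Proof.
apply: pdomD; first exact: mu_le.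
exact/weyl_act_pdom/sdominant_dominant/weyl_vector_sdominant.
Qed.

Definition char_coef nu : int := \sum_(p | char_exponent mu p == nu) weyl_sign p.2.

(** If mu_j + w rho = lam + rho then mu_j = lam and w rho = rho, because each summand is dominated
    by its counterpart. Hence w = 1, and j = j0 by multiplicity one. *)
Lemma char_coef_top : char_coef L = 1.
Proof.
rewrite /char_coef (bigD1 (j0, (1%g, [ffun=> false]))) /=; last first.
  by rewrite /char_exponent /= weyl_act1 mu_j0.
rewrite weyl_sign1 big1 ?addr0 // => -[j w] /= /andP[/eqP e ne].
have rd := sdominant_dominant (@weyl_vector_sdominant r).
have [muj wr] := pdomD_eq (mu_le j) (weyl_act_pdom w rd) e.
case/eqP: ne; rewrite (weyl_act_stab (@weyl_vector_sdominant r) wr).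
have [D Dd] := differential_exists (diag_rep_sp dr).
by rewrite (highest_weight_mult1 dr Dd mu_j0 mu_le muj).
Qed.

(* The Casimir eigenvalue, read off at the exponent lam + rho. *)
Lemma char_coef_sqnorm nu : char_coef nu != 0 -> sqnorm nu = sqnorm L.
Proof.
have [c cP] := laplace dr.
have h x : ((sqnorm x)%:~R - c) * (char_coef x)%:~R = 0.
  rewrite -[RHS](monomial_indep cP x) /char_coef [X in _ * X]rmorph_sum mulr_sumr.
  by apply: eq_bigr => p /eqP ->; rewrite mulrC.
have cE : c = (sqnorm L)%:~R.
  by apply/eqP; have /eqP := h L; rewrite char_coef_top mulr1 subr_eq0 eq_sym.
move=> n0; have /eqP := h nu; rewrite mulf_eq0 intr_eq0 (negbTE n0) orbF subr_eq0 cE.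
by rewrite eqr_int => /eqP.
Qed.

(** [I], [a] and [nu] write the difference between the two sides of the character formula as one
    combination of monomials. *)
Let I : finType := (('I_n * weyl_group r) + weyl_group r)%type.
Let a (i : I) : int := match i with inl p => weyl_sign p.2 | inr w => - weyl_sign w end.
Let nu (i : I) : 'rV[int]_r :=
  match i with inl p => char_exponent mu p | inr w => weyl_act w L end.

Let alternant (z : 'I_r -> C) : C :=
  \det (\matrix_(i < r, j < r) (z i ^ L 0 j - z i ^ (- L 0 j))).

Let diffE z : torus_pt z -> \sum_i (a i)%:~R * monomial z (nu i)
  = torus_char mu z * denominator z - alternant z.
Proof.
move=> z0; rewrite big_sumType /= char_denominator //; congr (_ + _).
rewrite /alternant -(weyl_sum_det (fun i m => z i ^ m) L) -sumrN.
by apply: eq_bigr => w _; rewrite rmorphN mulNr.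
Qed.

Let coef x : int := \sum_(i | nu i == x) a i.

(** At [weyl_point w z] the difference gets multiplied by the sign of w, the character being
    invariant and both determinants alternating. Two copies of [I] express this as a relation
    between monomials. *)
Let coef_act w x : coef x = weyl_sign w * coef (weyl_act w x).
Proof.
pose a' (i : I + I) : C := match i with
  | inl i => (a i)%:~R | inr i => - ((weyl_sign w)%:~R * (a i)%:~R) end.
pose nu' (i : I + I) := match i with inl i => weyl_act w (nu i) | inr i => nu i end.
have h (z : 'I_r -> C) : torus_regular z -> \sum_i a' i * monomial z (nu' i) = 0.
  move=> zreg; have [z0 _ _] := zreg; have [zw0 _ _] := weyl_point_regular w zreg.
  rewrite big_sumType /=.
  rewrite (eq_bigr (fun i => (a i)%:~R * monomial (weyl_point w z) (nu i))); last first.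
    by move=> i _; rewrite monomial_weyl_point.
  rewrite diffE // (torus_char_weyl_point dr) // /denominator /alternant !alternant_weyl_point.
  rewrite -/(denominator z) -/(alternant z).
  rewrite (eq_bigr (fun i => - (weyl_sign w)%:~R * ((a i)%:~R * monomial z (nu i)))); last first.
    by move=> i _; rewrite !mulNr mulrA.
  by rewrite -mulr_sumr diffE //; ring.
have := monomial_indep h (weyl_act w x).
rewrite big_mkcond big_sumType /= -!big_mkcond /=.
rewrite (eq_bigl (fun i => nu i == x)); last by move=> i; rewrite (inj_eq (@weyl_act_inj _ w)).
rewrite sumrN -mulr_sumr -!rmorph_sum -rmorphM -rmorphB /= => /eqP.
by rewrite intr_eq0 subr_eq0 => /eqP.
Qed.

Let coefE x : coef x = char_coef x - \sum_(w | weyl_act w L == x) weyl_sign w.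
Proof.
rewrite /coef big_mkcond big_sumType /= -!big_mkcond /=; congr (_ + _).
by rewrite sumrN.
Qed.

(** At lam + rho the coefficients are 1 and 1. Any other dominant exponent occurring on either side
    would be dominated by lam + rho and share its norm, contrary to [sqnorm_sdominant_inj]. *)
Let coef_dominant x : dominant x -> coef x = 0.
Proof.
move=> xd; rewrite coefE.
have [->|xL] := eqVneq x L.
  rewrite char_coef_top (bigD1 (1%g, [ffun=> false])) /= ?weyl_act1 // weyl_sign1 big1.
    by rewrite addr0 subrr.
  move=> w /andP[/eqP wL ne]; case/eqP: ne.
  exact: weyl_act_stab shifted_weight_sdominant wL.
have -> : char_coef x = 0.
  apply/eqP/negPn/negP => cx; case/eqP: xL.
  apply: sqnorm_sdominant_inj xd shifted_weight_sdominant _ (char_coef_sqnorm cx).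
  have [p /eqP <-] : exists p, char_exponent mu p == x.
    apply/existsP; apply: contraNT cx => /existsPn h.
    by rewrite /char_coef big1 // => p; rewrite (negbTE (h p)).
  exact: char_exponent_pdom.
rewrite big1 ?subrr // => w /eqP e; case/eqP: xL.
apply: sqnorm_sdominant_inj xd shifted_weight_sdominant _ _; rewrite -e ?sqnorm_act //.
exact/weyl_act_pdom/sdominant_dominant/shifted_weight_sdominant.
Qed.

Lemma torus_formula (z : 'I_r -> C) : torus_regular z ->
  \det (\matrix_(i < r, j < r) (z i ^ L 0 j - z i ^ (- L 0 j)))
  = torus_char mu z * denominator z.
Proof.
move=> [z0 _ _]; apply/eqP; rewrite eq_sym -subr_eq0 -/(alternant z) -diffE //; apply/eqP.
apply: sum_fibers => x; rewrite -rmorph_sum.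
have [w wx] := exists_dominant x.
by rewrite /= -/(coef x) (coef_act w) coef_dominant // mulr0.
Qed.

End TorusFormula.

(** * Symplectic matrices with distinct eigenvalues *)

Section Separable.
Variables (C : numClosedFieldType) (r : nat).
Local Notation om := (@symp_form C r).

(** A relation c E = 0 persists after weighting c by the powers of the eigenvalues. Inverting the
    Vandermonde matrix isolates each c_k E_kb. *)
Lemma eigenvectors_span (F : fieldType) m (g : 'M[F]_m) (a : 'I_m -> F) (E : 'M[F]_m) :
  injective a -> (forall k, row k E != 0) -> E *m g = diag_mx (\row_k a k) *m E ->
  E \in unitmx.
Proof.
move=> a_inj E0 Eg; rewrite -row_free_unit; apply: inj_row_free => c cE.
have cEm k : c *m diag_mx (\row_j a j ^+ k) *m E = 0.
  elim: k => [|k IH].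
    rewrite (_ : diag_mx _ = 1%:M) ?mulmx1 // -diag_const_mx; congr diag_mx.
    by apply/rowP=> j; rewrite !mxE expr0.
  rewrite (_ : diag_mx _ = diag_mx (\row_j a j ^+ k) *m diag_mx (\row_j a j)); last first.
    by rewrite mulmx_diag; congr diag_mx; apply/rowP=> j; rewrite !mxE exprSr.
  by rewrite mulmxA -[_ *m E]mulmxA -Eg mulmxA IH mul0mx.
pose W := (Vandermonde m (\row_j a j))^T.
have Wu : W \in unitmx.
  rewrite unitmxE det_tr det_Vandermonde unitfE; apply/prodf_neq0 => i _.
  apply/prodf_neq0 => j ij; rewrite !mxE subr_eq0 (inj_eq a_inj).
  by rewrite eq_sym -val_eqE neq_ltn ij.
have cEb b : \row_k (c 0 k * E k b) = 0.
  rewrite -[LHS]mulmx1 -(mulmxV Wu) mulmxA (_ : _ *m W = 0) ?mul0mx //.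
  apply/rowP => k; rewrite !mxE; have /matrixP/(_ 0 b) := cEm k; rewrite !mxE => e.
  rewrite -[RHS]e; apply: eq_bigr => j _; rewrite mul_mx_diag !mxE; ring.
apply/rowP => k; rewrite mxE.
have /rV0Pn[b] := E0 k; rewrite mxE => Ekb.
have /rowP/(_ k) := cEb b; rewrite !mxE => /eqP; rewrite mulf_eq0 (negbTE Ekb) orbF.
by move/eqP.
Qed.

Lemma char_poly_tr (K : comNzRingType) m (A : 'M[K]_m) : char_poly A^T = char_poly A.
Proof.
rewrite /char_poly -det_tr; congr (\det _); apply/matrixP => i j.
by rewrite !mxE eq_sym.
Qed.

(** By nondegeneracy each eigenvector pairs nontrivially with another one, and invariance of the
    form makes their eigenvalues inverse to each other. This pairing [io] is an involution, without
    fixed points because om(e, e) = 0. *)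
Lemma separable_torus_conj (g : 'M[C]_r.*2) : in_Sp g -> separable_poly (char_poly g) ->
  exists z h, [/\ torus_regular z, in_Sp h & g *m h = h *m torus_elt z].
Proof.
move=> gs gsep; have [rs rsE] := closed_field_poly_normal (char_poly g).
have rsP : char_poly g = \prod_(x <- rs) ('X - x%:P).
  by rewrite {1}rsE (monicP (char_poly_monic g)) scale1r.
have rsu : uniq rs by rewrite -separable_prod_XsubC -rsP.
have rss : size rs = r.*2.
  by have := size_char_poly g; rewrite rsP size_prod_XsubC => -[].
pose a (k : 'I_r.*2) := rs`_k.
have a_inj : injective a.
  by move=> i j /eqP; rewrite nth_uniq ?rss // => /eqP /val_inj.
have eP k : exists e : 'cV[C]_r.*2, e != 0 /\ g *m e = a k *: e.
  have : eigenvalue g^T (a k).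
    rewrite eigenvalue_root_char char_poly_tr rsP root_prod_XsubC.
    by rewrite mem_nth // rss.
  case/eigenvalueP => v vg v0; exists v^T; split; first by rewrite trmx_eq0.
  by apply: trmx_inj; rewrite trmx_mul trmxK vg linearZ /= trmxK.
have [e /all_and2 [e0 ge]] := fin_all_exists eP.
pose E : 'M[C]_r.*2 := \matrix_(k, b) e k b 0.
have rowE k : row k E = (e k)^T by apply/rowP=> b; rewrite !mxE.
have Eu : E \in unitmx.
  apply: (@eigenvectors_span _ _ g^T a) => // [k|]; first by rewrite rowE trmx_eq0.
  apply/row_matrixP => k; rewrite row_mul row_diag_mul rowE !mxE.
  by rewrite -trmx_mul ge linearZ.
have pairP k : exists j, om (e k) (e j) != 0.
  apply/existsP; apply: contraNT (e0 k) => /existsPn h; apply/eqP.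
  have cov0 : E *m (covec (e k))^T = 0.
    apply/row_matrixP => j; rewrite row_mul rowE row0 -trmx_mul covec_mul.
    by have := h j; rewrite negbK => /eqP ->; rewrite raddf0 trmx0.
  apply: om_nondeg => v; rewrite omE.
  have -> : covec (e k) = 0.
    by apply: trmx_inj; rewrite trmx0 -[LHS](mulKmx Eu) cov0 mulmx0.
  by rewrite mul0mx mxE.
have [io ioP] := fin_all_exists pairP.
have aio k : a k * a (io k) = 1.
  have := symplectic_om (e k) (e (io k)) gs; rewrite !ge omZl omZr mulrA => /eqP.
  by rewrite -subr_eq0 -{2}[om _ _]mul1r -mulrBl mulf_eq0 subr_eq0 (negbTE (ioP k)) orbF => /eqP.
have a0 k : a k != 0 by apply: contra_eq_neq (aio k) => ->; rewrite mul0r eq_sym oner_eq0.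
have ioK k : io (io k) = k.
  apply: a_inj; apply: (mulfI (a0 (io k))); rewrite aio mulrC.
  by rewrite aio.
have io_neq k : io k != k.
  by apply: contraNneq (ioP k) => ->; rewrite omuu.
have aV k j : a k * a j = 1 -> j = io k.
  by move=> h; apply: a_inj; apply: (mulfI (a0 k)); rewrite h aio.
(* One index from each pair {k, io k}, so S has r elements; their eigenvalues become the torus
   coordinates. *)
pose S := [set k : 'I_r.*2 | (k < io k)%N].
have cS : #|S| = r.
  have SC : ~: S = io @: S.
    apply/setP => k; rewrite !inE -leqNgt; apply/idP/imsetP => [ik|[j + ->]].
      exists (io k); last by rewrite ioK.
      by rewrite inE ioK ltn_neqAle ik andbT val_eqE io_neq.
    by rewrite inE ioK => /ltnW.
  have := cardsC S; rewrite SC card_imset; last exact: can_inj ioK.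
  by rewrite card_ord addnn => /double_inj.
pose s (i : 'I_r) : 'I_r.*2 := enum_val (cast_ord (esym cS) i).
have sS i : (s i < io (s i))%N by have := enum_valP (cast_ord (esym cS) i); rewrite inE.
have s_inj : injective s by move=> i j /enum_val_inj /cast_ord_inj.
pose z i := a (s i).
have zreg : torus_regular z.
  split=> [i|i j|i j ij]; first exact: a0.
    apply/eqP => /aV e1; have := sS i; have := sS j.
    by rewrite e1 ioK => h1 /(ltn_trans h1); rewrite ltnn.
  by rewrite (inj_eq a_inj) (inj_eq s_inj).
have zV i : a (io (s i)) = (z i)^-1.
  by apply: (mulfI (a0 (s i))); rewrite aio mulfV.
have [h hs hg] := torus_conj (u := fun i => e (s i)) (v := fun i => e (io (s i))) gs zreg
  (fun i => ge (s i)) (fun i => etrans (ge _) (congr1 ( *:%R^~ _) (zV i))) (fun i => ioP _).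
by exists z, h.
Qed.

Lemma torus_separable z : torus_regular z -> separable_poly (char_poly (torus_elt z : 'M[C]_r.*2)).
Proof.
move=> [z0 z1 zn]; rewrite torus_mx_diag; set d := \row_k _.
rewrite char_poly_trig ?diag_mx_is_trig //.
rewrite (eq_bigr (fun k => 'X - (d 0 k)%:P)) => [|k _];
  last by rewrite [diag_mx d k k]mxE eqxx mulr1n.
rewrite -(big_map (fun k => d 0 k) xpredT (fun x => 'X - x%:P)) separable_prod_XsubC.
rewrite map_inj_uniq ?index_enum_uniq // => k l; rewrite !mxE.
have zV i j : (z i)^-1 != z j.
  by rewrite -(inj_eq (mulfI (z0 i))) mulfV // eq_sym.
have z_inj i j : z i = z j -> i = j.
  by move=> e; have [//|/zn] := eqVneq i j; rewrite e eqxx.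
case: (coordP k) => i _; case: (coordP l) => j _; rewrite /= ?half_xcoord ?half_ycoord.
- by move/z_inj ->.
- by move/eqP; rewrite eq_sym (negbTE (zV _ _)).
- by move/eqP; rewrite (negbTE (zV _ _)).
- by move/invr_inj/z_inj ->.
Qed.

Lemma torus_regular_exists : exists z : 'I_r -> C, torus_regular z.
Proof.
have x_inj m m' : 2 ^+ m = 2 ^+ m' :> C -> m = m'.
  by apply: ieexprIn; rewrite ?ltr0n // gt_eqF // ltr1n.
exists (fun k => 2 ^+ k.+1); split=> [k|k l|k l kl].
- by rewrite expf_neq0 // pnatr_eq0.
- by rewrite -exprD -[1](expr0 2); apply/eqP => /x_inj.
- by apply: contra_neq kl => /x_inj [] /val_inj.
Qed.

End Separable.

Lemma lead_coef_deriv_monic (C : numFieldType) (p : {poly {poly C}}) m :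
  p \is monic -> size p = m.+2 -> lead_coef p^`() = m.+1%:R.
Proof.
move=> /monicP pm sp; have pm' : p^`()`_m = m.+1%:R.
  by rewrite coef_deriv; move: pm; rewrite lead_coefE sp /= => ->.
suff sp' : size p^`() = m.+1 by rewrite lead_coefE sp'.
apply/eqP; rewrite eqn_leq -[(_ <= _)%N]ltnS -sp lt_size_deriv -?size_poly_eq0 ?sp //=.
by rewrite ltnNge; apply/negP => /leq_sizeP/(_ m (leqnn _))/eqP;
  rewrite pm' -polyC_natr polyC_eq0 pnatr_eq0.
Qed.

(** * From regular elements to the whole group *)

Section Extension.
Variables (C : numClosedFieldType) (r : nat).

Definition mx_power N (g : 'M[C]_N) (k : int) : 'M[C]_N :=
  match k with
  | Posz m => g ^+ m
  | Negz m => invmx g ^+ m.+1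
  end.

(** Its determinant is the coordinate of the tensor at f, for the Weyl sum and for the wedge
    alike. *)
Definition alternant_mx N (g : 'M[C]_N) (l : 'rV[int]_r) (f : 'I_r -> 'I_N * 'I_N) :=
  \matrix_(i < r, j < r) (mx_power g (l 0 j) (f i).1 (f i).2
                          - mx_power g (- l 0 j) (f i).1 (f i).2).

Lemma mx_power_conj (g h : 'M[C]_r.*2) z k : g \in unitmx -> torus_pt z ->
  g *m h = h *m torus_elt z -> mx_power g k *m h = h *m torus_elt (fun i => z i ^ k).
Proof.
move=> gu z0 gh.
have pow (g' : 'M[C]_r.*2) z' m : g' *m h = h *m torus_elt z' ->
    g' ^+ m *m h = h *m torus_elt (fun i => z' i ^+ m).
  move=> g'h; elim: m => [|m IH].
    by rewrite expr0 mul1mx (eq_torus (w := fun=> 1)) // torus1 mulmx1.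
  rewrite exprS -[_ * _]/(g' *m _) -mulmxA IH mulmxA g'h -mulmxA torusM.
  by congr (_ *m _); apply: eq_torus => i; rewrite exprS.
case: k => m /=; first exact: pow.
rewrite (pow _ (fun i => (z i)^-1)).
  by congr (_ *m _); apply: eq_torus => i; rewrite exprVn.
rewrite -[h in LHS]mulmx1 -torus1 (eq_torus (w := fun i => z i * (z i)^-1)) => [|i];
  last by rewrite mulfV.
by rewrite -torusM !mulmxA -(mulmxA _ h) -gh mulKmx.
Qed.

(** The products of entries of h and its inverse are entries of the projections onto the eigenlines.
    The first determinant does not involve l, so it is common to lam + rho and rho. *)
Lemma alternant_conj (g h : 'M[C]_r.*2) z f l : g \in unitmx -> h \in unitmx -> torus_pt z ->
  g *m h = h *m torus_elt z ->
  \det (alternant_mx g l f) =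
  \det (\matrix_(i, m) (h (f i).1 (xcoord m) * invmx h (xcoord m) (f i).2
                        - h (f i).1 (ycoord m) * invmx h (ycoord m) (f i).2))
  * \det (\matrix_(i < r, j < r) (z i ^ l 0 j - z i ^ (- l 0 j))).
Proof.
move=> gu hu z0 gh; rewrite -det_mulmx; congr (\det _); apply/matrixP => i j.
have pwE k a b : mx_power g k a b = \sum_(m < r)
    (z m ^ k * (h a (xcoord m) * invmx h (xcoord m) b)
     + z m ^ (- k) * (h a (ycoord m) * invmx h (ycoord m) b)).
  have -> : mx_power g k = h *m torus_elt (fun i => z i ^ k) *m invmx h.
    by rewrite -(mx_power_conj _ gu z0 gh) mulmxK.
  rewrite -mulmxA mxE big_coord; apply: eq_bigr => m _ /=.
  by rewrite !torus_mul_coord invr_expz; ring.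
rewrite !mxE !pwE -sumrB; apply: eq_bigr => m _; rewrite !mxE opprK; ring.
Qed.

Lemma polyfun_alternant (M : 'M[{poly C}]_r.*2) f l :
  (forall t, in_Sp (eval_mx t M)) ->
  polyfun (fun t => \det (alternant_mx (eval_mx t M) l f)).
Proof.
move=> Ms; have pc := polyfun_closed C.
have pM i j : polyfun (fun t => eval_mx t M i j).
  by exists (M i j) => t; rewrite mxE.
have pV i j : polyfun (fun t => invmx (eval_mx t M) i j).
  apply: (fun_closed_ext pc (f := fun t =>
    - (skew_mx C r *m (eval_mx t M)^T *m skew_mx C r) i j)) => [t|].
    by rewrite (symplectic_inv (Ms t)) [RHS]mxE.
  apply: (fun_closedN pc).
  move: i j; apply: (fun_closed_mulmx pc) => [i j|i j]; last exact: (fun_closed_cst pc).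
  move: i j; apply: (fun_closed_mulmx pc) => [i j|i j]; first exact: (fun_closed_cst pc).
  by apply: (fun_closed_ext pc) (pM j i) => t; rewrite [RHS]mxE.
have pX (A : C -> 'M[C]_r.*2) m : (forall i j, polyfun (fun t => A t i j)) ->
    forall i j, polyfun (fun t => (A t ^+ m) i j).
  move=> pA; elim: m => [|m IH] i j; first exact: (fun_closed_cst pc).
  by have := fun_closed_mulmx pc pA IH i j; apply: (fun_closed_ext pc) => t; rewrite exprS.
have pP k i j : polyfun (fun t => mx_power (eval_mx t M) k i j).
  by case: k => m; apply: pX.
apply: (fun_closed_det pc) => i j.
have := fun_closedD pc (pP (l 0 j) (f i).1 (f i).2) (fun_closedN pc (pP (- l 0 j) (f i).1 (f i).2)).
by apply: (fun_closed_ext pc) => t; rewrite mxE.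
Qed.

Variables (n : nat) (rep : 'M[C]_r.*2 -> 'M[C]_n).
Hypothesis rep_sp : is_poly_rep rep.
Hypothesis rep_irr : is_irreducible_rep rep.

Definition has_weight (m : 'rV[int]_r) : Prop :=
  exists2 v : 'cV[C]_n, v != 0 &
    forall z : 'I_r -> C, (forall i, z i != 0) ->
      rep (torus_elt z) *m v = (\prod_(i < r) z i ^ m 0 i) *: v.

Variable lam : 'rV[int]_r.
Hypothesis lam_dom : dominant lam.
Hypothesis lam_weight : has_weight lam.
Hypothesis weight_le_lam : forall m, has_weight m -> weight_le m lam.

Lemma torus_conj_formula g h z f : in_Sp g -> in_Sp h -> torus_regular z ->
  g *m h = h *m torus_elt z ->
  \det (alternant_mx g (lam + weyl_vector r) f)
  = \tr (rep g) * \det (alternant_mx g (weyl_vector r) f).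
Proof.
move=> gs hs zreg gh; have [z0 _ _] := zreg.
have [B [mu [Bu dr]]] := diag_rep_exists rep_sp rep_irr.
(* The weights listed in the diagonalized form are weights of the original representation, so the
   bound by lam applies to them. *)
have muw j : has_weight (mu j).
  exists (invmx B *m delta_mx j 0).
    apply/eqP => /(congr1 (mulmx B)); rewrite mulKVmx // mulmx0 => /matrixP/(_ j 0)/eqP.
    by rewrite !mxE !eqxx oner_eq0.
  move=> w w0.
  have e : B *m rep (torus_elt w) *m invmx B = diag_mx (\row_k monomial w (mu k)) :=
    diag_rep_torus dr w0.
  have -> : rep (torus_elt w) *m (invmx B *m (delta_mx j 0 : 'cV_n))
      = invmx B *m (diag_mx (\row_k monomial w (mu k)) *m delta_mx j 0).
    by rewrite -e -!mulmxA mulKmx.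
  rewrite scalemxAr; congr (_ *m _); apply/colP => k; rewrite mul_diag_mx !mxE.
  by have [->|] := eqVneq k j; rewrite ?mulr0.
(* A highest weight vector has a nonzero coordinate in the weight basis; the weight of that basis
   vector must be lam. *)
have [j0 muj0] : exists j, mu j = lam.
  have [v v0 vP] := lam_weight.
  have : B *m v != 0 by apply: contraNneq v0 => e; rewrite -[v](mulKmx Bu) e mulmx0.
  move=> /cV0Pn[j vj]; exists j; apply: monomial_inj => w w0.
  have := congr1 (fun A => (B *m A) j 0) (vP w w0).
  rewrite -scalemxAr -{1}[v](mulKmx Bu) !mulmxA (diag_rep_torus dr w0).
  rewrite -[_ *m B *m v]mulmxA mul_diag_mx [in LHS]mxE [X in _ = X]mxE [X in X * _]mxE.
  by move=> /(mulIf vj).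
have mu_le j : pdom (mu j) lam by apply/weight_le_pdom/weight_le_lam.
have tr_g : \tr (rep g) = torus_char mu z.
  rewrite -(tr_torus dr zreg) [in RHS]mxtrace_mulC mulmxA mulVmx // mul1mx.
  have [_ repM _] := rep_sp.
  have e : rep g *m rep h = rep h *m rep (torus_elt z).
    by rewrite -!repM ?gh //; apply: torus_symplectic.
  have hV := rep_inv rep_sp hs.
  rewrite -[rep g]mulmx1 -hV mulmxA e mxtrace_mulC mulmxA.
  by rewrite (mulmx1C hV) mul1mx.
have ac := alternant_conj _ _ gs.1 hs.1 z0 gh.
rewrite !ac (torus_formula dr lam_dom muj0 mu_le zreg) tr_g /denominator.
by rewrite mulrCA.
Qed.

Lemma symplectic_formula g f : (0 < r)%N -> in_Sp g ->
  \det (alternant_mx g (lam + weyl_vector r) f)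
  = \tr (rep g) * \det (alternant_mx g (weyl_vector r) f).
Proof.
move=> r0 gs; have [z0 z0reg] := torus_regular_exists C r.
have ts : in_Sp (torus_elt z0) by apply: torus_symplectic; case: z0reg.
have [M [Ms M0 M1]] := symplectic_curve gs ts.
(* Up to sign, the discriminant of the characteristic polynomial along the curve; it is nonzero at t
   = 1, where the curve reaches the regular torus element. *)
pose q : {poly C} := resultant (char_poly M) (char_poly M)^`().
have qE t : q.[t] = resultant (char_poly (eval_mx t M)) (char_poly (eval_mx t M))^`().
  rewrite -map_char_poly deriv_map -[q.[t]]/(horner_eval t q) map_resultant //.
    by rewrite (monicP (char_poly_monic _)) rmorph1 oner_eq0.
  (* The resultant commutes with evaluation at t as long as the leading coefficients survive; they
     are 1 and 2r, and r is positive. *)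
  rewrite (@lead_coef_deriv_monic _ _ r.*2.-1) ?char_poly_monic ?size_char_poly ?prednK
    ?double_gt0 //.
  by rewrite rmorph_nat pnatr_eq0 -lt0n ?double_gt0.
have sepE t : (q.[t] != 0) = separable_poly (char_poly (eval_mx t M)).
  rewrite qE resultant_eq0 -leqNgt unlock /coprimep eqn_leq lt0n size_poly_eq0 gcdp_eq0.
  by rewrite negb_and (monic_neq0 (char_poly_monic _)) andbT.
have q0 : q != 0.
  suff : q.[1] != 0 by apply: contraNneq => ->; rewrite horner0.
  by rewrite sepE M1 torus_separable.
rewrite -M0.
apply: (polyfun_eq (phi := fun t => \det (alternant_mx (eval_mx t M) (lam + weyl_vector r) f))
  (psi := fun t => \tr (rep (eval_mx t M)) * \det (alternant_mx (eval_mx t M) (weyl_vector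
    r) f)) _ _ q0).
- exact: polyfun_alternant.
- have pc := polyfun_closed C.
  apply: (fun_closedM pc); last exact: polyfun_alternant.
  apply: (fun_closed_sum pc) => i; have [_ _ repP] := rep_sp; have [P PE] := repP i i.
  apply: (fun_closed_ext pc (f := fun t => mpoly.meval (fun k => mxvec (eval_mx t M) 0 k) P)).
    by move=> t; rewrite PE.
  apply: (fun_closed_meval pc) => k; case/mxvec_indexP: k => a b.
  by exists (M a b) => t; rewrite mxvecE mxE.
move=> t qt.
have := qt; rewrite sepE => /(separable_torus_conj (Ms t))[z [h [zreg hs gh]]].
exact: torus_conj_formula hs zreg gh.
Qed.

End Extension.

Lemma weyl_sum_tensor (R : realType) (r : nat) (g : 'M[complex R]_r.*2) (l : 'rV[int]_r) f :
  (\sum_(w : weyl_group r) (weyl_sign w)%:~R *: mx_multipower g (weyl_act w l)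
    : tensor_power R r r.*2) f
  = \det (@alternant_mx (complex R) r r.*2 g l f).
Proof.
rewrite sum_ffunE -(@weyl_sum_det r (complex R) (fun i k => mx_exprz g k (f i).1 (f i).2)).
by apply: eq_bigr => w _; rewrite !ffunE.
Qed.

Lemma wedge_tensor (R : realType) (r N : nat) (A : 'I_r -> 'M[complex R]_N) f :
  wedge A f = \det (\matrix_(i < r, j < r) A j (f i).1 (f i).2).
Proof.
rewrite sum_ffunE; apply: eq_bigr => s _; rewrite !ffunE; congr (_ * _).
by apply: eq_bigr => i _; rewrite mxE.
Qed.

Unset Implicit Arguments.

Theorem theorem4p1 (R : realType) (r : nat) (r_ge1 : (1 <= r)%N)
    (lambda : 'rV[int]_r)
    (lambda_ge0 : forall i : 'I_r, 0 <= lambda 0 i)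
    (lambda_noninc : forall i j : 'I_r, (i <= j)%N -> lambda 0 j <= lambda 0 i)
    (n : nat) (rep : 'M[complex R]_r.*2 -> 'M[complex R]_n)
    (rep_sp : sp_representation rep)
    (rep_irr : sp_irreducible rep)
    (rep_hw : highest_weight rep lambda)
    (g : 'M[complex R]_r.*2) (g_sp : symplectic g) :
  let l := lambda + weyl_vector r in
  (\sum_(w : weyl_group r)
      (weyl_sign w)%:~R *: mx_multipower g (weyl_act w l)
   = rep_character rep g *:
     \sum_(w : weyl_group r)
        (weyl_sign w)%:~R *: mx_multipower g (weyl_act w (weyl_vector r)))
  /\
  (wedge (fun i : 'I_r => mx_exprz g (l 0 i) - mx_exprz g (- l 0 i))
   = rep_character rep g *:
     wedge (fun i : 'I_r => mx_exprz g (r%:Z - i%:Z)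
                            - mx_exprz g (- (r%:Z - i%:Z)))).
Proof.
move=> l.
have key f : \det (@alternant_mx (complex R) r r.*2 g l f)
    = rep_character rep g * \det (@alternant_mx (complex R) r r.*2 g (weyl_vector r) f).
  have [lam_wt lam_max] := rep_hw.
  by apply: (@symplectic_formula (complex R) r n rep rep_sp rep_irr lambda
    (conj lambda_noninc lambda_ge0) lam_wt lam_max g f r_ge1 g_sp).
split; apply/ffunP => f; rewrite [RHS]ffunE.
  exact: etrans (@weyl_sum_tensor _ _ _ _ _)
    (etrans (key f) (congr1 _ (esym (@weyl_sum_tensor _ _ _ _ _)))).
apply: etrans (@wedge_tensor _ _ _ _ _) _.
apply: etrans (etrans _ (key f)) (congr1 _ (etrans _ (esym (@wedge_tensor _ _ _ _ _)))).
  by congr (\det _); apply/matrixP => i j; rewrite !mxE.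
by congr (\det _); apply/matrixP => i j; rewrite !mxE.
Qed.
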